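(* Let $\Omega\subset\mathbb{R}^n$ be open and let $u_r=(u_r^1,\ldots,u_r^N)\in L^2_{loc}(\Omega,\mathbb{C}^N)$, $r\in\mathbb{N}$, converge weakly in $L^2_{loc}(\Omega,\mathbb{C}^N)$ to a vector-function $u(x)$ as $r\to\infty$. Let $p_{s\alpha k}(\xi)\in A$, $c_{s\alpha k}(x)\in C(\Omega)$ for $s=1,\ldots,m$, $\alpha=1,\ldots,N$, $k=1,\ldots,M$, and suppose that for each $\Phi(x)\in C_0^\infty(\Omega)$ and each $s=1,\ldots,m$ the sequence (in $r$) $$\sum_{\alpha=1}^N\sum_{k=1}^M c_{s\alpha k}(x)\,p_{s\alpha k}(\partial/\partial x)(\Phi(x)u_r^\alpha(x))$$ is precompact in $L^2_{loc}(\Omega)$. For $x\in\Omega$ put $$\Lambda(x)=\Bigl\{\lambda\in\mathbb{C}^N\ \Big|\ \exists\,\eta\in\mathcal{S}:\ \sum_{\alpha=1}^N\sum_{k=1}^M c_{s\alpha k}(x)\,\widehat{p_{s\alpha k}}(\eta)\,\lambda_\alpha=0\ \ \forall s=1,\ldots,m\Bigr\}.$$ Let $q(x,u)=\sum_{\alpha,\beta=1}^N q_{\alpha\beta}(x)u_\alpha\overline{u_\beta}$ be an Hermitian form on $\mathbb{C}^N$ with coefficients $q_{\alpha\beta}(x)\in C(\Omega)$, and suppose that $q(x,u_r)\rightharpoonup v$ as $r\to\infty$ weakly in $M_{loc}(\Omega)$. If $q(x,\lambda)\ge 0$ for all $\lambda\in\Lambda(x)$, $x\in\Omega$, then $q(x,u(x))\le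 v$ in the sense of measures.
   Context: $F(u)(\xi)=\int_{\mathbb{R}^n}e^{-2\pi i\xi\cdot x}u(x)\,dx$ is the Fourier transformation extended as a unitary operator on $L^2(\mathbb{R}^n)$. $C_0(Y)$ denotes the space of continuous complex-valued functions on $Y$ with compact support; functions supported in $\Omega$ are extended by zero to $\mathbb{R}^n$. $M_{loc}(\Omega)$ is the space of locally finite (Radon) measures on $\Omega$, with weak convergence tested against $C_0(\Omega)$; a locally integrable function $f$ is identified with the measure $f\,dx$. For $\Phi(x),\psi(\xi)\in L^\infty(\mathbb{R}^n)$ let $B_\Phi$, $A_\psi$ be the bounded operators on $L^2(\mathbb{R}^n)$ given by $B_\Phi u=\Phi u$ and $F(A_\psi u)(\xi)=\psi(\xi)F(u)(\xi)$. Let $A$ be the subalgebra of $L^\infty(\mathbb{R}^n)$ consisting of those $\psi$ for which the commutators $[A_\psi,B_\Phi]$ are compact operators in $L^2(\mathbb{R}^n)$ for all $\Phi\in C_0(\mathbb{R}^n)$. For $p\in A$, $p(\partial/\partial x)$ denotes the pseudo-differential operator $A_p$ with symbol $p(\xi)$. Let $A_0$ be the subspace of $\psi\in L^\infty(\mathbb{R}^n)$ with $\operatorname{ess\,lim}_{|\xi|\to\infty}\psi(\xi)=0$; it is a closed ideal in $A$. $\mathcal{A}=A/A_0$ is the quotient algebra, a commutative $C^*$-algebra (involution: complex conjugation) with norm $\|\psi\|=\lim_{R\to\infty}\operatorname{ess\,sup}_{|\xi|>R}|\psi(\xi)|$; a class is identified with a representative $\psi(\xi)$. $\mathcal{S}$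 is the (compact Hausdorff) spectrum of $\mathcal{A}$ and $\hat\psi\in C(\mathcal{S})$ is the Gelfand transform of (the class of) $\psi$. *)

(* Defs.v *)
From HB Require Import structures.
From mathcomp Require Import all_boot all_order all_algebra.
From mathcomp Require Import all_classical all_reals all_analysis.
From mathcomp Require Import complex.

Set Implicit Arguments.
Unset Strict Implicit.
Unset Printing Implicit Defensive.

Import Order.TTheory GRing.Theory Num.Theory.
Import numFieldNormedType.Exports.

Local Open Scope classical_set_scope.
Local Open Scope ring_scope.

(* R^n is 'rV[R]_n.  The product of n copies of the Borel sigma-algebra of R
   is the Borel sigma-algebra of R^n. *)
Definition rV_display : measure_display.
Proof. exact: default_measure_display. Qed.

Section rV_measurable.
Context {R : realType} (n : nat).

Definition rV_coord (i : 'I_n) (x : 'rV[R]_n) : measurableTypeR R := x 0 i.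

Let rV_set0 : g_sigma_preimage rV_coord set0.
Proof. exact: sigma_algebra0. Qed.

Let rV_setC A : g_sigma_preimage rV_coord A -> g_sigma_preimage rV_coord (~` A).
Proof. exact: sigma_algebraC. Qed.

Let rV_bigcup (F : _^nat) : (forall i, g_sigma_preimage rV_coord (F i)) ->
  g_sigma_preimage rV_coord (\bigcup_i (F i)).
Proof. exact: sigma_algebra_bigcup. Qed.

HB.instance Definition _ := @isMeasurable.Build rV_display 'rV[R]_n
  (g_sigma_preimage rV_coord) rV_set0 rV_setC rV_bigcup.

End rV_measurable.

Section rV_measurable_lemmas.
Context {R : realType}.

Lemma measurable_rV_coord n (i : 'I_n) :
  measurable_fun [set: 'rV[R]_n] (fun x : 'rV[R]_n => x 0 i).
Proof.
move=> _ Y mY; rewrite setTI; apply: sub_sigma_algebra => /=.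
rewrite -bigcup_seq/=; exists i => /=; first by rewrite mem_index_enum.
by exists Y => //; rewrite setTI.
Qed.

Lemma measurable_fun_rVP d (T : measurableType d) n (f : T -> 'rV[R]_n) :
  measurable_fun [set: T] f <->
  forall i, measurable_fun [set: T] (fun x => f x 0 i).
Proof.
split=> [mf i|mf].
  exact: (measurableT_comp (measurable_rV_coord i)).
move=> _ A mA; rewrite setTI.
suff : preimage_set_system setT f
    (g_sigma_preimage (@rV_coord R n)) `<=` measurable.
  by apply; exists A => //; rewrite setTI.
rewrite -g_sigma_preimage_comp; apply: smallest_sub.
  exact: sigma_algebra_measurable.
rewrite -bigcup_seq => B [i _] [C mC <-].
exact: mf.
Qed.

Definition rV_cons n (p : R * 'rV[R]_n) : 'rV[R]_n.+1 :=
  row_mx (p.1%:M : 'rV_1) p.2.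

Definition rV_uncons n (x : 'rV[R]_n.+1) : R * 'rV[R]_n :=
  (x 0 ord0, \row_i x 0 (lift ord0 i)).

Lemma rV_consK n : cancel (@rV_cons n) (@rV_uncons n).
Proof.
move=> [a x]; rewrite /rV_uncons /rV_cons/=; congr (_, _).
  by rewrite mxE; case: splitP => // j _; rewrite mxE !ord1 eqxx mulr1n.
apply/rowP => i; rewrite !mxE; case: splitP => [j|j [ij]]; first by rewrite ord1.
by congr (x _ _); exact/val_inj.
Qed.

Lemma rV_unconsK n : cancel (@rV_uncons n) (@rV_cons n).
Proof.
move=> x; apply/rowP => i.
have [j ->|->] := unliftP ord0 i; last first.
  by have /(congr1 fst) := rV_consK (rV_uncons x).
have /(congr1 snd)/rowP/(_ j) := rV_consK (rV_uncons x).
by rewrite !mxE.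
Qed.

Lemma measurable_rV_cons n : measurable_fun setT (@rV_cons n).
Proof.
apply/measurable_fun_rVP => i.
have [j ->|->] := unliftP ord0 i; last first.
  rewrite (_ : (fun _ => _) = fst); first exact: measurable_fst.
  by apply/funext => p; have /(congr1 fst) := rV_consK p.
rewrite (_ : (fun _ => _) = (fun x : 'rV[R]_n => x 0 j) \o snd).
  exact: measurableT_comp (measurable_rV_coord j) measurable_snd.
apply/funext => p /=.
by have /(congr1 snd)/rowP/(_ j) := rV_consK p; rewrite mxE.
Qed.

Lemma measurable_rV_uncons n : measurable_fun setT (@rV_uncons n).
Proof.
apply/measurable_fun_pairP; split; first exact: measurable_rV_coord.
apply/measurable_fun_rVP => i /=.
rewrite [X in measurable_fun _ X](_ : _ =
    fun x : 'rV[R]_n.+1 => x 0 (lift ord0 i)).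
  exact: measurable_rV_coord.
by apply/funext => x; rewrite /= mxE.
Qed.

End rV_measurable_lemmas.

Section lebesgue_rV.
Context {R : realType}.

Section step.
Variables (n : nat) (m : {sigma_finite_measure set 'rV[R]_n -> \bar R}).

Definition leb_step : set 'rV[R]_n.+1 -> \bar R :=
  pushforward (@lebesgue_measure R \x m)%E (@rV_cons R n).

Let leb_step0 : leb_step set0 = 0%E.
Proof. by rewrite /leb_step /pushforward preimage_set0 measure0. Qed.

Let leb_step_ge0 A : (0 <= leb_step A)%E.
Proof. by rewrite /leb_step /pushforward; apply: measure_ge0. Qed.

Let mpre A : measurable A -> measurable (@rV_cons R n @^-1` A).
Proof. by rewrite -[X in _ -> measurable X]setTI; exact: measurable_rV_cons. Qed.

Let leb_step_sigma_additive : semi_sigma_additive leb_step.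
Proof.
move=> F mF tF mUF; rewrite /leb_step /pushforward preimage_bigcup.
apply: measure_semi_sigma_additive => [k||]; first exact: mpre.
- apply/trivIsetP => /= i j _ _ ij; rewrite -preimage_setI.
  by move/trivIsetP : tF => /(_ _ _ _ _ ij) ->//; rewrite preimage_set0.
- by rewrite -preimage_bigcup; exact: mpre.
Qed.

HB.instance Definition _ := isMeasure.Build _ _ _ leb_step
  leb_step0 leb_step_ge0 leb_step_sigma_additive.

Let leb_step_sigma_finite : sigma_finite setT leb_step.
Proof.
have /sigma_finiteP[F [TF ndF Foo]] := sigma_finiteT (@lebesgue_measure R).
have /sigma_finiteP[G [TG ndG Goo]] := sigma_finiteT m.
exists (fun k => @rV_uncons R n @^-1` (F k `*` G k)).
  rewrite predeqE => x; split=> // _.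
  have [k _ Fk] : (\bigcup_i F i) (rV_uncons x).1 by rewrite -TF.
  have [l _ Gl] : (\bigcup_i G i) (rV_uncons x).2 by rewrite -TG.
  exists (maxn k l) => //; split.
    by move: Fk; exact/subsetPset/ndF/leq_maxl.
  by move: Gl; exact/subsetPset/ndG/leq_maxr.
move=> k; have [mF Fk] := Foo k; have [mG Gk] := Goo k; split.
  rewrite -[X in measurable X]setTI; apply: measurable_rV_uncons => //.
  exact: measurableX.
rewrite /leb_step /pushforward -comp_preimage.
rewrite [X in X @^-1` _](_ : _ = idfun); last first.
  by apply/funext => p; exact: rV_consK.
by rewrite preimage_id product_measure1E// lte_mul_pinfty// ge0_fin_numE.
Qed.

HB.instance Definition _ := Measure_isSigmaFinite.Build _ _ _ leb_step
  leb_step_sigma_finite.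

End step.

(* Lebesgue measure on R^n: the n-fold product of that of R. *)
Fixpoint leb (n : nat) : {sigma_finite_measure set 'rV[R]_n -> \bar R} :=
  if n is k.+1 then leb_step (leb k) else \d_(0 : 'rV[R]_0).

End lebesgue_rV.

Local Open Scope complex_scope.

Section complex_valued.
Context {R : realType} {n : nat}.
Local Notation Rn := 'rV[R]_n.
Local Notation C := R[i].
Implicit Types (D K Omega : set Rn) (f g u psi Phi : Rn -> C).

(* Borel measurability, continuity, convergence and integration of C-valued
   objects are taken on real and imaginary parts. *)
Definition cmeasurable D f :=
  measurable_fun D (fun x => complex.Re (f x)) /\
  measurable_fun D (fun x => complex.Im (f x)).

Definition ccontinuous D f :=
  {within D, continuous (fun x => complex.Re (f x))} /\
  {within D, continuous (fun x => complex.Im (f x))}.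

Definition ccvg (z : nat -> C) (l : C) :=
  (complex.Re (z k) @[k --> \oo] --> complex.Re l) /\
  (complex.Im (z k) @[k --> \oo] --> complex.Im l).

Definition cint (mu : {measure set Rn -> \bar R}) D f : C :=
  (\int[mu]_(x in D) complex.Re (f x)) +i* (\int[mu]_(x in D) complex.Im (f x)).

(* The Lebesgue spaces below are spaces of functions, not of classes of
   functions; L2sq D f is the square of the norm of f in L^2(D). *)
Definition L1 f := cmeasurable setT f /\
  (\int[leb n]_x (Normc.normc (f x))%:E < +oo)%E.

Definition L2sq D f : \bar R :=
  (\int[leb n]_(x in D) (Normc.normc (f x) ^+ 2)%:E)%E.

Definition L2 f := cmeasurable setT f /\ (L2sq setT f < +oo)%E.

Definition Linfty f := cmeasurable setT f /\
  exists M : R, {ae leb n, forall x, Normc.normc (f x) <= M}.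

Definition L2loc Omega f := cmeasurable Omega f /\
  forall K, compact K -> K `<=` Omega -> (L2sq K f < +oo)%E.

Definition L2_cvg D (f_ : nat -> Rn -> C) f :=
  L2sq D (f_ k \- f) @[k --> \oo] --> 0%E.

Definition L2loc_cvg Omega (f_ : nat -> Rn -> C) f :=
  forall K, compact K -> K `<=` Omega -> L2_cvg K f_ f.

(* The dual of L^2_loc(Omega) is the space of the functions of L^2(Omega) with
   compact support in Omega. *)
Definition L2loc_weak_cvg Omega (f_ : nat -> Rn -> C) f :=
  forall g K, L2 g -> compact K -> K `<=` Omega ->
    (forall x, ~ K x -> g x = 0) ->
    ccvg (fun k => cint (leb n) Omega (fun x => f_ k x * (g x)^*))
         (cint (leb n) Omega (fun x => f x * (g x)^*)).

Definition L2loc_precompact Omega (f_ : nat -> Rn -> C) :=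
  forall s : nat -> nat, {homo s : i j / (i < j)%N} ->
  exists2 t : nat -> nat, {homo t : i j / (i < j)%N} &
  exists2 f, L2loc Omega f & L2loc_cvg Omega (fun k => f_ (s (t k))) f.

Definition csupport f : set Rn := closure [set x | f x != 0].

(* C_0(Omega): continuous functions with compact support in Omega *)
Definition C0 Omega f :=
  [/\ ccontinuous setT f, compact (csupport f) & csupport f `<=` Omega].

Fixpoint partial (s : seq 'I_n) (f : Rn -> R) : Rn -> R :=
  if s is i :: s' then 'D_(delta_mx 0 i : Rn) (partial s' f) else f.

Definition smooth (f : Rn -> R) := forall s : seq 'I_n,
  continuous (partial s f) /\
  forall (i : 'I_n) (x : Rn), derivable (partial s f) x (delta_mx 0 i).

Definition C0infty Omega f :=
  [/\ C0 Omega f, smooth (fun x => complex.Re (f x)) &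
      smooth (fun x => complex.Im (f x))].

Definition dotp (x y : Rn) : R := \sum_i x 0 i * y 0 i.

Definition fourier_int u : Rn -> C := fun xi =>
  cint (leb n) setT (fun x =>
    let t := - 2 * pi * dotp xi x in (cos t +i* sin t) * u x).

(* The graph of the extension by continuity, from L^1 `&` L^2 to L^2, of the
   Fourier integral. *)
Definition is_fourier u v := [/\ L2 u, L2 v &
  exists2 w_ : nat -> Rn -> C, forall k, L1 (w_ k) /\ L2 (w_ k) &
    L2_cvg setT w_ u /\ L2_cvg setT (fun k => fourier_int (w_ k)) v].

Definition fourier u : Rn -> C := xget (fun=> 0) [set v | is_fourier u v].

Definition multB Phi u : Rn -> C := Phi \* u.

Definition psdoA psi u : Rn -> C := xget (fun=> 0)
  [set w | L2 w /\
    {ae leb n, forall xi, fourier w xi = psi xi * fourier u xi}].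

Definition commutator (S T : (Rn -> C) -> Rn -> C) u : Rn -> C :=
  S (T u) \- T (S u).

Definition compact_operator (T : (Rn -> C) -> Rn -> C) :=
  forall u_ : nat -> Rn -> C, (forall k, L2 (u_ k)) ->
    (exists M : R, forall k, (L2sq setT (u_ k) <= M%:E)%E) ->
  exists2 s : nat -> nat, {homo s : i j / (i < j)%N} &
  exists2 v, L2 v & L2_cvg setT (fun k => T (u_ (s k))) v.

Definition algA : set (Rn -> C) := [set psi | Linfty psi /\
  forall Phi, C0 setT Phi -> compact_operator (commutator (psdoA psi) (multB Phi))].

Definition enorm (x : Rn) : R := Num.sqrt (dotp x x).

Definition idealA0 : set (Rn -> C) := [set psi | Linfty psi /\
  forall e : R, 0 < e -> exists r : R,
    {ae leb n, forall xi, r < enorm xi -> Normc.normc (psi xi) < e}].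

(* An element of the quotient algebra A / A_0 is the set of its
   representatives. *)
Definition classA psi : set (Rn -> C) :=
  [set phi | algA phi /\ idealA0 (phi \- psi)].

(* The points of the spectrum of A / A_0: its nonzero multiplicative linear
   functionals. *)
Record character (eta : set (Rn -> C) -> C) : Prop := Character {
  characterD : forall phi psi, algA phi -> algA psi ->
    eta (classA (phi \+ psi)) = eta (classA phi) + eta (classA psi) ;
  characterZ : forall (a : C) psi, algA psi ->
    eta (classA (fun xi => a * psi xi)) = a * eta (classA psi) ;
  characterM : forall phi psi, algA phi -> algA psi ->
    eta (classA (phi \* psi)) = eta (classA phi) * eta (classA psi) ;
  character_neq0 : exists2 psi, algA psi & eta (classA psi) != 0 }.

Definition spectrum : set (set (Rn -> C) -> C) := [set eta | character eta].

Definition gelfand psi (eta : set (Rn -> C) -> C) : C := eta (classA psi).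

(* A real element of M_loc(Omega), presented as the difference of two positive
   Borel measures that are finite on the compact subsets of Omega; only their
   values on subsets of Omega are ever used. *)
Record Mloc Omega := MLoc {
  Mpos : {measure set Rn -> \bar R} ;
  Mneg : {measure set Rn -> \bar R} ;
  Mpos_fin : forall K, compact K -> K `<=` Omega -> (Mpos K < +oo)%E ;
  Mneg_fin : forall K, compact K -> K `<=` Omega -> (Mneg K < +oo)%E }.

Definition Mloc_pairing Omega (v : Mloc Omega) Phi : C :=
  cint (Mpos v) Omega Phi - cint (Mneg v) Omega Phi.

Definition Mloc_val Omega (v : Mloc Omega) (B : set Rn) : R :=
  fine (Mpos v B) - fine (Mneg v B).

(* f_ k dx --> v, weakly in M_loc(Omega) *)
Definition Mloc_weak_cvg Omega (f_ : nat -> Rn -> C) (v : Mloc Omega) :=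
  forall Phi, C0 Omega Phi ->
    ccvg (fun k => cint (leb n) Omega (f_ k \* Phi)) (Mloc_pairing v Phi).

(* f dx <= v; a locally finite signed measure takes values on relatively
   compact sets only, and <= on C also says that the left-hand side is real. *)
Definition Mloc_ge_density Omega f (v : Mloc Omega) :=
  forall B K, measurable B -> compact K -> K `<=` Omega -> B `<=` K ->
    cint (leb n) B f <= (Mloc_val v B)%:C.

End complex_valued.

Section compensated_compactness.
Context {R : realType} {n N : nat}.
Local Notation Rn := 'rV[R]_n.
Local Notation C := R[i].

Definition LambdaSet m M (p c : 'I_m -> 'I_N -> 'I_M -> Rn -> C) (x : Rn)
    : set 'rV[C]_N :=
  [set lambda | exists2 eta, spectrum eta & forall s,
    \sum_alpha \sum_k c s alpha k x * gelfand (p s alpha k) eta * lambda 0 alpha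
      = 0].

Definition hform (q : 'I_N -> 'I_N -> Rn -> C) (x : Rn) (u : 'rV[C]_N) : C :=
  \sum_alpha \sum_beta q alpha beta x * u 0 alpha * (u 0 beta)^*.

End compensated_compactness.

(* Main.v *)
(* Put w_r = u_r - u.  Expanding the form, the weak limit of q(x, u_r) - q(x, w_r) is q(x, u), so
   everything reduces to lim \int phi q(x, w_r) >= 0 for continuous compactly supported phi >= 0.

   Freeze the coefficients at x0 and let P_s(xi) be the resulting symbols.  For every delta > 0
   there is k such that
     q(x0, l) >= - delta |l|^2 - k \sum_s |P_s(xi) l|^2   for a.e. |xi| > k and all l in C^N.
   Otherwise the sets of pairs (xi, l), |l| = 1, violating this for k = 0, 1, ... generate, modulo
   null sets, a proper filter; limits along an ultrafilter refining it define a character of A / A_0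
   and a vector l in Lambda(x0) with q(x0, l) <= - delta.

   Apply the inequality to the Fourier transform of W = sqrt(phi) w_r, with phi supported near x0,
   and integrate.  W is weakly null with bounded support, so its low frequencies vanish in the limit
   by dominated convergence.  Writing sqrt(phi) = b chi with chi a smooth bump, p(D) W differs from
   b p(D)(chi w_r) by a compact operator applied to a weakly null sequence, which tends to 0 in
   norm; and \sum c(x) b p(D)(chi w_r) is weakly null and precompact, hence also tends to 0.  So
   P_s(D) W is small up to the oscillation of the coefficients near x0.  A partition of phi
   subordinate to a finite cover globalizes the estimate, and regularity of Borel measures turns the
   inequality between integrals of test functions into one between measures of Borel sets.

   Plancherel's theorem is obtained from the Poisson kernel, which is the transform of
   \prod_i exp(- e |xi_i|), and by testing Fourier inversion on indicators of boxes. *)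
From HB Require Import structures.
From mathcomp Require Import all_boot all_order all_algebra.
From mathcomp Require Import all_classical all_reals all_analysis.
From mathcomp Require Import measurable_realfun complex ring lra.

Set Implicit Arguments.
Unset Strict Implicit.
Unset Printing Implicit Defensive.

Import Order.TTheory GRing.Theory Num.Theory.
Import numFieldNormedType.Exports.
Require Import Defs.

Local Open Scope classical_set_scope.
Local Open Scope ring_scope.
Local Open Scope complex_scope.

(** The precompactness hypothesis speaks of smooth [Phi] only, whereas the square root of a test
    function is merely continuous. Hence a smooth [bump], positive exactly on an open box, is
    divided out: for [phi] supported inside the box, [b = sqrt(phi) / bump] is continuous with
    compact support, and commuting [b] with [p(D)] costs only compact operators, by the very
    definition of A. This is the one analytic use of A; its algebra structure serves only to make
    the limits along the ultrafilter a character.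

    A character must give a value to every class of A at once, and no single sequence of frequencies
    along which all symbols converge is at hand; this is why an ultrafilter is used. The same
    integer [k] bounds the frequencies from below and weighs the constraints, so that the
    exceptional sets decrease with [k].

    Functions are not identified almost everywhere: [fourier] and [psdoA] choose representatives, so
    their linearity and composition rules hold almost everywhere only, and the lemmas on compact
    operators are stated accordingly. *)

Notation normc := Normc.normc.
Notation Re := (@complex.Re _).
Notation Im := (@complex.Im _).

(** * Complex-valued integrals *)

Section complex_modulus.
Local Notation "x ^*" := (conjc x) : ring_scope.
Context {R : realType}.
Implicit Types z w : R[i].

Lemma sqr_normcE z : normc z ^+ 2 = Re z ^+ 2 + Im z ^+ 2.
Proof. by case: z => a b /=; rewrite sqr_sqrtr// addr_ge0// sqr_ge0. Qed.

Lemma normc_ge0 z : 0 <= normc z.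
Proof. by case: z => a b /=; exact: sqrtr_ge0. Qed.

Lemma normc_conj z : normc z^* = normc z.
Proof. by case: z => a b /=; rewrite sqrrN. Qed.

Lemma normc_real (x : R) : normc x%:C = `|x|.
Proof. by rewrite /= expr0n/= addr0 sqrtr_sqr. Qed.

Lemma normc_Re z : `|Re z| <= normc z.
Proof.
by case: z => a b /=; rewrite -sqrtr_sqr ler_wsqrtr// lerDl sqr_ge0.
Qed.

Lemma normc_Im z : `|Im z| <= normc z.
Proof.
by case: z => a b /=; rewrite -sqrtr_sqr ler_wsqrtr// lerDr sqr_ge0.
Qed.

Lemma normc_le z : normc z <= `|Re z| + `|Im z|.
Proof.
have : 0 <= `|Re z| + `|Im z| by rewrite addr_ge0.
move=> h; rewrite -(@ler_pXn2r _ 2) ?nnegrE ?normc_ge0//.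
rewrite sqr_normcE sqrrD !real_normK ?num_real// addrAC lerDl.
by rewrite pmulrn_lge0// mulr_ge0.
Qed.

Lemma mulcC_normc z : z * z^* = (normc z ^+ 2)%:C.
Proof.
by rewrite sqr_normcE; case: z => a b; apply/eqP; rewrite eq_complex/=; apply/andP;
  split; apply/eqP; ring.
Qed.

Lemma conjcD z w : (z + w)^* = z^* + w^*. Proof. exact: rmorphD. Qed.
Lemma conjcB z w : (z - w)^* = z^* - w^*. Proof. exact: rmorphB. Qed.
Lemma conjcM z w : (z * w)^* = z^* * w^*. Proof. exact: rmorphM. Qed.

Lemma cReD z w : Re (z + w) = Re z + Re w.
Proof. by case: z w => ? ? []. Qed.
Lemma cImD z w : Im (z + w) = Im z + Im w.
Proof. by case: z w => ? ? []. Qed.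
Lemma cReN z : Re (- z) = - Re z. Proof. by case: z. Qed.
Lemma cImN z : Im (- z) = - Im z. Proof. by case: z. Qed.
Lemma cReB z w : Re (z - w) = Re z - Re w.
Proof. by rewrite cReD cReN. Qed.
Lemma cImB z w : Im (z - w) = Im z - Im w.
Proof. by rewrite cImD cImN. Qed.
Lemma cReM z w : Re (z * w) = Re z * Re w - Im z * Im w.
Proof. by case: z w => ? ? []. Qed.
Lemma cImM z w : Im (z * w) = Re z * Im w + Im z * Re w.
Proof. by case: z w => ? ? []. Qed.
Lemma cReC z : Re (z^*) = Re z. Proof. by case: z. Qed.
Lemma cImC z : Im (z^*) = - Im z. Proof. by case: z. Qed.
Definition ReImE := (cReB, cImB, cReD, cImD, cReN, cImN, cReM, cImM, cReC, cImC).

Lemma complex_ext z w : Re z = Re w -> Im z = Im w -> z = w.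
Proof. by case: z w => ? ? [? ?] /= -> ->. Qed.

Lemma normcD_sqr z w : normc (z + w) ^+ 2 <= 2 * (normc z ^+ 2 + normc w ^+ 2).
Proof.
rewrite !sqr_normcE !ReImE -subr_ge0.
rewrite [leRHS](_ : _ = (Re z - Re w) ^+ 2 + (Im z - Im w) ^+ 2); last by ring.
by rewrite addr_ge0// sqr_ge0.
Qed.

Lemma normcM_le z w : normc (z * w) <= (normc z ^+ 2 + normc w ^+ 2) / 2.
Proof.
rewrite Normc.normcM; have := sqr_ge0 (normc z - normc w).
by rewrite sqrrB; lra.
Qed.

End complex_modulus.

Section complex_integral.
Local Notation "x ^*" := (conjc x) : ring_scope.
Context d (T : measurableType d) {R : realType}.
Variable mu : {measure set T -> \bar R}.
Implicit Types f g : T -> R[i].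

Definition cmeas f := measurable_fun setT (fun x => Re (f x)) /\
  measurable_fun setT (fun x => Im (f x)).

Definition cinteg f := mu.-integrable setT (EFin \o (fun x => Re (f x))) /\
  mu.-integrable setT (EFin \o (fun x => Im (f x))).

(** Always over the whole space, so that Fubini's theorem carries no domain. It is convertible to
    [cint mu setT]; [cint_cI] relates it to [cint] over [Omega] for integrands vanishing off
    [Omega]. *)
Definition cI f : R[i] := (\int[mu]_x Re (f x)) +i* (\int[mu]_x Im (f x)).

Lemma integrableD_EFin (f g : T -> R) : mu.-integrable setT (EFin \o f) ->
  mu.-integrable setT (EFin \o g) ->
  mu.-integrable setT (EFin \o (fun x => f x + g x)).
Proof.
move=> fi gi; have := integrableD measurableT fi gi.
by apply: eq_integrable => // x _ /=; rewrite EFinD.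
Qed.

Lemma integrableZ_EFin (k : R) (f : T -> R) : mu.-integrable setT (EFin \o f) ->
  mu.-integrable setT (EFin \o (fun x => k * f x)).
Proof.
move=> fi; have := integrableZl measurableT k fi.
by apply: eq_integrable => // x _ /=; rewrite EFinM.
Qed.

Lemma cmeasD f g : cmeas f -> cmeas g -> cmeas (fun x => f x + g x).
Proof.
move=> [f1 f2] [g1 g2]; split; under eq_fun do rewrite ReImE.
  exact: measurable_funD.
exact: measurable_funD.
Qed.

Lemma cmeasN f : cmeas f -> cmeas (fun x => - f x).
Proof.
by move=> [f1 f2]; split; under eq_fun do rewrite ReImE; exact: measurableT_comp.
Qed.

Lemma cmeasB f g : cmeas f -> cmeas g -> cmeas (fun x => f x - g x).
Proof. by move=> mf mg; apply: cmeasD => //; exact: cmeasN. Qed.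

Lemma cmeasM f g : cmeas f -> cmeas g -> cmeas (fun x => f x * g x).
Proof.
move=> [f1 f2] [g1 g2]; split; under eq_fun do rewrite ReImE.
  by apply: measurable_funB; exact: measurable_funM.
by apply: measurable_funD; exact: measurable_funM.
Qed.

Lemma cmeas_conj f : cmeas f -> cmeas (fun x => (f x)^*).
Proof.
move=> [f1 f2]; split; first by under eq_fun do rewrite ReImE.
by under eq_fun do rewrite ReImE; exact: measurableT_comp.
Qed.

Lemma cmeas_cst (c : R[i]) : cmeas (fun=> c).
Proof. by split; exact: measurable_cst. Qed.

Lemma cmeas_real (h : T -> R) : measurable_fun setT h -> cmeas (fun x => (h x)%:C).
Proof. by move=> mh; split => //=; exact: measurable_cst. Qed.

Lemma cmeas_normc f : cmeas f -> measurable_fun setT (fun x => normc (f x)).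
Proof.
move=> [f1 f2].
rewrite (_ : (fun _ => _) = fun x => Num.sqrt (Re (f x) ^+ 2 + Im (f x) ^+ 2)).
  have ms := continuous_measurable_fun (@sqrt_continuous R).
  apply: (measurableT_comp ms).
  by apply: measurable_funD; exact: measurable_funX.
by apply/funext => x; case: (f x).
Qed.

Lemma cmeas_sqr f : cmeas f -> measurable_fun setT (fun x => normc (f x) ^+ 2).
Proof. by move=> /cmeas_normc mf; exact: measurable_funX. Qed.

Lemma cinteg_meas f : cinteg f -> cmeas f.
Proof.
move=> [/integrableP[f1 _] /integrableP[f2 _]].
by split; apply/measurable_EFinP.
Qed.

Lemma cinteg_le f (h : T -> R) : cmeas f -> mu.-integrable setT (EFin \o h) ->
  (forall x, normc (f x) <= h x) -> cinteg f.
Proof.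
move=> [f1 f2] ih fh; split.
  apply: (le_integrable _ _ _ ih) => //; first exact/measurable_EFinP.
  move=> x _ /=; rewrite lee_fin (le_trans (normc_Re _))//.
  by rewrite (le_trans (fh x))// ler_norm.
apply: (le_integrable _ _ _ ih) => //; first exact/measurable_EFinP.
move=> x _ /=; rewrite lee_fin (le_trans (normc_Im _))//.
by rewrite (le_trans (fh x))// ler_norm.
Qed.

Lemma cinteg_normc f : cinteg f ->
  mu.-integrable setT (EFin \o (fun x => normc (f x))).
Proof.
move=> cf; have [f1 f2] := cf.
apply: (le_integrable _ _ _ (integrableD measurableT
  (integrable_abse f1) (integrable_abse f2))) => //.
  by apply/measurable_EFinP; apply: cmeas_normc; exact: cinteg_meas.
move=> x _ /=; rewrite lee_fin ger0_norm ?normc_ge0//.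
by rewrite (le_trans (normc_le _))// ler_norm.
Qed.

Lemma cintegP f : cinteg f <->
  cmeas f /\ (\int[mu]_x (normc (f x))%:E < +oo)%E.
Proof.
split=> [cf|[mf fy]].
  split; first exact: cinteg_meas.
  have /integrableP[_] := cinteg_normc cf.
  by under eq_integral do rewrite /= ger0_norm ?normc_ge0//.
apply: (@cinteg_le _ (fun x => normc (f x))) => //.
apply/integrableP; split.
  by apply/measurable_EFinP; exact: cmeas_normc.
by under eq_integral do rewrite /= ger0_norm ?normc_ge0//.
Qed.

Lemma cintegD f g : cinteg f -> cinteg g -> cinteg (fun x => f x + g x).
Proof.
move=> [f1 f2] [g1 g2]; split.
  by rewrite (_ : _ \o _ = (EFin \o (fun x => Re (f x))) \+ (EFin \o (fun x => Re (g x))))%E;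
    [exact: integrableD|apply/funext => x /=; rewrite ReImE].
by rewrite (_ : _ \o _ = (EFin \o (fun x => Im (f x))) \+ (EFin \o (fun x => Im (g x))))%E;
    [exact: integrableD|apply/funext => x /=; rewrite ReImE].
Qed.

Lemma cID f g : cinteg f -> cinteg g -> cI (fun x => f x + g x) = cI f + cI g.
Proof.
move=> [f1 f2] [g1 g2]; apply: complex_ext => /=.
  by under eq_Rintegral do rewrite ReImE; rewrite RintegralD.
by under eq_Rintegral do rewrite ReImE; rewrite RintegralD.
Qed.

Lemma cinteg0 : cinteg (fun=> 0).
Proof. by split; exact: integrable0. Qed.

Lemma cI0 : cI (fun=> 0) = 0.
Proof. by apply: complex_ext; rewrite /= Rintegral_cst// mul0r. Qed.

Lemma cintegZ (c : R[i]) f : cinteg f -> cinteg (fun x => c * f x).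
Proof.
move=> cf; apply: (@cinteg_le _ (fun x => normc c * normc (f x))).
- by apply: cmeasM; [exact: cmeas_cst|exact: cinteg_meas].
- have := integrableZl measurableT (normc c) (cinteg_normc cf).
  by apply: eq_integrable => // x _ /=; rewrite EFinM.
- by move=> x; rewrite Normc.normcM.
Qed.

Lemma cinteg_conj f : cinteg f -> cinteg (fun x => (f x)^*).
Proof.
move=> cf; apply: (@cinteg_le _ (fun x => normc (f x))).
- by apply: cmeas_conj; exact: cinteg_meas.
- exact: cinteg_normc.
- by move=> x; rewrite normc_conj.
Qed.

Lemma cIZ (c : R[i]) f : cinteg f -> cI (fun x => c * f x) = c * cI f.
Proof.
move=> [f1 f2].
have rZ (k : R) (h : T -> R) : mu.-integrable setT (EFin \o h) ->
    mu.-integrable setT (EFin \o (fun x => k * h x)).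
  by move/(integrableZl measurableT k); apply: eq_integrable => // x _ /=; rewrite EFinM.
apply: complex_ext => /=; under eq_Rintegral do rewrite ReImE.
  by rewrite RintegralB// ?RintegralZl// ?cReM//=; exact: rZ.
by rewrite RintegralD// ?RintegralZl// ?cImM//=; exact: rZ.
Qed.

Lemma cI_conj f : cinteg f -> cI (fun x => (f x)^*) = (cI f)^*.
Proof.
move=> [f1 f2]; apply: complex_ext => /=; under eq_Rintegral do rewrite ReImE; rewrite ?cReC ?cImC//.
rewrite -[RHS]mulN1r -RintegralZl//; apply: eq_Rintegral => x _.
by rewrite mulN1r.
Qed.

Lemma cIB f g : cinteg f -> cinteg g -> cI (fun x => f x - g x) = cI f - cI g.
Proof.
move=> cf cg; rewrite -[- cI g]mulN1r -cIZ// -cID//; last exact: cintegZ.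
by congr cI; apply/funext => x; rewrite mulN1r.
Qed.

Lemma cintegB f g : cinteg f -> cinteg g -> cinteg (fun x => f x - g x).
Proof.
move=> cf cg; have := cintegD cf (cintegZ (-1) cg).
by under eq_fun do rewrite mulN1r.
Qed.

Lemma cI_real (h : T -> R) : cI (fun x => (h x)%:C) = (\int[mu]_x h x)%:C.
Proof. by apply: complex_ext => //=; rewrite Rintegral_cst// mul0r. Qed.

Lemma cI_sum (I : Type) (r : seq I) (P : pred I) (F : I -> T -> R[i]) :
  (forall i, cinteg (F i)) -> cinteg (fun x => \sum_(i <- r | P i) F i x) /\
  cI (fun x => \sum_(i <- r | P i) F i x) = \sum_(i <- r | P i) cI (F i).
Proof.
move=> mF; elim: r => [|i r [ih1 ih2]].
  under eq_fun do rewrite big_nil; rewrite big_nil; split; first exact: cinteg0.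
  exact: cI0.
under eq_fun do rewrite big_cons; rewrite big_cons; case: (P i) => //.
by split; [exact: cintegD|rewrite cID// ih2].
Qed.

(* Multiplying [f] by a constant makes its integral real and nonnegative. *)
Lemma normc_cI f : cinteg f -> normc (cI f) <= \int[mu]_x normc (f x).
Proof.
move=> cf; have [->|f0] := eqVneq (cI f) 0.
  by rewrite Normc.normc0 Rintegral_ge0// => x _; exact: normc_ge0.
have n0 : 0 < normc (cI f).
  by rewrite lt_neqAle normc_ge0 andbT eq_sym; apply: contra f0 => /eqP/Normc.eq0_normc ->.
rewrite -(ler_pM2l n0) -expr2.
have [c nc cE] : exists2 c : R[i], normc c = normc (cI f) & c * cI f = (normc (cI f) ^+ 2)%:C.
  by exists (cI f)^*; [exact: normc_conj|rewrite mulrC mulcC_normc].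
have -> : normc (cI f) ^+ 2 = Re (cI (fun x => c * f x)) by rewrite cIZ// cE.
rewrite -RintegralZl//; last exact: cinteg_normc.
apply: le_Rintegral => //.
- by have [] := cintegZ c cf.
- exact: integrableZ_EFin (cinteg_normc cf).
- move=> x _; rewrite (le_trans (ler_norm _))// (le_trans (normc_Re _))//.
  by rewrite Normc.normcM nc.
Qed.

Lemma ae_eq_cI f g : cmeas f -> cmeas g ->
  {ae mu, forall x, f x = g x} -> cI f = cI g.
Proof.
move=> [f1 f2] [g1 g2] fg; apply: complex_ext => /=; congr fine;
  apply: ae_eq_integral => //; try (exact/measurable_EFinP);
  by apply: filterS fg => x + _ => /= ->.
Qed.

Lemma cI_dominated (f_ : nat -> T -> R[i]) f (h : T -> R) :
  (forall k, cmeas (f_ k)) -> cmeas f ->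
  mu.-integrable setT (EFin \o h) ->
  {ae mu, forall x, ccvg (f_^~ x) (f x)} ->
  (forall k, {ae mu, forall x, normc (f_ k x) <= h x}) ->
  ccvg (fun k => cI (f_ k)) (cI f).
Proof.
move=> mf_ mf ih cf fh.
have key (P : R[i] -> R) : (forall z, `|P z| <= normc z) ->
   (forall k, measurable_fun setT (fun x => P (f_ k x))) ->
   measurable_fun setT (fun x => P (f x)) ->
   {ae mu, forall x, P (f_ k x) @[k --> \oo] --> P (f x)} ->
   \int[mu]_x P (f_ k x) @[k --> \oo] --> \int[mu]_x P (f x).
  move=> Pn m_ m c.
  have [|||||i1 i2 i3] := @dominated_convergence _ _ _ mu setT measurableT
    (fun k x => (P (f_ k x))%:E) (fun x => (P (f x))%:E) (EFin \o h).
  - by move=> k; exact/measurable_EFinP.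
  - exact/measurable_EFinP.
  - apply: filterS c => x + _ => /= c.
    by apply: cvg_EFin => //; exact: nearW.
  - exact: ih.
  - apply/ae_foralln => k; apply: filterS (fh k) => x + _ /=; rewrite lee_fin.
    exact: le_trans.
  apply: fine_cvg; rewrite /Rintegral fineK//.
  exact: integrable_fin_num.
split.
  apply: (key Re (@normc_Re _) (fun k => (mf_ k).1) mf.1).
  by apply: filterS cf => x [].
apply: (key Im (@normc_Im _) (fun k => (mf_ k).2) mf.2).
by apply: filterS cf => x [].
Qed.

End complex_integral.

(** * Fubini's theorem for complex-valued functions *)

Section Fubini_complex.
Context d1 d2 (X : measurableType d1) (Y : measurableType d2) {R : realType}.
Variable mx : {sigma_finite_measure set X -> \bar R}.
Variable my : {sigma_finite_measure set Y -> \bar R}.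
Implicit Types f : X * Y -> R[i].

Lemma cmeas_comp d (Z : measurableType d) (g : Z -> X) (h : X -> R[i]) :
  measurable_fun setT g -> cmeas h -> cmeas (h \o g).
Proof. by move=> mg [h1 h2]; split; [exact: (measurableT_comp h1)|exact: (measurableT_comp h2)]. Qed.

Lemma measurable_Rintegral_prod (f : X * Y -> R) : measurable_fun setT f ->
  measurable_fun setT (fun x => \int[my]_y f (x, y)).
Proof.
move=> mf; have mef : measurable_fun setT (EFin \o f) by exact/measurable_EFinP.
apply: measurableT_comp; first exact: fine_measurable.
rewrite (_ : (fun _ => _) = (fun x => \int[my]_y (EFin \o f)^\+ (x, y) -
    \int[my]_y (EFin \o f)^\- (x, y))%E); last first.
  apply/funext => x; rewrite [LHS]integralE.
  under eq_integral do rewrite (funepos_comp (EFin \o f) (pair x))/=.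
  by under [X in (_ - X = _)%E]eq_integral do rewrite (funeneg_comp (EFin \o f) (pair x))/=.
apply: emeasurable_funB.
  apply: (measurable_fun_fubini_tonelli_F (EFin \o f)^\+%E) => //.
  exact: measurable_funepos.
apply: (measurable_fun_fubini_tonelli_F (EFin \o f)^\-%E) => //.
exact: measurable_funeneg.
Qed.

Lemma cmeas_cI_prod f : cmeas f -> cmeas (fun x => cI my (fun y => f (x, y))).
Proof.
by move=> [f1 f2]; split;
  [exact: (@measurable_Rintegral_prod (fun z => Re (f z)))|
   exact: (@measurable_Rintegral_prod (fun z => Im (f z)))].
Qed.

Lemma cmeas_pair1 f x : cmeas f -> cmeas (fun y => f (x, y)).
Proof.
move=> [f1 f2]; split; [exact: (measurableT_comp f1)|exact: (measurableT_comp f2)].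
Qed.

Lemma cmeas_pair2 f y : cmeas f -> cmeas (fun x => f (x, y)).
Proof.
move=> [f1 f2]; split; [exact: (measurableT_comp f1)|exact: (measurableT_comp f2)].
Qed.

Variables (a : X -> R) (b : Y -> R).
Hypotheses (ia : mx.-integrable setT (EFin \o a)).
Hypotheses (ib : my.-integrable setT (EFin \o b)).

Lemma integrable_prodM :
  (mx \x my)%E.-integrable setT (EFin \o (fun z => a z.1 * b z.2)).
Proof.
have ma : measurable_fun setT a by apply/measurable_EFinP; exact: measurable_int ia.
have mb : measurable_fun setT b by apply/measurable_EFinP; exact: measurable_int ib.
have mab : measurable_fun setT (fun z : X * Y => a z.1 * b z.2).
  apply: measurable_funM.
    exact: (measurableT_comp ma).
  exact: (measurableT_comp mb).
apply/integrable12ltyP; first exact/measurable_EFinP.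
have iB := integrable_abse ib.
rewrite (_ : (\int[mx]_x _)%E = \int[mx]_x (`|(a x)%:E| * \int[my]_y `|(b y)%:E|))%E.
  have fB : (\int[my]_y `|(b y)%:E|)%E \is a fin_num by exact: (integrable_fin_num _ iB).
  rewrite ge0_integralZr//.
  - by rewrite lte_mul_pinfty ?integral_ge0//;
      [exact: (integrable_fin_num _ (integrable_abse ia))|case/integrableP: ib].
  - by apply/measurable_EFinP; exact: measurableT_comp.
  - exact: integral_ge0.
apply: eq_integral => x _; rewrite -ge0_integralZl//.
  by apply: eq_integral => y _; rewrite -abseM.
by apply/measurable_EFinP; exact: measurableT_comp.
Qed.

Variable f : X * Y -> R[i].
Hypotheses (mf : cmeas f) (fab : forall x y, normc (f (x, y)) <= a x * b y).

Lemma cinteg_prod : cinteg (mx \x my)%E f.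
Proof.
by apply: (cinteg_le mf integrable_prodM) => -[x y]; exact: fab.
Qed.

Lemma cinteg_pair1 x : cinteg my (fun y => f (x, y)).
Proof.
apply: (cinteg_le _ _ (fab x)); first exact: cmeas_pair1.
have := integrableZl measurableT (a x) ib.
by apply: eq_integrable => // y _ /=; rewrite EFinM.
Qed.

Lemma cinteg_pair2 y : cinteg mx (fun x => f (x, y)).
Proof.
apply: (@cinteg_le _ _ _ mx _ (fun x => a x * b y)) => //; first exact: cmeas_pair2.
have := integrableZr measurableT (b y) ia.
by apply: eq_integrable => // x _ /=; rewrite EFinM.
Qed.

Let rFubini (g : X * Y -> R) : (mx \x my)%E.-integrable setT (EFin \o g) ->
  (forall x, my.-integrable setT (EFin \o (fun y => g (x, y)))) ->
  (forall y, mx.-integrable setT (EFin \o (fun x => g (x, y)))) ->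
  (\int[mx]_x \int[my]_y g (x, y) = fine (\int[(mx \x my)%E]_z (g z)%:E)%E) /\
  (\int[my]_y \int[mx]_x g (x, y) = fine (\int[(mx \x my)%E]_z (g z)%:E)%E).
Proof.
move=> ig i1 i2; split.
  rewrite -(integral12_prod_meas1 ig); congr fine.
  apply: eq_integral => x _; rewrite fineK//.
  exact: (integrable_fin_num _ (i1 x)).
rewrite -(integral21_prod_meas1 ig); congr fine.
apply: eq_integral => y _; rewrite fineK//.
exact: (integrable_fin_num _ (i2 y)).
Qed.

Lemma cI_prod1 : cI mx (fun x => cI my (fun y => f (x, y))) = cI (mx \x my)%E f.
Proof.
have [f1 f2] := cinteg_prod.
apply: complex_ext => /=.
  by have [] := rFubini f1 (fun x => (cinteg_pair1 x).1) (fun y => (cinteg_pair2 y).1).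
by have [] := rFubini f2 (fun x => (cinteg_pair1 x).2) (fun y => (cinteg_pair2 y).2).
Qed.

(** The bound by [a x * b y] makes every section integrable, not only almost every one, so the
    iterated integrals are meaningful at each point and no null set has to be discarded. *)
Lemma cI_Fubini : cI mx (fun x => cI my (fun y => f (x, y))) =
  cI my (fun y => cI mx (fun x => f (x, y))).
Proof.
have [f1 f2] := cinteg_prod.
rewrite cI_prod1; apply/esym/complex_ext => /=.
  by have [] := rFubini f1 (fun x => (cinteg_pair1 x).1) (fun y => (cinteg_pair2 y).1).
by have [] := rFubini f2 (fun x => (cinteg_pair1 x).2) (fun y => (cinteg_pair2 y).2).
Qed.

End Fubini_complex.

(** * Borel sets and Lebesgue measure of R^n *)

Section rV_topology_measure.
Context {R : realType} {n : nat}.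
Local Notation Rn := 'rV[R]_n.

Lemma measurable_rV_ball (x : Rn) e : measurable (ball x e).
Proof.
have [e0|e0] := ltP 0 e; last first.
  rewrite (_ : ball x e = set0)//; apply/seteqP; split => // y [].
  by rewrite ltNge e0.
have -> : ball x e = \bigcap_(i in [set: 'I_n]) (fun y : Rn => y 0 i) @^-1` ball (x 0 i) e.
  apply/seteqP; split => [y [_ xy] i _|y xy]; first exact: xy.
  by split => // j i; rewrite ord1; exact: xy.
apply: fin_bigcap_measurable => // i _; rewrite -[X in measurable X]setTI.
exact: measurable_rV_coord measurableT _ (measurable_ball _ _).
Qed.

(** The sigma-algebra is generated by the coordinates, not by the open sets. An open set is the
    countable union of the balls with rational centre and radius [1/(k+1)] that it contains. *)
Lemma open_rV_measurable (U : set Rn) : open U -> measurable U.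
Proof.
move=> oU.
pose F (p : 'rV[rat]_n * nat) : set Rn :=
  let B := ball (map_mx ratr p.1 : Rn) (p.2.+1%:R^-1) in
  if `[< B `<=` U >] then B else set0.
have -> : U = \bigcup_p F p.
  apply/seteqP; split => [x Ux|x [p _]]; last first.
    by rewrite /F; case: asboolP => // BU; exact: BU.
  have /nbhs_ballP[e /= e0 xe] : nbhs x U by exact: open_nbhs_nbhs.
  pose k := Num.truncn (2 / e).
  have ke : k.+1%:R^-1 < e / 2.
    rewrite invf_plt ?posrE ?divr_gt0// invf_div.
    by have := Num.Theory.truncnS_gt (2 / e).
  have hq i : exists q : rat, `|x 0 i - ratr q| < k.+1%:R^-1.
    have k0 : (0 : R) < k.+1%:R^-1 by rewrite invr_gt0.
    have [q] : exists q, ratr q \in `](x 0 i - k.+1%:R^-1), (x 0 i + k.+1%:R^-1)[.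
      by apply: rat_in_itvoo; rewrite ltrD2l (lt_trans _ k0)// oppr_lt0.
    rewrite in_itv/= => /andP[q1 q2]; exists q.
    by rewrite ltr_distlC q1.
  pose q : 'rV[rat]_n := \row_i xget 0%Q [set q | `|x 0 i - ratr q| < k.+1%:R^-1].
  have qE i : `|x 0 i - ratr (q 0 i)| < k.+1%:R^-1.
    rewrite /q mxE; case: xgetP => [r -> //|/=]; have [r hr] := hq i.
    by move=> /(_ r).
  exists (q, k) => //; rewrite /F/=.
  have qx : ball (map_mx ratr q : Rn) k.+1%:R^-1 x.
    split=> [|i j]; first by rewrite invr_gt0.
    by rewrite ord1 mxE /ball/= distrC.
  case: asboolP => // -[]; apply: (subset_trans _ xe) => y qy.
  rewrite (_ : e = e / 2 + e / 2); last by rewrite -splitr.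
  by apply: ball_triangle; [apply/ball_sym|]; apply: le_ball; [|exact: qx| |exact: qy]; exact: ltW.
apply: countable_bigcupT_measurable => [|p]; first exact: countableP.
by rewrite /F; case: asboolP => // _; exact: measurable_rV_ball.
Qed.

Lemma closed_rV_measurable (F : set Rn) : closed F -> measurable F.
Proof.
move=> cF; rewrite -[F]setCK; apply: measurableC; apply: open_rV_measurable.
exact: closed_openC.
Qed.

Lemma compact_rV_measurable (K : set Rn) : compact K -> measurable K.
Proof.
move=> cK; apply: closed_rV_measurable; apply: compact_closed => //.
Qed.

Lemma continuous_rV_measurable (D : set Rn) (f : Rn -> R) : open D ->
  {within D, continuous f} -> measurable_fun D f.
Proof.
move=> oD; rewrite continuous_open_subspace// => cf.
apply: (measurability _ (RGenOpens.measurableE R)).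
move=> _ [_ [a [b ->] <-]]; apply: open_rV_measurable.
rewrite openE => x [Dx fx]; apply: filterI; first exact: open_nbhs_nbhs.
apply: (cf x); first by rewrite inE.
by apply: open_nbhs_nbhs; split => //; exact: interval_open.
Qed.

Lemma ccontinuous_cmeasurable (D : set Rn) (f : Rn -> R[i]) : open D ->
  ccontinuous D f -> cmeasurable D f.
Proof. by move=> oD [f1 f2]; split; exact: continuous_rV_measurable. Qed.

Definition rV_box (a b : Rn) : set Rn :=
  [set x | forall i, a 0 i < x 0 i <= b 0 i].

Lemma measurable_rV_box a b : measurable (rV_box a b).
Proof.
have -> : rV_box a b = \bigcap_(i in [set: 'I_n])
    (fun y : Rn => y 0 i) @^-1` `]a 0 i, b 0 i]%classic.
  apply/seteqP; split => [y ab i _ /=|y xy i]; first by rewrite in_itv/= ab.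
  by have := xy i Logic.I; rewrite /= in_itv.
apply: fin_bigcap_measurable => // i _; rewrite -[X in measurable X]setTI.
exact: measurable_rV_coord.
Qed.

Definition rV_boxes : set (set Rn) := [set Q | exists a b, Q = rV_box a b].

Definition cube (k : nat) : set Rn := rV_box (const_mx (- k%:R)) (const_mx k%:R).

Lemma cubeP k x : cube k x <-> forall i, - k%:R < x 0 i <= k%:R.
Proof. by split => [h i|h i]; have := h i; rewrite !mxE. Qed.

Lemma subset_cube k l : (k <= l)%N -> cube k `<=` cube l.
Proof.
move=> kl x /cubeP kx; apply/cubeP => i; have /andP[x1 x2] := kx i.
by rewrite (le_trans x2) ?ler_nat// andbT (le_lt_trans _ x1)// lerN2 ler_nat.
Qed.

Lemma bounded_cube (K : set Rn) : bounded_set K -> exists k, K `<=` cube k.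
Proof.
move=> [M [_ KM]]; exists (Num.truncn (`|M| + 1)).+1 => x /(KM (`|M| + 1)) xM.
have {}xM : `|x| <= `|M| + 1.
  by apply: xM; rewrite (le_lt_trans (ler_norm _))// ltrDl.
apply/cubeP => i; have : `|x 0 i| < (Num.truncn (`|M| + 1)).+1%:R.
  apply: (le_lt_trans _ (Num.Theory.truncnS_gt _)); apply: (le_trans _ xM).
  by rewrite [leRHS]/Num.norm/= mx_normrE; apply/bigmax_geP; right; exists (0, i).
by rewrite ltr_norml => /andP[-> /ltW].
Qed.

Lemma bigcup_cube : \bigcup_k cube k = setT.
Proof.
apply/seteqP; split => // x _; have [|k] := @bounded_cube [set x].
  by exists `|x|; split => // y xy z -> /=; exact: ltW.
by move=> /(_ x erefl) xk; exists k.
Qed.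

Lemma rV_boxI a b a' b' : rV_box a b `&` rV_box a' b' =
  rV_box (\row_i Num.max (a 0 i) (a' 0 i)) (\row_i Num.min (b 0 i) (b' 0 i)).
Proof.
apply/seteqP; split => [x [h h'] i|x h].
  by rewrite !mxE gt_max le_min; have /andP[-> ->] := h i; have /andP[-> ->] := h' i.
by split => i; have := h i; rewrite !mxE gt_max le_min => /andP[/andP[a1 a2] /andP[b1 b2]]; apply/andP.
Qed.

Lemma rV_boxes_setI : setI_closed rV_boxes.
Proof.
move=> _ _ [a [b ->]] [a' [b' ->]]; rewrite rV_boxI.
by eexists; eexists.
Qed.

(** It suffices to reach the half-spaces [x 0 i > r]; each is the union over [k] of the boxes whose
    other coordinates lie in []-k, k]]. *)
Lemma measurable_rV_boxesE : @measurable _ Rn `<=` <<s rV_boxes >>.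
Proof.
suff mi (i : 'I_n) : @measurable_fun _ _ (g_sigma_algebraType rV_boxes) R setT
    (fun x : Rn => x 0 i).
  apply: smallest_sub; first exact: smallest_sigma_algebra.
  rewrite -bigcup_seq => _ [i _ [Y mY <-]]; exact: mi.
apply: (measurability _ (RGenOInfty.measurableE R)).
move=> _ [_ [r ->] <-]; rewrite setTI.
pose F k := rV_box (\row_j if j == i then r else - k%:R) (const_mx k%:R).
have -> : (fun x : Rn => x 0 i) @^-1` `]r, +oo[%classic = \bigcup_k F k.
  apply/seteqP; split => [x /=|x [k _ Fx] /=]; last first.
    by have := Fx i; rewrite !mxE eqxx in_itv/= andbT => /andP[].
  rewrite in_itv/= andbT => rx.
  have : [set: Rn] x by []. rewrite -bigcup_cube => -[k _ /cubeP xk].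
  exists k => // j; rewrite !mxE; case: ifPn => [/eqP ->|_]; last exact: xk.
  by rewrite rx; have /andP[] := xk i.
apply: (@bigcupT_measurable _ (g_sigma_algebraType rV_boxes)) => k.
apply: sub_sigma_algebra.
by eexists; eexists.
Qed.

End rV_topology_measure.

Section density_measure.
Context d (T : measurableType d) {R : realType} (mu : {measure set T -> \bar R}).
Variables (f : T -> \bar R).
Hypotheses (mf : measurable_fun setT f) (f0 : forall x, (0 <= f x)%E).

(** The two proofs are arguments of the function, so that the measure structure declared below can
    be inferred from the term. *)
Definition density_of & measurable_fun setT f & (forall x, (0 <= f x)%E) :=
  fun A => (\int[mu]_(x in A) f x)%E.

Local Notation nu := (density_of mf f0).

Let nu0 : nu set0 = 0%E. Proof. by rewrite /density_of integral_set0. Qed.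
Let nu_ge0 A : (0 <= nu A)%E. Proof. by apply: integral_ge0 => x _. Qed.
Let nu_sigma : semi_sigma_additive nu.
Proof. exact: semi_sigma_additive_nng_induced. Qed.

HB.instance Definition _ := isMeasure.Build _ _ _ nu nu0 nu_ge0 nu_sigma.

End density_measure.

Section box_determines.
Context {R : realType} {n : nat}.
Local Notation Rn := 'rV[R]_n.
Variable mu : {measure set Rn -> \bar R}.

(** The positive and negative parts of [h] are the densities of two finite measures that agree on
    boxes. Boxes are stable under intersection and generate the Borel sets, so the measures coincide
    and [h] has zero integral over every Borel set. *)
Lemma integral_box0_ae (h : Rn -> R) : mu.-integrable setT (EFin \o h) ->
  (forall a b, (\int[mu]_(x in rV_box a b) (h x)%:E)%E = 0%E) ->
  {ae mu, forall x, h x = 0}.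
Proof.
move=> ih h0.
have mh : measurable_fun setT (EFin \o h) by exact: measurable_int ih.
have mp := measurable_funepos mh.
have mn := measurable_funeneg mh.
have p0 x : (0 <= (EFin \o h)^\+ x)%E by exact: funepos_ge0.
have n0 x : (0 <= (EFin \o h)^\- x)%E by exact: funeneg_ge0.
have fin (A : set Rn) : measurable A ->
    ((\int[mu]_(x in A) ((EFin \o h)^\+ x)) < +oo)%E /\
    ((\int[mu]_(x in A) ((EFin \o h)^\- x)) < +oo)%E.
  move=> mA; have ihA := integrableS measurableT mA (@subsetT _ _) ih.
  by split; [have /integrableP[_] := integrable_funepos mA ihA|
    have /integrableP[_] := integrable_funeneg mA ihA];
    under eq_integral do rewrite gee0_abs//.
pose m1 : {measure set Rn -> \bar R} := density_of mu mp p0.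
pose m2 : {measure set Rn -> \bar R} := density_of mu mn n0.
have m12 A : measurable A -> m1 A = m2 A.
  move=> mA; apply: (@g_sigma_algebra_measure_unique _ _ _ rV_boxes _ cube) => //.
  - by move=> _ [a [b ->]]; exact: measurable_rV_box.
  - by move=> k; eexists; eexists.
  - exact: bigcup_cube.
  - exact: rV_boxes_setI.
  - move=> _ [a [b ->]]; have := h0 a b; rewrite integralE => /eqP.
    have [f1 f2] := fin _ (measurable_rV_box a b).
    rewrite sube_eq ?add0e ?fin_num_adde_defl//; first by move/eqP.
    + by rewrite ge0_fin_numE// integral_ge0.
    + by rewrite ge0_fin_numE// integral_ge0.
  - by move=> k; have [] := fin _ (measurable_rV_box (const_mx (- k%:R)) (const_mx k%:R)).
  - exact: measurable_rV_boxesE.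
have /= := @integral_ae_eq _ _ _ mu setT measurableT (cst 0%E) (EFin \o h) ih.
move=> /(_ (measurable_cst _)) []; last first.
  by move=> N [mN N0 sN]; exists N; split => // x /= xh; apply: sN => /= /(_ Logic.I) [].
move=> E _ mE; rewrite integral0 integralE.
have [f1 f2] := fin _ mE.
have := m12 E mE; rewrite /m1 /m2/= /density_of => ->.
by rewrite subee// ge0_fin_numE// integral_ge0.
Qed.

End box_determines.

(** * Integrals of tensor products *)

Section leb_tensor.
Context {R : realType}.

Lemma integral_lebS n (f : 'rV[R]_n.+1 -> \bar R) :
  measurable_fun setT f ->
  (@lebesgue_measure R \x leb n)%E.-integrable setT (f \o @rV_cons R n) ->
  (leb n.+1).-integrable setT f /\
  (\int[leb n.+1]_x f x = \int[(@lebesgue_measure R \x leb n)%E]_z f (rV_cons z))%E.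
Proof.
move=> mf ifc; split.
  exact: (@integrable_pushforward _ _ (measurableTypeR R * 'rV[R]_n)%type
    'rV[R]_n.+1 R (@rV_cons R n) (@measurable_rV_cons R n)
    (@lebesgue_measure R \x leb n)%E setT f mf ifc measurableT).
exact: (@integral_pushforward _ _ (measurableTypeR R * 'rV[R]_n)%type
    'rV[R]_n.+1 R (@rV_cons R n) (@measurable_rV_cons R n)
    (@lebesgue_measure R \x leb n)%E setT f mf ifc measurableT).
Qed.

Lemma cI_lebS n (f : 'rV[R]_n.+1 -> R[i]) : cmeas f ->
  cinteg (@lebesgue_measure R \x leb n)%E (f \o @rV_cons R n) ->
  cinteg (leb n.+1) f /\
  cI (leb n.+1) f = cI (@lebesgue_measure R \x leb n)%E (f \o @rV_cons R n).
Proof.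
move=> [f1 f2] [i1 i2].
have mf1 : measurable_fun setT (EFin \o (fun x => Re (f x))) by exact/measurable_EFinP.
have mf2 : measurable_fun setT (EFin \o (fun x => Im (f x))) by exact/measurable_EFinP.
have [j1 e1] := integral_lebS mf1 i1; have [j2 e2] := integral_lebS mf2 i2.
by split => //; apply: complex_ext; rewrite /= /Rintegral; [rewrite e1|rewrite e2].
Qed.

Lemma rV_cons0 n (p : R * 'rV[R]_n) : rV_cons p 0 ord0 = p.1.
Proof. by have /(congr1 fst) := rV_consK p. Qed.

Lemma rV_consS n (p : R * 'rV[R]_n) j : rV_cons p 0 (lift ord0 j) = p.2 0 j.
Proof. by have /(congr1 snd)/rowP/(_ j) := rV_consK p; rewrite mxE. Qed.

Lemma cmeas_prod_coord n (F : 'I_n -> R -> R[i]) : (forall i, cmeas (F i)) ->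
  cmeas (fun x : 'rV[R]_n => \prod_i F i (x 0 i)).
Proof.
move=> mF; elim: (index_enum _) => [|i r ih].
  by under eq_fun do rewrite big_nil; exact: cmeas_cst.
under eq_fun do rewrite big_cons; apply: cmeasM => //.
exact: (cmeas_comp (measurable_rV_coord i)).
Qed.

Lemma leb_tensor n (F : 'I_n -> R -> R[i]) :
  (forall i, cinteg (@lebesgue_measure R) (F i)) ->
  cinteg (leb n) (fun x => \prod_i F i (x 0 i)) /\
  cI (leb n) (fun x => \prod_i F i (x 0 i)) = \prod_i cI (@lebesgue_measure R) (F i).
Proof.
elim: n F => [|n ih] F iF.
  rewrite big_ord0; under eq_fun do rewrite big_ord0.
  have l1 : (leb 0 : {measure set 'rV[R]_0 -> \bar R}) setT = 1%E by exact: diracT.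
  split.
    apply: (@cinteg_le _ _ _ (leb 0) _ (fun=> 1)); first exact: cmeas_cst.
      apply/integrableP; split; first exact: measurable_cst.
      by rewrite integral_cst//= normr1 mul1e l1 ltry.
    by move=> x; rewrite Normc.normc1.
  by apply: complex_ext; rewrite /= Rintegral_cst// l1 ?mul1r ?mul0r.
have [i1 e1] := ih (fun j => F (lift ord0 j)) (fun j => iF _).
have E (p : R * 'rV[R]_n) : \prod_i F i (rV_cons p 0 i) =
    F ord0 p.1 * \prod_j F (lift ord0 j) (p.2 0 j).
  by rewrite big_ord_recl rV_cons0; congr (_ * _); apply: eq_bigr => j _; rewrite rV_consS.
have mF : cmeas (fun x : 'rV[R]_n.+1 => \prod_i F i (x 0 i)).
  by apply: cmeas_prod_coord => i; exact: cinteg_meas (iF i).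
have mc := cmeas_comp (@measurable_rV_cons R n) mF.
have dom x y : normc (((fun x => \prod_i F i (x 0 i)) \o @rV_cons R n) (x, y)) <=
    normc (F ord0 x) * normc (\prod_j F (lift ord0 j) (y 0 j)).
  by rewrite /= E Normc.normcM.
have ia := cinteg_normc (iF ord0); have ib := cinteg_normc i1.
have [j1 ->] := cI_lebS mF (cinteg_prod ia ib mc dom); split => //.
rewrite -(cI_prod1 ia ib mc dom) big_ord_recl -e1.
under eq_fun do under eq_fun do rewrite /= E/=.
under eq_fun do rewrite cIZ//.
under eq_fun do rewrite mulrC; rewrite cIZ// mulrC//.
Qed.

Lemma cinteg_indic_itv (a b : R) :
  cinteg (@lebesgue_measure R) (fun x => ((a < x <= b)%R%:R : R)%:C) /\
  cI (@lebesgue_measure R) (fun x => ((a < x <= b)%R%:R : R)%:C) = (Num.max (b - a) 0)%:C.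
Proof.
have E : (fun x => ((a < x <= b)%R%:R : R)) = \1_`]a, b].
  by apply/funext => x; rewrite indicE mem_setE/=.
have mab : measurable (`]a, b] : set R) by [].
have lab : (@lebesgue_measure R `]a, b] = (Num.max (b - a) 0)%:E)%E.
  rewrite lebesgue_measure_itv/= lte_fin; case: ltP => ab.
    by rewrite -EFinB max_l// subr_ge0 ltW.
  by rewrite max_r// subr_le0.
split.
  apply: (@cinteg_le _ (measurableTypeR R) R (@lebesgue_measure R) _ (\1_(`]a, b]%classic : set R))).
  - rewrite (_ : (fun _ => _) = fun x => (\1_(`]a, b]%classic : set R) x)%:C); last by rewrite -E.
    by apply: cmeas_real; exact: measurable_indic.
  - apply/integrableP; split; first exact/measurable_EFinP/measurable_indic.
    under eq_integral do rewrite /= ger0_norm//.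
    by rewrite integral_indic// setIT [X in (X < _)%E]lab ltry.
  - by move=> x; rewrite normc_real ger0_norm// -E.
rewrite cI_real E; congr _%:C; rewrite /Rintegral integral_indic// setIT.
by rewrite [X in fine X]lab.
Qed.

End leb_tensor.

(** * The Hilbert space L^2 *)

Section L2_theory.
Local Notation "x ^*" := (conjc x) : ring_scope.
Context {R : realType} {n : nat}.
Local Notation Rn := 'rV[R]_n.
Local Notation C := R[i].
Local Notation mu := (@leb R n).
Implicit Types f g h : Rn -> C.

(** [fine] sends an infinite integral to [0], so the value is meaningful under [L2 f] only; hence
    the [L2] hypotheses everywhere below. *)
Definition nrm2 f : R := fine (L2sq setT f).
Definition nrm f : R := Num.sqrt (nrm2 f).
Definition ip f g : C := cI mu (fun x => f x * (g x)^*).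

Lemma L2P f : L2 f <->
  cmeas f /\ mu.-integrable setT (EFin \o (fun x => normc (f x) ^+ 2)).
Proof.
split=> -[mf fy]; split => //.
  apply/integrableP; split; first by apply/measurable_EFinP; exact: cmeas_sqr.
  by under eq_integral do rewrite /= ger0_norm ?sqr_ge0//.
have /integrableP[_] := fy.
by under eq_integral do rewrite /= ger0_norm ?sqr_ge0//.
Qed.

Lemma L2_meas f : L2 f -> cmeas f. Proof. by case. Qed.

Lemma nrm2_ge0 f : 0 <= nrm2 f.
Proof. by apply: Rintegral_ge0 => x _; exact: sqr_ge0. Qed.

Lemma nrm_ge0 f : 0 <= nrm f. Proof. exact: sqrtr_ge0. Qed.

Lemma sqr_nrm f : nrm f ^+ 2 = nrm2 f.
Proof. by rewrite sqr_sqrtr// nrm2_ge0. Qed.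

Lemma nrm2E f : nrm2 f = \int[mu]_x (normc (f x) ^+ 2).
Proof. by []. Qed.

Lemma L2sq_ge0 D f : (0 <= L2sq D f)%E.
Proof. by apply: integral_ge0 => x _; rewrite lee_fin sqr_ge0. Qed.

Lemma L2sqE f : L2 f -> L2sq setT f = (nrm2 f)%:E.
Proof. by move=> [_ fy]; rewrite fineK// ge0_fin_numE// L2sq_ge0. Qed.

Lemma L2_le (M : R) f g : 0 <= M -> cmeas g -> L2 f ->
  (forall x, normc (g x) <= M * normc (f x)) -> L2 g /\ nrm2 g <= M ^+ 2 * nrm2 f.
Proof.
move=> M0 mg /L2P[mf iff] gf.
have iM : mu.-integrable setT (EFin \o (fun x => M ^+ 2 * normc (f x) ^+ 2)).
  have := integrableZl measurableT (M ^+ 2) iff.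
  by apply: eq_integrable => // x _ /=; rewrite EFinM.
have le x : normc (g x) ^+ 2 <= M ^+ 2 * normc (f x) ^+ 2.
  by rewrite -exprMn ler_pXn2r// ?nnegrE ?mulr_ge0 ?normc_ge0.
have ig : mu.-integrable setT (EFin \o (fun x => normc (g x) ^+ 2)).
  apply: (le_integrable _ _ _ iM) => //.
    by apply/measurable_EFinP; exact: cmeas_sqr.
  move=> x _ /=; rewrite lee_fin ger0_norm ?sqr_ge0// (le_trans (le x))//.
  exact: ler_norm.
split; first exact/L2P.
by rewrite !nrm2E -RintegralZl//; exact: le_Rintegral.
Qed.

Lemma L2Z (c : C) f : L2 f -> L2 (fun x => c * f x).
Proof.
move=> Lf; have [] // := @L2_le (normc c) f (fun x => c * f x) (normc_ge0 _) _ Lf.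
  by apply: cmeasM; [exact: cmeas_cst|exact: L2_meas].
by move=> x; rewrite Normc.normcM.
Qed.

Lemma L2_conj f : L2 f -> L2 (fun x => (f x)^*).
Proof.
move=> Lf; have [] // := @L2_le 1 f (fun x => (f x)^*) ler01 _ Lf.
  by apply: cmeas_conj; exact: L2_meas.
by move=> x; rewrite mul1r normc_conj.
Qed.

Lemma nrm2_conj f : nrm2 (fun x => (f x)^*) = nrm2 f.
Proof. by rewrite !nrm2E; apply: eq_Rintegral => x _; rewrite normc_conj. Qed.

Lemma nrm2Z (c : C) f : L2 f -> nrm2 (fun x => c * f x) = normc c ^+ 2 * nrm2 f.
Proof.
move=> /L2P[_ iff]; rewrite !nrm2E -RintegralZl//; apply: eq_Rintegral => x _.
by rewrite Normc.normcM exprMn.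
Qed.

Lemma L2D f g : L2 f -> L2 g -> L2 (fun x => f x + g x).
Proof.
move=> /L2P[mf iff] /L2P[mg ig]; apply/L2P; split; first exact: cmeasD.
have := integrableZ_EFin 2 (integrableD_EFin iff ig).
apply: le_integrable => //; first by apply/measurable_EFinP; apply: cmeas_sqr; exact: cmeasD.
move=> x _ /=; rewrite lee_fin ger0_norm ?sqr_ge0//.
by rewrite (le_trans (normcD_sqr _ _))// ler_norm.
Qed.

Lemma L2B f g : L2 f -> L2 g -> L2 (fun x => f x - g x).
Proof.
move=> Lf Lg; have := L2D Lf (L2Z (-1) Lg).
by under eq_fun do rewrite mulN1r.
Qed.

Lemma L20 : L2 (fun _ : Rn => 0 : C).
Proof.
apply/L2P; split; first exact: cmeas_cst.
by under eq_fun do rewrite Normc.normc0 expr0n; exact: integrable0.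
Qed.

Lemma nrm20 : nrm2 (fun _ : Rn => 0 : C) = 0.
Proof. by rewrite nrm2E; under eq_Rintegral do rewrite Normc.normc0 expr0n/=; rewrite Rintegral_cst// mul0r. Qed.

Lemma nrm2_subC f g : nrm2 (fun x => f x - g x) = nrm2 (fun x => g x - f x).
Proof.
by rewrite !nrm2E; apply: eq_Rintegral => x _; rewrite -opprB normcN.
Qed.

Lemma L2_sum (I : Type) (r : seq I) (P : pred I) (F : I -> Rn -> C) :
  (forall i, L2 (F i)) -> L2 (fun x => \sum_(i <- r | P i) F i x).
Proof.
move=> LF; elim: r => [|i r ih].
  by under eq_fun do rewrite big_nil; exact: L20.
by under eq_fun do rewrite big_cons; case: (P i) => //; exact: L2D.
Qed.

Lemma cinteg_mul f g : L2 f -> L2 g -> cinteg mu (fun x => f x * g x).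
Proof.
move=> /L2P[mf iff] /L2P[mg ig].
apply: (@cinteg_le _ _ _ mu _ (fun x => (normc (f x) ^+ 2 + normc (g x) ^+ 2) / 2)).
- exact: cmeasM.
- have := integrableZr measurableT (2^-1) (integrableD measurableT iff ig).
  by apply: eq_integrable => // x _ /=; rewrite EFinM EFinD.
- by move=> x; exact: normcM_le.
Qed.

Lemma cinteg_ip f g : L2 f -> L2 g -> cinteg mu (fun x => f x * (g x)^*).
Proof. by move=> Lf Lg; apply: cinteg_mul => //; exact: L2_conj. Qed.

Lemma ip_nrm2 f : ip f f = (nrm2 f)%:C.
Proof. by rewrite /ip; under eq_fun do rewrite mulcC_normc; rewrite cI_real. Qed.

Lemma ip_conj f g : L2 f -> L2 g -> ip g f = (ip f g)^*.
Proof.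
move=> Lf Lg; rewrite /ip -cI_conj; last exact: cinteg_ip.
by congr cI; apply/funext => x; rewrite rmorphM /= conjcK mulrC.
Qed.

Lemma ipDl f g h : L2 f -> L2 g -> L2 h ->
  ip (fun x => f x + g x) h = ip f h + ip g h.
Proof.
move=> Lf Lg Lh; rewrite /ip -cID; [|exact: cinteg_ip..].
by congr cI; apply/funext => x; rewrite mulrDl.
Qed.

Lemma ipZl (c : C) f h : L2 f -> L2 h -> ip (fun x => c * f x) h = c * ip f h.
Proof.
move=> Lf Lh; rewrite /ip -cIZ; last exact: cinteg_ip.
by congr cI; apply/funext => x; rewrite mulrA.
Qed.

Lemma ipBl f g h : L2 f -> L2 g -> L2 h ->
  ip (fun x => f x - g x) h = ip f h - ip g h.
Proof.
move=> Lf Lg Lh; rewrite -[- ip g h]mulN1r -ipZl// -ipDl//; last exact: L2Z.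
by congr ip; apply/funext => x; rewrite mulN1r.
Qed.

Lemma ipDr f g h : L2 f -> L2 g -> L2 h ->
  ip h (fun x => f x + g x) = ip h f + ip h g.
Proof.
move=> Lf Lg Lh; rewrite (ip_conj (L2D Lf Lg) Lh) ipDl// conjcD.
by rewrite (ip_conj Lf Lh) (ip_conj Lg Lh).
Qed.

Lemma ipZr (c : C) f h : L2 f -> L2 h -> ip h (fun x => c * f x) = c^* * ip h f.
Proof.
move=> Lf Lh; rewrite (ip_conj (L2Z c Lf) Lh) ipZl// conjcM.
by rewrite (ip_conj Lf Lh).
Qed.

Lemma ipBr f g h : L2 f -> L2 g -> L2 h ->
  ip h (fun x => f x - g x) = ip h f - ip h g.
Proof.
move=> Lf Lg Lh; rewrite (ip_conj (L2B Lf Lg) Lh) ipBl// conjcB.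
by rewrite (ip_conj Lf Lh) (ip_conj Lg Lh).
Qed.

Lemma nrm2D f g : L2 f -> L2 g ->
  nrm2 (fun x => f x + g x) = nrm2 f + nrm2 g + 2 * Re (ip f g).
Proof.
move=> Lf Lg; have Lfg := L2D Lf Lg.
have := ip_nrm2 (fun x => f x + g x).
rewrite ipDl// ipDr// ipDr// !ip_nrm2 (ip_conj Lf Lg).
by case: (ip f g) => a b; move=> [<-] _ /=; ring.
Qed.

(** With [I] the integral of [|f| |g|], integrating [(t |f| - |g|)^2 >= 0] gives
    [2 t I <= t^2 |f|^2 + |g|^2] for every [t]. The choice [t = I / |f|^2] is optimal; if [|f| = 0]
    and [I] is not [0], the choice [t = (|g|^2 + 1) / (2 I)] is absurd. *)
Lemma cauchy_schwarz f g : L2 f -> L2 g ->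
  normc (ip f g) ^+ 2 <= nrm2 f * nrm2 g.
Proof.
move=> Lf Lg; have icf := cinteg_ip Lf Lg.
set I := \int[mu]_x normc (f x * (g x)^*).
have I0 : 0 <= I by apply: Rintegral_ge0 => x _; exact: normc_ge0.
have nI : normc (ip f g) <= I by exact: normc_cI.
have key t : 2 * t * I <= t ^+ 2 * nrm2 f + nrm2 g.
  have /L2P[mf iff] := Lf; have /L2P[mg ig] := Lg.
  have i1 := integrableZ_EFin (t ^+ 2) iff.
  have i2 := integrableZ_EFin (2 * t) (cinteg_normc icf).
  have -> : 2 * t * I = \int[mu]_x (2 * t * normc (f x * (g x)^*)).
    by rewrite RintegralZl//; exact: cinteg_normc.
  have -> : t ^+ 2 * nrm2 f + nrm2 g =
      \int[mu]_x (t ^+ 2 * normc (f x) ^+ 2 + normc (g x) ^+ 2).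
    by rewrite RintegralD// RintegralZl.
  have i3 := integrableD_EFin i1 ig.
  apply: le_Rintegral => // x _; rewrite Normc.normcM normc_conj -subr_ge0.
  rewrite [leRHS](_ : _ = (t * normc (f x) - normc (g x)) ^+ 2); last by ring.
  exact: sqr_ge0.
rewrite (@le_trans _ _ (I ^+ 2))//.
  by rewrite ler_pXn2r// nnegrE ?normc_ge0.
have [A0|A0] := eqVneq (nrm2 f) 0.
  have [->|In0] := eqVneq I 0; first by rewrite expr0n mulr_ge0 ?nrm2_ge0.
  have := key ((nrm2 g + 1) / (2 * I)); rewrite A0 mulr0 add0r.
  rewrite (_ : _ * I = nrm2 g + 1); last by field.
  by rewrite gerDl ler10.
have Ap : 0 < nrm2 f by rewrite lt_neqAle eq_sym A0 nrm2_ge0.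
have := key (I / nrm2 f).
rewrite (_ : 2 * _ * I = 2 * (I ^+ 2 / nrm2 f)); last by field.
rewrite (_ : _ ^+ 2 * nrm2 f = I ^+ 2 / nrm2 f); last by field.
rewrite -lerBlDl (_ : _ - _ = I ^+ 2 / nrm2 f); last by ring.
by rewrite ler_pdivrMr// mulrC.
Qed.

Lemma cauchy_schwarz_nrm f g : L2 f -> L2 g -> normc (ip f g) <= nrm f * nrm g.
Proof.
move=> Lf Lg; rewrite -(@ler_pXn2r _ 2) ?nnegrE ?normc_ge0 ?mulr_ge0 ?nrm_ge0//.
by rewrite exprMn !sqr_nrm cauchy_schwarz.
Qed.

Lemma nrmD f g : L2 f -> L2 g -> nrm (fun x => f x + g x) <= nrm f + nrm g.
Proof.
move=> Lf Lg; rewrite -(@ler_pXn2r _ 2) ?nnegrE ?addr_ge0 ?nrm_ge0//.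
have : Re (ip f g) <= nrm f * nrm g.
  rewrite (le_trans (ler_norm _))//.
  by rewrite (le_trans (normc_Re _))// cauchy_schwarz_nrm.
by rewrite sqr_nrm nrm2D// sqrrD !sqr_nrm; lra.
Qed.

Lemma nrmB f g : L2 f -> L2 g -> nrm (fun x => f x - g x) <= nrm f + nrm g.
Proof.
move=> Lf Lg; have := nrmD Lf (L2Z (-1) Lg).
under eq_fun do rewrite mulN1r.
by rewrite /nrm nrm2Z// normcN Normc.normc1 expr1n mul1r.
Qed.

Lemma nrm_tri f g h : L2 f -> L2 g -> L2 h ->
  nrm (fun x => f x - h x) <= nrm (fun x => f x - g x) + nrm (fun x => g x - h x).
Proof.
move=> Lf Lg Lh; have := nrmD (L2B Lf Lg) (L2B Lg Lh).
by under eq_fun do rewrite addrA subrK.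
Qed.

Lemma nrm2_eq0 f : L2 f -> nrm2 f = 0 -> {ae mu, forall x, f x = 0}.
Proof.
move=> Lf f0; have /L2P[mf iff] := Lf.
have := L2sqE Lf; rewrite f0 /L2sq => h0.
have : (\int[mu]_x `|(normc (f x) ^+ 2)%:E| = 0)%E.
  by rewrite -[RHS]h0; apply: eq_integral => x _; rewrite /= ger0_norm ?sqr_ge0.
have mm : measurable_fun setT (fun x => (normc (f x) ^+ 2)%:E).
  by apply/measurable_EFinP; exact: cmeas_sqr.
move/(@ae_eq_integral_abs _ _ _ mu setT measurableT _ mm).
apply: filterS => x /= /(_ Logic.I) [] /eqP.
by rewrite sqrf_eq0 => /eqP/Normc.eq0_normc.
Qed.

Lemma ae_nrm2 f g : cmeas f -> cmeas g -> {ae mu, forall x, f x = g x} ->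
  nrm2 g = nrm2 f.
Proof.
move=> mf mg fg; congr fine.
apply: ae_eq_integral => //; try (by apply/measurable_EFinP; exact: cmeas_sqr).
by apply: filterS fg => x + _ => /= ->.
Qed.

Lemma ae_ip f f' g g' : L2 f -> L2 f' -> L2 g -> L2 g' ->
  {ae mu, forall x, f x = f' x} -> {ae mu, forall x, g x = g' x} ->
  ip f g = ip f' g'.
Proof.
move=> Lf Lf' Lg Lg' ff' gg'; apply: ae_eq_cI.
- by have := cinteg_meas (cinteg_ip Lf Lg).
- by have := cinteg_meas (cinteg_ip Lf' Lg').
- by apply: filterS2 ff' gg' => x -> ->.
Qed.

End L2_theory.

Section L2_convergence.
Context {R : realType} {n : nat}.
Local Notation Rn := 'rV[R]_n.
Local Notation C := R[i].
Local Notation mu := (@leb R n).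
Implicit Types f g h : Rn -> C.

Lemma cvgnP (u : nat -> R) (l : R) : u k @[k --> \oo] --> l <->
  forall e : R, 0 < e -> exists K, forall k, (K <= k)%N -> `|u k - l| < e.
Proof.
split=> [/cvgrPdistC_lt h e e0|h].
  by have [K _ hK] := h e e0; exists K => k Kk; exact: hK.
apply/cvgrPdistC_lt => e e0; have [K hK] := h e e0.
by exists K => // k /= Kk; exact: hK.
Qed.

Lemma cvg0P (u : nat -> R) : u k @[k --> \oo] --> (0 : R) <->
  forall e : R, 0 < e -> exists K, forall k, (K <= k)%N -> `|u k| < e.
Proof.
by rewrite cvgnP; split=> h e /h[K hK]; exists K => k /hK; rewrite subr0.
Qed.

Lemma cvg_addnl (u : nat -> R) (k : nat) (l : R) : u j @[j --> \oo] --> l ->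
  u (k + j)%N @[j --> \oo] --> l.
Proof.
move=> /cvgnP h; apply/cvgnP => e /h[K hK]; exists K => j Kj.
by apply: hK; rewrite (leq_trans Kj)// leq_addl.
Qed.

Lemma squeeze0 (u v : nat -> R) : (forall k, 0 <= u k <= v k) ->
  v k @[k --> \oo] --> (0 : R) -> u k @[k --> \oo] --> (0 : R).
Proof.
move=> uv v0; apply: (squeeze_cvgr (f := fun=> 0) (h := v)) => //; last exact: cvg_cst.
exact: nearW.
Qed.

Lemma cvg_sqrt0 (u : nat -> R) : (forall k, 0 <= u k) ->
  u k @[k --> \oo] --> (0 : R) <-> Num.sqrt (u k) @[k --> \oo] --> (0 : R).
Proof.
move=> u0; split=> h.
  by rewrite -[X in _ --> X](@sqrtr0 R); apply: continuous_cvg => //; exact: sqrt_continuous.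
rewrite (_ : u = (fun k => Num.sqrt (u k) * Num.sqrt (u k))); last first.
  by apply/funext => k; rewrite -expr2 sqr_sqrtr.
by rewrite -[X in _ --> X](mulr0 (0 : R)); exact: cvgM.
Qed.

Lemma L2_cvgP (f_ : nat -> Rn -> C) f : (forall k, L2 (f_ k)) -> L2 f ->
  L2_cvg setT f_ f <-> nrm2 (fun x => f_ k x - f x) @[k --> \oo] --> (0 : R).
Proof.
move=> Lk Lf.
have E : (fun k => L2sq setT (f_ k \- f)) = (fun k => (nrm2 (fun x => f_ k x - f x))%:E).
  by apply/funext => k; rewrite L2sqE//; exact: L2B.
rewrite /L2_cvg E; split => [/fine_cvg//|h].
by apply: cvg_EFin => //; exact: nearW.
Qed.

Lemma L2_cvg_nrmP (f_ : nat -> Rn -> C) f : (forall k, L2 (f_ k)) -> L2 f ->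
  L2_cvg setT f_ f <-> nrm (fun x => f_ k x - f x) @[k --> \oo] --> (0 : R).
Proof.
move=> Lk Lf; rewrite L2_cvgP// cvg_sqrt0// => k; exact: nrm2_ge0.
Qed.

Lemma nrm_cvg (f_ : nat -> Rn -> C) f : (forall k, L2 (f_ k)) -> L2 f -> L2_cvg setT f_ f ->
  nrm (f_ k) @[k --> \oo] --> nrm f.
Proof.
move=> Lk Lf /(L2_cvg_nrmP Lk Lf) /cvg0P h.
apply/cvgnP => e e0; have [K hK] := h e e0.
exists K => k /hK; rewrite ger0_norm ?nrm_ge0//; apply: le_lt_trans.
have h1 := nrmD (L2B (Lk k) Lf) Lf.
have h2 := nrmB (Lk k) (L2B (Lk k) Lf).
rewrite (_ : (fun x => f_ k x - f x + f x) = f_ k) in h1; last first.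
  by apply/funext => x; rewrite subrK.
rewrite (_ : (fun x => f_ k x - (f_ k x - f x)) = f) in h2; last first.
  by apply/funext => x; rewrite opprB addrC subrK.
by rewrite ler_norml; apply/andP; split; lra.
Qed.

Lemma ip_cvg (f_ : nat -> Rn -> C) f (g_ : nat -> Rn -> C) g : (forall k, L2 (f_ k)) -> L2 f ->
  (forall k, L2 (g_ k)) -> L2 g -> L2_cvg setT f_ f -> L2_cvg setT g_ g ->
  normc (ip (f_ k) (g_ k) - ip f g) @[k --> \oo] --> (0 : R).
Proof.
move=> Lk Lf Lgk Lg cf cg.
have nf := nrm_cvg Lk Lf cf.
have c1 := (L2_cvg_nrmP Lk Lf).1 cf; have c2 := (L2_cvg_nrmP Lgk Lg).1 cg.
apply: (squeeze0 (v := fun k => nrm (f_ k) * nrm (fun x => g_ k x - g x) +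
    nrm (fun x => f_ k x - f x) * nrm g)); last first.
  have := cvgD (cvgM nf c2) (cvgM c1 (cvg_cst (nrm g))).
  by rewrite mulr0 mul0r addr0; apply.
move=> k; rewrite normc_ge0 andTb.
rewrite (_ : ip (f_ k) _ - _ = ip (f_ k) (fun x => g_ k x - g x) +
    ip (fun x => f_ k x - f x) g); last first.
  by rewrite ipBr// ipBl// addrA subrK.
apply: (le_trans (le_normcD _ _)); apply: lerD; apply: cauchy_schwarz_nrm => //.
  exact: L2B.
exact: L2B.
Qed.

Lemma cvg_normc_eq (u v : nat -> C) a b : (forall k, u k = v k) ->
  normc (u k - a) @[k --> \oo] --> (0 : R) ->
  normc (v k - b) @[k --> \oo] --> (0 : R) -> a = b.
Proof.
move=> uv ua vb; apply/eqP; rewrite -subr_eq0; apply/eqP/Normc.eq0_normc.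
apply/eqP; rewrite eq_le normc_ge0 andbT; apply/ler_addgt0Pl => e e0.
have /cvg0P/(_ (e/2))[|K1 h1] := ua; first by rewrite divr_gt0.
have /cvg0P/(_ (e/2))[|K2 h2] := vb; first by rewrite divr_gt0.
have := h1 _ (leq_maxl K1 K2); have := h2 _ (leq_maxr K1 K2).
set k := maxn _ _; rewrite !ger0_norm ?normc_ge0//.
rewrite addr0 -uv => i2 i1.
have -> : a - b = (u k - b) - (u k - a) by ring.
by rewrite (le_trans (le_normcD _ _))// normcN; lra.
Qed.

Lemma L2sq_fatou (g_ : nat -> Rn -> C) g (c : \bar R) :
  (forall k, cmeas (g_ k)) -> cmeas g ->
  {ae mu, forall x, ccvg (g_^~ x) (g x)} ->
  (forall k, (L2sq setT (g_ k) <= c)%E) -> (L2sq setT g <= c)%E.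
Proof.
move=> mk mg cg gc.
pose F k x : \bar R := ((normc (g_ k x)) ^+ 2)%:E.
have mF k : measurable_fun setT (F k).
  by apply/measurable_EFinP; exact: cmeas_sqr.
have F0 k x : setT x -> (0 <= F k x)%E by rewrite lee_fin sqr_ge0.
apply: (@le_trans _ _ (\int[mu]_x limn_einf (F^~ x))%E).
  apply: ae_ge0_le_integral => //.
  - by move=> x _; rewrite lee_fin sqr_ge0.
  - by apply/measurable_EFinP; exact: cmeas_sqr.
  - move=> x _; rewrite limn_einf_lim; apply: lime_ge; first exact: is_cvg_einfs.
    apply: nearW => k; apply: le_ereal_inf_tmp => _ [m _ <-]; exact: F0.
  - apply: (@emeasurable_fun_cvg _ _ _ _ (fun m x => einfs (F^~ x) m)).
      by move=> m; exact: measurable_fun_einfs.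
    by move=> x _; rewrite limn_einf_lim; exact: is_cvg_einfs.
  - apply: filterS cg => x [c1 c2] _.
    have cF : F^~ x k @[k --> \oo] --> ((normc (g x) ^+ 2)%:E).
      apply: cvg_EFin; first exact: nearW.
      rewrite (_ : fine \o _ = fun k => Re (g_ k x) ^+ 2 + Im (g_ k x) ^+ 2); last first.
        by apply/funext => k /=; rewrite sqr_normcE.
      by rewrite sqr_normcE !expr2; apply: cvgD; exact: cvgM.
    rewrite is_cvg_limn_einfE; last by apply/cvg_ex; eexists; exact: cF.
    by rewrite (cvg_lim _ cF).
apply: (le_trans (fatou mu measurableT mF F0)).
rewrite limn_einf_lim; apply: lime_le; first exact: is_cvg_einfs.
apply: nearW => k; apply: le_trans (gc k).
by apply: ereal_inf_lbound; exists k => //=.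
Qed.

Lemma fast_cauchy_cvg (a : nat -> R) (M : R) :
  (forall k, `|a k.+1 - a k| <= M / 2 ^+ k) -> cvgn a.
Proof.
move=> aM.
have cs : cvgn (series (telescope a)).
  apply: (@normed_cvg _ R^o (telescope a)).
  apply: (@series_le_cvg _ _ (geometric M 2^-1)).
  - by move=> k; exact: normr_ge0.
  - by move=> k; have := le_trans (normr_ge0 _) (aM k); rewrite /geometric/= exprVn.
  - by move=> k; rewrite /geometric/= exprVn; exact: aM.
  - by apply: is_cvg_geometric_series; rewrite ger0_norm ?invr_ge0// invf_lt1// ltr1n.
move: cs; rewrite telescopeK => cs.
rewrite (_ : a = fun k => (a k - a 0%N) + a 0%N); last by apply/funext => k; rewrite subrK.
apply: is_cvgD; first exact: cs.
exact: is_cvg_cst.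
Qed.

Lemma fast_cauchy_nrm (f_ : nat -> Rn -> C) : (forall k, L2 (f_ k)) ->
  (forall k, nrm (fun x => f_ k.+1 x - f_ k x) <= (4 ^+ k)^-1) ->
  forall m j, nrm (fun x => f_ (m + j)%N x - f_ m x) <= 2 / 4 ^+ m.
Proof.
(* The bound is sharpened for the induction: passing from [j] to [j + 1] adds [1/4^(m+j)], while the
   sharpened bound gains [(3/2)/4^(m+j)]. *)
move=> Lk fk m j; suff : nrm (fun x => f_ (m + j)%N x - f_ m x) <=
    (2 - 2 / 4 ^+ j) / 4 ^+ m.
  move=> /le_trans; apply; rewrite ler_pM2r ?invr_gt0 ?exprn_gt0//.
  by rewrite gerBl divr_ge0 ?exprn_ge0.
elim: j => [|j ih].
  rewrite addn0; under eq_fun do rewrite subrr.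
  rewrite /nrm nrm20 sqrtr0 mulr_ge0 ?invr_ge0 ?exprn_ge0// expr0 divr1.
  by rewrite subrr.
rewrite addnS; apply: (le_trans (nrm_tri (Lk _) (Lk (m + j)%N) (Lk _))).
apply: (le_trans (lerD (fk _) ih)).
have h4 k : (0 : R) < 4 ^+ k by rewrite exprn_gt0.
rewrite exprD invfM mulrC -mulrDl.
rewrite ler_pM2r ?invr_gt0// exprS invfM.
have : (0 : R) < (4 ^+ j)^-1 by rewrite invr_gt0.
by lra.
Qed.

(** Riesz-Fischer. The series of the [4^k |f_(k+1) - f_k|^2] has integral at most the sum of the
    [4^-k], so it is finite almost everywhere, and there the increments are bounded by a constant
    times [2^-k]. The limit is taken on the set [E] of finiteness and put equal to [0] elsewhere,
    which keeps it measurable; Fatou's lemma gives the rate. *)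
Lemma L2_complete (f_ : nat -> Rn -> C) : (forall k, L2 (f_ k)) ->
  (forall k, nrm (fun x => f_ k.+1 x - f_ k x) <= (4 ^+ k)^-1) ->
  exists2 f, L2 f & forall k, nrm (fun x => f_ k x - f x) <= 2 / 4 ^+ k.
Proof.
move=> Lk fk.
have h4 k : (0 : R) < 4 ^+ k by rewrite exprn_gt0.
have h2 k : (0 : R) < 2 ^+ k by rewrite exprn_gt0.
pose D k x : \bar R := (4 ^+ k * normc (f_ k.+1 x - f_ k x) ^+ 2)%:E.
have mD k : measurable_fun setT (D k).
  apply/measurable_EFinP; apply: measurable_funM; first exact: measurable_cst.
  by apply: cmeas_sqr; apply: cmeasB; exact: L2_meas.
have D0 k x : setT x -> (0 <= D k x)%E.
  by move=> _; rewrite lee_fin mulr_ge0 ?sqr_ge0// ltW.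
pose S x := (\sum_(k <oo) D k x)%E.
have mS : measurable_fun setT S.
  apply: (@emeasurable_fun_cvg _ _ _ _ (fun m x => (\sum_(0 <= k < m) D k x)%E)).
    by move=> m; exact: emeasurable_sum.
  by move=> x _; apply: is_cvg_nneseries => k _ _; exact: D0.
have S0 x : (0 <= S x)%E by apply: nneseries_ge0 => k _ _; exact: D0.
have Sfin : {ae mu, forall x, (S x < +oo)%E}.
  have iS : mu.-integrable setT S.
    apply/integrableP; split => //.
    under eq_integral do rewrite gee0_abs//.
    rewrite integral_nneseries//.
    apply: (@le_lt_trans _ _ (\sum_(k <oo) (geometric 1 (4^-1) k)%:E)%E).
      apply: lee_nneseries => [k _ _|k _]; first by apply: integral_ge0 => x; exact: D0.
      rewrite /D; under eq_integral do rewrite EFinM.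
      have mk : measurable_fun setT (fun x => (normc (f_ k.+1 x - f_ k x) ^+ 2)%:E).
        by apply/measurable_EFinP; apply: cmeas_sqr; apply: cmeasB; exact: L2_meas.
      rewrite (ge0_integralZl_EFin _ measurableT _ mk) ?(ltW (h4 k))//; last first.
        by move=> x _; rewrite lee_fin sqr_ge0.
      have := L2sqE (L2B (Lk k.+1) (Lk k)); rewrite /L2sq/= => ->.
      rewrite -EFinM lee_fin /geometric/= mul1r exprVn -sqr_nrm.
      have fk2 : nrm (fun x => f_ k.+1 x - f_ k x) ^+ 2 <= (4 ^+ k)^-1 ^+ 2.
        by rewrite ler_pXn2r// nnegrE ?nrm_ge0 ?invr_ge0 ?(ltW (h4 _)).
      apply: (le_trans (ler_wpM2l (ltW (h4 k)) fk2)).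
      by rewrite expr2 mulrA divff ?mul1r// gt_eqF.
    have cg : cvgn (series (geometric (1 : R) 4^-1)).
      by apply: is_cvg_geometric_series; rewrite ger0_norm ?invr_ge0// invf_lt1// ltr1n.
    rewrite (_ : (fun m => \sum_(0 <= k < m) (geometric 1 4^-1 k)%:E)%E =
       EFin \o series (geometric (1 : R) 4^-1)); last first.
      by apply/funext => m; rewrite /= sumEFin.
    by rewrite EFin_lim// ltry.
  have := integrable_ae measurableT iS; apply: filterS => x /(_ Logic.I).
  by rewrite ge0_fin_numE.
have Dle x : (S x < +oo)%E -> exists M, forall k, normc (f_ k.+1 x - f_ k x) <= M / 2 ^+ k.
  move=> Sx; exists (Num.sqrt (fine (S x))) => k.
  have : (D k x <= S x)%E.
    apply: le_trans (nneseries_lim_ge (P := xpredT) (m := 0) k.+1 (fun j _ _ => D0 j x Logic.I)).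
    by rewrite big_nat_recr//=; apply: leeDr; apply: sume_ge0 => j _; exact: D0.
  have Sf : (S x \is a fin_num) by rewrite ge0_fin_numE.
  rewrite /D -[X in (_ <= X)%E -> _]fineK// lee_fin => DS.
  rewrite ler_pdivlMr// -(@ler_pXn2r _ 2) ?nnegrE ?mulr_ge0 ?normc_ge0 ?sqrtr_ge0 ?(ltW (h2 _))//.
  rewrite sqr_sqrtr ?fine_ge0// exprMn -exprM mulnC exprM mulrC.
  by rewrite (_ : 2 ^+ 2 = 4 :> R)// -natrX.
pose E := [set x | (S x < +oo)%E].
have mE : measurable E.
  by rewrite -[E]setTI; exact: emeasurable_fun_infty_o.
pose g k x := (\1_E x)%:C * f_ k x.
have mg k : cmeas (g k).
  apply: cmeasM; last exact: L2_meas.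
  by apply: cmeas_real; exact: measurable_indic.
pose f x : C := (limn (fun k => Re (g k x))) +i* (limn (fun k => Im (g k x))).
have gf x : ccvg (g^~ x) (f x).
  have [xE|xE] := pselect (E x); last first.
    have g0 k : g k x = 0 by rewrite /g indicE memNset ?mul0r.
    by split; rewrite /f/= (_ : (fun k => _) = fun=> 0);
      [exact: is_cvg_cst|by apply/funext => k; rewrite g0|
       exact: is_cvg_cst|by apply/funext => k; rewrite g0].
  have gE k : g k x = f_ k x by rewrite /g indicE mem_set ?mul1r.
  have [M hM] := Dle x xE.
  split; rewrite /f/=; apply: (@fast_cauchy_cvg _ M) => k; rewrite !gE.
    by rewrite -cReB (le_trans (normc_Re _)).
  by rewrite -cImB (le_trans (normc_Im _)).
have mf : cmeas f.
  split.
    by apply: (measurable_fun_cvg (h := fun k x => Re (g k x))) => [k|x _];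
      [case: (mg k)|case: (gf x)].
  by apply: (measurable_fun_cvg (h := fun k x => Im (g k x))) => [k|x _];
    [case: (mg k)|case: (gf x)].
have ae_f : {ae mu, forall x, ccvg (f_^~ x) (f x)}.
  apply: filterS Sfin => x xE; have gE k : g k x = f_ k x.
    by rewrite /g indicE mem_set ?mul1r.
  by have := gf x; rewrite /ccvg; under eq_fun do rewrite gE; under [X in _ /\ (X @ _ --> _)]eq_fun do rewrite gE.
have bound k : (L2sq setT (fun x => (f x - f_ k x)%R) <= ((2 / 4 ^+ k) ^+ 2)%:E)%E.
  apply: (@L2sq_fatou (fun j x => f_ (k + j)%N x - f_ k x)).
  - by move=> j; apply: cmeasB; exact: L2_meas.
  - by apply: cmeasB => //; exact: L2_meas.
  - apply: filterS ae_f => x [c1 c2]; split; under eq_fun do rewrite ReImE; rewrite ReImE.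
      apply: cvgB; last exact: cvg_cst.
      exact: (cvg_addnl (u := fun j => Re (f_ j x))).
    apply: cvgB; last exact: cvg_cst.
    exact: (cvg_addnl (u := fun j => Im (f_ j x))).
  - move=> j; rewrite L2sqE; last exact: L2B.
    have d0 : 0 <= 2 / 4 ^+ k :> R by rewrite divr_ge0// ltW.
    rewrite lee_fin -sqr_nrm ler_pXn2r ?nnegrE ?nrm_ge0//.
    exact: fast_cauchy_nrm.
have LD k : L2 (fun x => f x - f_ k x).
  split; last by rewrite (le_lt_trans (bound k))// ltry.
  by apply: cmeasB => //; exact: L2_meas.
have Lf : L2 f.
  by have := L2D (LD 0%N) (Lk 0%N); under eq_fun do rewrite subrK.
exists f => // k; rewrite -(@ler_pXn2r _ 2) ?nnegrE ?nrm_ge0 ?divr_ge0 ?(ltW (h4 _))//.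
by rewrite sqr_nrm nrm2_subC -lee_fin -L2sqE.
Qed.

End L2_convergence.

(** * Plancherel's theorem *)

Section poisson_kernel.
Local Notation "x ^*" := (conjc x) : ring_scope.
Context {R : realType}.
Local Notation leb1 := (@lebesgue_measure R).
Implicit Types (e t x y a b : R) (f F : R -> R).

Lemma is_derive_affine f (c d x df : R) : is_derive (c * x + d) (1 : R) f df ->
  is_derive x (1 : R) (fun y => f (c * y + d)) (c * df).
Proof.
move=> hf; have ha : is_derive x (1 : R) (fun y => c * y + d) c.
  by apply: is_derive_eq; rewrite /GRing.scale/= ?(mulr0, addr0, add0r, mulr1).
by have := is_derive1_comp (f := f) (g := fun y => c * y + d) (x := x) hf ha; rewrite mulrC.
Qed.

Lemma is_derive1_cts f df : (forall x, is_derive x (1 : R) f (df x)) -> continuous f.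
Proof.
move=> h x; apply: differentiable_continuous; apply/derivable1_diffP.
by have [] := h x.
Qed.

(** The fundamental theorem of calculus on a half-line is used for nonnegative integrands with an
    everywhere differentiable primitive; [exp(- e |x|)] meets this only after being cut at [0]. *)
Lemma integral_half f : (forall x, 0 <= f x) -> continuous f ->
  (\int[leb1]_x (f x)%:E = \int[leb1]_(x in `[0%R, +oo[) (f x)%:E +
     \int[leb1]_(x in `[0%R, +oo[) (f (- x))%:E)%E.
Proof.
move=> f0 cf; have mf : measurable_fun setT f by exact: continuous_measurable_fun.
have mI : measurable (`[0%R, +oo[%classic : set R) by [].
rewrite -(setUv (`[0%R, +oo[%classic : set R)) ge0_integral_setU//=; last 4 first.
- exact: measurableC.
- by rewrite setUv; exact/measurable_EFinP.
- by move=> x _; rewrite lee_fin.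
- exact/disj_setPCl.
congr (_ + _)%E; rewrite setCitvr.
rewrite integral_itv_bndo_bndc; last exact/measurable_EFinP/measurable_funTS.
rewrite -{1}oppr0 ge0_integration_by_substitutionNy//.
exact: continuous_subspaceT.
Qed.

Lemma FTC_half f F (l : R) : (forall x, 0 <= x -> 0 <= f x) -> continuous f ->
  (forall x, is_derive x (1 : R) F (f x)) -> F x @[x --> +oo] --> l ->
  (\int[leb1]_(x in `[0%R, +oo[) (f x)%:E = (l - F 0)%:E)%E.
Proof.
move=> f0 cf dF Fl; rewrite (@ge0_continuous_FTC2y _ f F 0 l)//.
- exact: continuous_subspaceT.
- by apply: cvg_at_right_filter; exact: (is_derive1_cts dF).
- by move=> x _; rewrite derive1E; exact: derive_val.
Qed.

(** A convergence factor and its transform, the Poisson kernel. In contrast with Gaussians, all the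
    primitives involved are elementary, and the convolution of [pk] with the indicator of an
    interval is a difference of arctangents. *)
Definition gk e x : R := expR (- (e * `|x|)).
Definition pk e t : R := 2 * e / (e ^+ 2 + (2 * pi * t) ^+ 2).

Lemma continuous_gk e : continuous (gk e).
Proof.
move=> x; apply: (@continuous_comp _ _ _ (fun x : R => - (e * `|x|)) expR).
  apply: cvgN; apply: cvgM; first exact: cvg_cst.
  exact: norm_continuous.
exact: continuous_expR.
Qed.

Lemma gkN e x : gk e (- x) = gk e x. Proof. by rewrite /gk normrN. Qed.
Lemma gk_ge0 e x : 0 <= gk e x. Proof. exact: expR_ge0. Qed.

Lemma cvg_expR_lin0 e : 0 < e -> expR (- e * x) @[x --> +oo] --> (0 : R).
Proof.
move=> e0; under eq_fun do rewrite mulNr.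
apply: (cvg_comp (fun x => e * x) (fun y => expR (- y))); last exact: cvgr_expR.
by apply/gt0_cvgMry => //; exact: cvg_id.
Qed.

Lemma is_derive_exp_lin e x : is_derive x (1 : R) (fun y => expR (- e * y)) (- e * expR (- e * x)).
Proof.
rewrite (_ : (fun y => _) = fun y => expR (- e * y + 0)); last by under eq_fun do rewrite -[- e * _]addr0.
have := @is_derive_affine expR (- e) 0 x (expR (- e * x + 0)) (is_derive_expR _).
by rewrite addr0.
Qed.

Lemma is_derive_sin_lin b x : is_derive x (1 : R) (fun y => sin (b * y)) (b * cos (b * x)).
Proof.
rewrite (_ : (fun y => _) = fun y => sin (b * y + 0)); last by under eq_fun do rewrite -[b * _]addr0.
have := @is_derive_affine sin b 0 x (cos (b * x + 0)) (is_derive_sin _).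
by rewrite addr0.
Qed.

Lemma is_derive_cos_lin b x : is_derive x (1 : R) (fun y => cos (b * y)) (- b * sin (b * x)).
Proof.
rewrite (_ : (fun y => _) = fun y => cos (b * y + 0)); last by under eq_fun do rewrite -[b * _]addr0.
have := @is_derive_affine cos b 0 x (- sin (b * x + 0)) (is_derive_cos _).
by rewrite addr0 mulrN mulNr.
Qed.

Lemma integral_exp_half e : 0 < e ->
  (\int[leb1]_(x in `[0%R, +oo[) (expR (- e * x))%:E = (e^-1)%:E)%E.
Proof.
move=> e0.
have dF x : is_derive x (1 : R) (fun x => - e^-1 * expR (- e * x)) (expR (- e * x)).
  have h := is_derive_exp_lin e x.
  apply: is_derive_eq; rewrite /GRing.scale/= ?mulr0 ?addr0.
  by rewrite mulrA mulrNN mulVf ?mul1r// gt_eqF.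
rewrite (FTC_half (fun x _ => expR_ge0 _) (is_derive1_cts (is_derive_exp_lin e)) dF (l := 0)).
  by rewrite mulr0 expR0 mulr1 sub0r opprK.
rewrite -[X in _ --> X](mulr0 (- e^-1)); apply: cvgM; first exact: cvg_cst.
exact: cvg_expR_lin0.
Qed.

(** [1 + cos] replaces [cos] to keep the integrand nonnegative; the extra [1/e] is subtracted
    afterwards. The primitive is [exp(- e x) G x]. *)
Lemma integral_exp_cos_half e b : 0 < e ->
  (\int[leb1]_(x in `[0%R, +oo[) (expR (- e * x) * (1 + cos (b * x)))%:E =
   (e^-1 + e / (e ^+ 2 + b ^+ 2))%:E)%E.
Proof.
move=> e0; have q0 : e ^+ 2 + b ^+ 2 != 0.
  by rewrite gt_eqF// ltr_wpDr ?sqr_ge0// exprn_gt0.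
pose G x := (b * sin (b * x) - e * cos (b * x)) / (e ^+ 2 + b ^+ 2) - e^-1.
have f0 x : 0 <= x -> 0 <= expR (- e * x) * (1 + cos (b * x)).
  by move=> _; have := cos_geN1 (b * x) => c1; rewrite mulr_ge0 ?expR_ge0//; lra.
have cf : continuous (fun x => expR (- e * x) * (1 + cos (b * x))).
  move=> x; apply: cvgM; first exact: (is_derive1_cts (is_derive_exp_lin e)).
  by apply: cvgD; [exact: cvg_cst|exact: (is_derive1_cts (is_derive_cos_lin b))].
have dF x : is_derive x (1 : R) (fun x => expR (- e * x) * G x)
    (expR (- e * x) * (1 + cos (b * x))).
  have h1 := is_derive_exp_lin e x.
  have h2 := is_derive_sin_lin b x; have h3 := is_derive_cos_lin b x.
  apply: is_derive_eq; rewrite /G /GRing.scale/=.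
  by field; rewrite q0 gt_eqF.
rewrite (FTC_half f0 cf dF (l := 0)).
  by rewrite /G !mulr0 expR0 sin0 cos0; congr EFin; field; rewrite q0 gt_eqF.
apply/cvgr0Pnorm_lt => d d0.
  pose M := (`|b| + e) / (e ^+ 2 + b ^+ 2) + e^-1.
  have q1 : 0 < e ^+ 2 + b ^+ 2 by rewrite lt_neqAle eq_sym q0 addr_ge0 ?sqr_ge0.
  have M0 : 0 < M.
    apply: ltr_wpDl; last by rewrite invr_gt0.
    by apply: divr_ge0; [apply: addr_ge0 => //; exact: ltW|exact: ltW].
  have GM x : `|G x| <= M.
    rewrite /G /M (le_trans (ler_normB _ _))// lerD//; last by rewrite ger0_norm// invr_ge0 ltW.
    rewrite normrM [X in _ * X]ger0_norm ?invr_ge0 ?(ltW q1)// ler_pM2r ?invr_gt0//.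
    rewrite (le_trans (ler_normB _ _))// !normrM (gtr0_norm e0) lerD//.
      by rewrite ler_piMr// ler_norml sin_geN1 sin_le1.
    by rewrite ler_piMr ?(ltW e0)// ler_norml cos_geN1 cos_le1.
  have := cvg_expR_lin0 e0; move=> /cvgr0Pnorm_lt /(_ (d / M)); rewrite divr_gt0// => /(_ isT).
  apply: filterS => x; rewrite ltr_pdivlMr//; apply: le_lt_trans.
  by rewrite normrM ler_wpM2l.
Qed.

Lemma integral_gk_half e : 0 < e ->
  (\int[leb1]_(x in `[0%R, +oo[) (gk e x)%:E = (e^-1)%:E)%E.
Proof.
move=> e0; rewrite -integral_exp_half//; apply: eq_integral => x.
by rewrite inE/= in_itv/= andbT => x0; rewrite /gk ger0_norm// mulNr.
Qed.

Lemma integral_gk e : 0 < e -> (\int[leb1]_x (gk e x)%:E = (2 / e)%:E)%E.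
Proof.
move=> e0; rewrite integral_half; [|exact: gk_ge0|exact: continuous_gk].
under [X in (_ + X)%E]eq_integral do rewrite gkN.
by rewrite integral_gk_half// -EFinD; congr EFin; field; rewrite gt_eqF.
Qed.

Lemma integrable_gk e : 0 < e -> leb1.-integrable setT (EFin \o gk e).
Proof.
move=> e0; apply/integrableP; split.
  by apply/measurable_EFinP; apply: continuous_measurable_fun; exact: continuous_gk.
under eq_integral do rewrite /= ger0_norm ?gk_ge0//.
by rewrite integral_gk// ltry.
Qed.

Lemma integral_gk_cos e b : 0 < e ->
  \int[leb1]_x (gk e x * cos (b * x)) = 2 * e / (e ^+ 2 + b ^+ 2).
Proof.
move=> e0.
have mc : measurable_fun setT (fun x => gk e x * cos (b * x)).
  apply: continuous_measurable_fun => x; apply: cvgM; first exact: continuous_gk.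
  exact: (is_derive1_cts (is_derive_cos_lin b)).
have ic : leb1.-integrable setT (EFin \o (fun x => gk e x * cos (b * x))).
  apply: (le_integrable _ _ _ (integrable_gk e0)) => //; first exact/measurable_EFinP.
  move=> x _ /=; rewrite lee_fin normrM ler_piMr//.
  by rewrite ler_norml cos_geN1 cos_le1.
have E : (\int[leb1]_x (gk e x * (1 + cos (b * x)))%:E =
    (2 * (e^-1 + e / (e ^+ 2 + b ^+ 2)))%:E)%E.
  rewrite integral_half.
  - rewrite (_ : (\int[leb1]_(x in _) (gk e (- x) * _)%:E)%E =
       (\int[leb1]_(x in `[0%R, +oo[) (gk e x * (1 + cos (b * x)))%:E)%E); last first.
      by apply: eq_integral => x _; rewrite gkN mulrN cosN.
    rewrite (_ : (\int[leb1]_(x in _) _)%E =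
       (\int[leb1]_(x in `[0%R, +oo[) (expR (- e * x) * (1 + cos (b * x)))%:E)%E); last first.
      apply: eq_integral => x; rewrite inE/= in_itv/= andbT => x0.
      by rewrite /gk ger0_norm// mulNr.
    by rewrite integral_exp_cos_half// -EFinD; congr EFin; ring.
  - by move=> x; have := cos_geN1 (b * x) => c1; rewrite mulr_ge0 ?gk_ge0//; lra.
  - move=> x; apply: cvgM; first exact: continuous_gk.
    by apply: cvgD; [exact: cvg_cst|exact: (is_derive1_cts (is_derive_cos_lin b))].
have := congr1 fine E; rewrite -/(Rintegral _ _ _).
under eq_Rintegral do rewrite mulrDr mulr1.
rewrite RintegralD//; last exact: integrable_gk.
have -> : \int[leb1]_x gk e x = 2 / e by rewrite /Rintegral integral_gk.
by move=> /= h; rewrite -[LHS](addKr (2 / e)) h; ring.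
Qed.

(** Parity, again with nonnegative integrands: the two half-lines contribute [gk (1 + sin)] and
    [gk (1 - sin)], whose sum is [2 gk]. Thus [gk (1 + sin)] and [gk] have the same integral. *)
Lemma integral_gk_sin e b : 0 < e -> \int[leb1]_x (gk e x * sin (b * x)) = 0.
Proof.
move=> e0.
have cc : continuous (fun x => gk e x * sin (b * x)).
  move=> x; apply: cvgM; first exact: continuous_gk.
  exact: (is_derive1_cts (is_derive_sin_lin b)).
have ic : leb1.-integrable setT (EFin \o (fun x => gk e x * sin (b * x))).
  apply: (le_integrable _ _ _ (integrable_gk e0)) => //.
    by apply/measurable_EFinP; exact: continuous_measurable_fun.
  move=> x _ /=; rewrite lee_fin normrM ler_piMr//.
  by rewrite ler_norml sin_geN1 sin_le1.
have g0 (s : R) x : `|s| = 1 -> 0 <= gk e x * (1 + s * sin (b * x)).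
  move=> s1.
  have : `|s * sin (b * x)| <= 1 by rewrite normrM s1 mul1r ler_norml sin_geN1 sin_le1.
  by rewrite ler_norml => /andP[? ?]; rewrite mulr_ge0 ?gk_ge0//; lra.
have cs (s : R) : continuous (fun x => gk e x * (1 + s * sin (b * x))).
  move=> x; apply: cvgM; first exact: continuous_gk.
  apply: cvgD; first exact: cvg_cst.
  by apply: cvgM; [exact: cvg_cst|exact: (is_derive1_cts (is_derive_sin_lin b))].
have E : (\int[leb1]_x (gk e x * (1 + 1 * sin (b * x)))%:E = (2 / e)%:E)%E.
  rewrite integral_half; [|by move=> x; apply: g0; rewrite normr1|exact: cs].
  rewrite (_ : (\int[leb1]_(x in _) (gk e (- x) * _)%:E)%E =
       (\int[leb1]_(x in `[0%R, +oo[) (gk e x * (1 + (-1) * sin (b * x)))%:E)%E); last first.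
    by apply: eq_integral => x _; rewrite gkN mulrN sinN mul1r mulN1r.
  rewrite -ge0_integralD//.
  - rewrite (_ : (\int[leb1]_(x in _) _)%E =
       (\int[leb1]_(x in `[0%R, +oo[) (2%:E * (gk e x)%:E))%E); last first.
      by apply: eq_integral => x _; rewrite -EFinD -EFinM; congr EFin; ring.
    rewrite ge0_integralZl_EFin//.
    + by rewrite integral_gk_half.
    + by move=> x _; rewrite lee_fin gk_ge0.
    + apply/measurable_EFinP/measurable_funTS; apply: continuous_measurable_fun.
      exact: continuous_gk.
  - by move=> x _; rewrite lee_fin g0// normr1.
  - by apply/measurable_EFinP/measurable_funTS; exact: continuous_measurable_fun.
  - by move=> x _; rewrite lee_fin g0// normrN1.
  - by apply/measurable_EFinP/measurable_funTS; exact: continuous_measurable_fun.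
have := congr1 fine E; rewrite -/(Rintegral _ _ _).
under eq_Rintegral do rewrite mul1r mulrDr mulr1.
rewrite RintegralD//; last exact: integrable_gk.
have -> : \int[leb1]_x gk e x = 2 / e by rewrite /Rintegral integral_gk.
by move=> /= h; rewrite -[LHS](addKr (2 / e)) h; ring.
Qed.

Definition cis t : R[i] := cos t +i* sin t.

Lemma normc_cis t : normc (cis t) = 1.
Proof. by rewrite /= cos2Dsin2 sqrtr1. Qed.

Lemma cisD s t : cis (s + t) = cis s * cis t.
Proof. by apply: complex_ext; rewrite /= ?cosD ?sinD; ring. Qed.

Lemma cis0 : cis 0 = 1. Proof. by rewrite /cis cos0 sin0. Qed.

Lemma cis_conj t : (cis t)^* = cis (- t).
Proof. by rewrite /cis/= cosN sinN. Qed.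

Lemma cis_sum (I : Type) (r : seq I) (P : pred I) (F : I -> R) :
  cis (\sum_(i <- r | P i) F i) = \prod_(i <- r | P i) cis (F i).
Proof. by elim/big_rec2 : _ => [|i a b _ <-]; [exact: cis0|exact: cisD]. Qed.

Lemma cI_gk_cis e t : 0 < e ->
  cinteg leb1 (fun x => (gk e x)%:C * cis (2 * pi * t * x)) /\
  cI leb1 (fun x => (gk e x)%:C * cis (2 * pi * t * x)) = (pk e t)%:C.
Proof.
move=> e0; split.
  apply: (@cinteg_le _ (measurableTypeR R) R leb1 _ (gk e)).
  - apply: cmeasM.
      by apply: cmeas_real; apply: continuous_measurable_fun; exact: continuous_gk.
    split; apply: continuous_measurable_fun => /=.
      exact: (is_derive1_cts (is_derive_cos_lin _)).
    exact: (is_derive1_cts (is_derive_sin_lin _)).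
  - exact: integrable_gk.
  - by move=> x; rewrite Normc.normcM normc_cis mulr1 normc_real ger0_norm ?gk_ge0.
apply: complex_ext => /=.
  under eq_Rintegral do rewrite mul0r subr0.
  by rewrite integral_gk_cos.
under eq_Rintegral do rewrite mul0r addr0.
exact: integral_gk_sin.
Qed.

(** The odd primitive of [pk e]. Its limits at infinity are [-1/2] and [1/2], and it tends to half
    the sign function as [e] tends to [0]. *)
Definition atk e t : R := atan (2 * pi / e * t) / pi.

Lemma pi_neq0 : pi != 0 :> R. Proof. by rewrite gt_eqF// pi_gt0. Qed.

Lemma pk_ge0 e t : 0 < e -> 0 <= pk e t.
Proof.
by move=> e0; rewrite /pk divr_ge0 ?addr_ge0 ?sqr_ge0// mulr_ge0// ltW.
Qed.

Lemma is_derive_atk e (s d x : R) : 0 < e ->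
  is_derive x (1 : R) (fun y => atk e (s * y + d)) (s * pk e (s * x + d)).
Proof.
move=> e0; have p0 := pi_neq0.
have h : is_derive (s * x + d) (1 : R) (atk e) (pk e (s * x + d)).
  set z := s * x + d.
  have := @is_derive_affine atan (2 * pi / e) 0 z _ (is_derive1_atan _).
  rewrite addr0 (_ : (fun y => _) = (fun y => atan (2 * pi / e * y))) => [h|]; last first.
    by under eq_fun do rewrite addr0.
  apply: is_derive_eq; rewrite /GRing.scale/= /pk ?mulr0 ?add0r ?addr0.
  have q1 : e ^+ 2 + (2 * pi * z) ^+ 2 != 0.
    by rewrite gt_eqF// ltr_wpDr ?sqr_ge0// exprn_gt0.
  have -> : 1 + (2 * pi / e * z) ^+ 2 = (e ^+ 2 + (2 * pi * z) ^+ 2) / e ^+ 2.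
    by field; rewrite gt_eqF.
  move: (e ^+ 2 + _) q1 => D D0.
  have H (P : R) : P != 0 -> P^-1 * (2 * P / e / (D / e ^+ 2)) = 2 * e / D.
    by move=> P0; field; rewrite D0 P0 gt_eqF.
  exact: H.
exact: is_derive_affine.
Qed.

Lemma continuous_pk e : 0 < e -> continuous (pk e).
Proof.
move=> e0 x; apply: cvgM; first exact: cvg_cst.
apply: cvgV.
  by rewrite gt_eqF// ltr_wpDr ?sqr_ge0// exprn_gt0.
apply: cvgD; first exact: cvg_cst.
apply: (@continuous_comp _ _ _ (fun x : R => 2 * pi * x) (fun y => y ^+ 2)).
  by apply: cvgM; [exact: cvg_cst|exact: cvg_id].
exact: exprn_continuous.
Qed.

Lemma pkN e t : pk e (- t) = pk e t.
Proof. by rewrite /pk mulrN sqrrN. Qed.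

Lemma cvg_atk e d : 0 < e -> atk e (1 * x + d) @[x --> +oo] --> (2^-1 : R).
Proof.
move=> e0; rewrite (_ : 2^-1 = pi / 2 / pi); last by rewrite mulrAC divff ?mul1r// pi_neq0.
apply: cvgM; last exact: cvg_cst.
apply: (cvg_comp (fun x => 2 * pi / e * (1 * x + d)) atan); last exact: cvgy_atan.
apply/gt0_cvgMry; first by rewrite divr_gt0// mulr_gt0// pi_gt0.
by under eq_fun do rewrite mul1r; exact: cvg_addrr.
Qed.

Lemma atkN e t : atk e (- t) = - atk e t.
Proof. by rewrite /atk mulrN atanN mulNr. Qed.

Lemma integral_pk e x : 0 < e -> (\int[leb1]_y (pk e (x - y))%:E = 1)%E.
Proof.
move=> e0.
have cp (s d : R) : continuous (fun y => pk e (s * y + d)).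
  move=> z; apply: (@continuous_comp _ _ _ (fun y : R => s * y + d) (pk e)).
    apply: cvgD; last exact: cvg_cst.
    by apply: cvgM; [exact: cvg_cst|exact: cvg_id].
  exact: continuous_pk.
have half d : (\int[leb1]_(y in `[0%R, +oo[) (pk e (1 * y + d))%:E =
    (2^-1 - atk e d)%:E)%E.
  have dF y : is_derive y (1 : R) (fun y => atk e (1 * y + d)) (pk e (1 * y + d)).
    by have := @is_derive_atk e 1 d y e0; rewrite mul1r.
  rewrite (FTC_half (fun y _ => pk_ge0 _ e0) (cp 1 d) dF (cvg_atk d e0)).
  by rewrite mulr0 add0r.
rewrite integral_half.
- rewrite (_ : (\int[leb1]_(y in _) (pk e (x - - y))%:E)%E =
    (\int[leb1]_(y in `[0%R, +oo[) (pk e (1 * y + x))%:E)%E); last first.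
    by apply: eq_integral => y _; rewrite opprK mul1r addrC.
  rewrite (_ : (\int[leb1]_(y in _) _)%E =
    (\int[leb1]_(y in `[0%R, +oo[) (pk e (1 * y - x))%:E)%E); last first.
    by apply: eq_integral => y _; rewrite mul1r -pkN opprB.
  by rewrite !half atkN -EFinD; congr EFin; lra.
- by move=> y; exact: pk_ge0.
- rewrite (_ : (fun _ => _) = fun y => pk e (-1 * y + x)); first exact: cp.
  by apply/funext => z; rewrite mulN1r addrC.
Qed.

Lemma integral_pk_itv e x a b : 0 < e -> a < b ->
  (\int[leb1]_(y in `]a, b]) (pk e (x - y))%:E = (atk e (x - a) - atk e (x - b))%:E)%E.
Proof.
move=> e0 ab.
have cp : continuous (fun y => pk e (x - y)).
  move=> z; apply: (@continuous_comp _ _ _ (fun y : R => x - y) (pk e)).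
    by apply: cvgB; [exact: cvg_cst|exact: cvg_id].
  exact: continuous_pk.
have dF y : is_derive y (1 : R) (fun y => - atk e (x - y)) (pk e (x - y)).
  have := @is_derive_atk e (-1) x y e0.
  rewrite (_ : (fun y => atk e (-1 * y + x)) = (fun y => atk e (x - y))); last first.
    by apply/funext => z; rewrite mulN1r addrC.
  by move=> h; apply: is_derive_eq; rewrite mulN1r opprK mulN1r addrC.
have cF := is_derive1_cts dF.
rewrite integral_itv_obnd_cbnd; last first.
  by apply/measurable_EFinP/measurable_funTS; exact: continuous_measurable_fun.
rewrite (@continuous_FTC2 _ (fun y => pk e (x - y)) (fun y => - atk e (x - y)))//.
- by rewrite -EFinB opprK addrC.
- exact: continuous_subspaceT.
- split => [y _||].
  + by have [] := dF y.
  + by apply: cvg_at_right_filter; exact: cF.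
  + by apply: cvg_at_left_filter; exact: cF.
- by move=> y _; rewrite derive1E; exact: derive_val.
Qed.

End poisson_kernel.

(** * The Fourier integral of integrable functions *)

Section fourier_integral.
Local Notation "x ^*" := (conjc x) : ring_scope.
Context {R : realType} {n : nat}.
Local Notation Rn := 'rV[R]_n.
Local Notation C := R[i].
Local Notation mu := (@leb R n).
Implicit Types (u w f g : Rn -> C) (x y xi : Rn) (e : R).

Lemma L1P u : L1 u <-> cinteg mu u.
Proof. by rewrite cintegP. Qed.

Lemma dotpC x y : dotp x y = dotp y x.
Proof. by apply: eq_bigr => i _; rewrite mulrC. Qed.

Lemma dotpBl x y xi : dotp (x - y) xi = dotp x xi - dotp y xi.
Proof. by rewrite /dotp -sumrB; apply: eq_bigr => i _; rewrite !mxE mulrBl. Qed.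

Lemma measurable_dotp : measurable_fun setT (fun z : Rn * Rn => dotp z.1 z.2).
Proof.
apply: measurable_sum => i; apply: measurable_funM.
  exact: (measurableT_comp (measurable_rV_coord i) measurable_fst).
exact: (measurableT_comp (measurable_rV_coord i) measurable_snd).
Qed.

Lemma cmeas_cis d (T : measurableType d) (h : T -> R) : measurable_fun setT h ->
  cmeas (fun t => cis (h t)).
Proof.
move=> mh; split.
  apply: (measurableT_comp _ mh); apply: continuous_measurable_fun; exact: continuous_cos.
apply: (measurableT_comp _ mh); apply: continuous_measurable_fun; exact: continuous_sin.
Qed.

Lemma fourier_intE u xi :
  fourier_int u xi = cI mu (fun x => cis (- 2 * pi * dotp xi x) * u x).
Proof. by []. Qed.

Lemma cmeas_char_mul u : cmeas u ->
  cmeas (fun z : Rn * Rn => cis (- 2 * pi * dotp z.1 z.2) * u z.2).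
Proof.
move=> mu_; apply: cmeasM.
  apply: cmeas_cis; apply: measurable_funM; first exact: measurable_cst.
  exact: measurable_dotp.
exact: (cmeas_comp measurable_snd mu_).
Qed.

Lemma cmeas_fourier_int u : cmeas u -> cmeas (fourier_int u).
Proof.
move=> mu_; exact: (cmeas_cI_prod mu (cmeas_char_mul mu_)).
Qed.

Lemma cinteg_char (h : R) (k : Rn) u : cinteg mu u ->
  cinteg mu (fun x => cis (h * dotp k x) * u x).
Proof.
move=> iu; apply: (cinteg_le _ (cinteg_normc iu)).
  apply: cmeasM; last exact: cinteg_meas iu.
  apply: cmeas_cis; apply: measurable_funM; first exact: measurable_cst.
  apply: measurable_sum => i; apply: measurable_funM; first exact: measurable_cst.
  exact: measurable_rV_coord.
by move=> x; rewrite Normc.normcM normc_cis mul1r.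
Qed.

Lemma normc_fourier_int u xi : cinteg mu u ->
  normc (fourier_int u xi) <= \int[mu]_x normc (u x).
Proof.
move=> iu; apply: (le_trans (normc_cI (cinteg_char (- 2 * pi) xi iu))).
rewrite le_eqVlt; apply/orP; left; apply/eqP; apply: eq_Rintegral => x _.
by rewrite Normc.normcM normc_cis mul1r.
Qed.

Lemma fourier_intD u w : cinteg mu u -> cinteg mu w ->
  fourier_int (fun x => u x + w x) = fun xi => fourier_int u xi + fourier_int w xi.
Proof.
move=> iu iw; apply/funext => xi; rewrite !fourier_intE -cID; [|exact: cinteg_char..].
by congr cI; apply/funext => x; rewrite mulrDr.
Qed.

Lemma fourier_intZ (c : C) u : cinteg mu u ->
  fourier_int (fun x => c * u x) = fun xi => c * fourier_int u xi.
Proof.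
move=> iu; apply/funext => xi; rewrite !fourier_intE -cIZ; last exact: cinteg_char.
by congr cI; apply/funext => x; rewrite mulrCA.
Qed.

Lemma fourier_intB u w : cinteg mu u -> cinteg mu w ->
  fourier_int (fun x => u x - w x) = fun xi => fourier_int u xi - fourier_int w xi.
Proof.
move=> iu iw; apply/funext => xi; rewrite !fourier_intE -cIB; [|exact: cinteg_char..].
by congr cI; apply/funext => x; rewrite mulrBr.
Qed.

Lemma fourier_int_conj u xi : cinteg mu u ->
  (fourier_int u xi)^* = cI mu (fun x => cis (2 * pi * dotp xi x) * (u x)^*).
Proof.
move=> iu; rewrite fourier_intE -cI_conj; last exact: cinteg_char.
congr cI; apply/funext => x; rewrite conjcM cis_conj.
by congr (cis _ * _); rewrite !mulNr opprK.
Qed.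

Lemma fourier_int_duality u w : cinteg mu u -> cinteg mu w ->
  cI mu (fun xi => fourier_int u xi * w xi) = cI mu (fun x => u x * fourier_int w x).
Proof.
move=> iu iw.
pose f (z : Rn * Rn) := w z.1 * (cis (- 2 * pi * dotp z.1 z.2) * u z.2).
have mf : cmeas f.
  apply: cmeasM; last exact: cmeas_char_mul (cinteg_meas iu).
  exact: (cmeas_comp measurable_fst (cinteg_meas iw)).
have := @cI_Fubini _ _ _ _ R mu mu _ _ (cinteg_normc iw) (cinteg_normc iu) f mf.
move=> /(_ _)/wrap[x y|].
  by rewrite /f/= !Normc.normcM normc_cis mul1r.
move=> h; rewrite /f/= in h; transitivity (cI mu (fun x => cI mu (fun y => w x *
    (cis (- 2 * pi * dotp x y) * u y)))).
  congr cI; apply/funext => x; rewrite cIZ; last exact: cinteg_char.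
  by rewrite mulrC fourier_intE.
rewrite h; congr cI; apply/funext => y.
rewrite fourier_intE -cIZ; last exact: cinteg_char.
congr cI; apply/funext => x; rewrite (dotpC y x); ring.
Qed.

Definition gkn e xi : R := \prod_i gk e (xi 0 i).
Definition pkn e x : R := \prod_i pk e (x 0 i).

Lemma prodC (I : Type) (r : seq I) (P : pred I) (F : I -> R) :
  (\prod_(i <- r | P i) F i)%:C = \prod_(i <- r | P i) (F i)%:C :> C.
Proof. exact: rmorph_prod. Qed.

Lemma gkn_ge0 e xi : 0 <= gkn e xi.
Proof. by apply: prodr_ge0 => i _; exact: gk_ge0. Qed.

Lemma pkn_ge0 e x : 0 < e -> 0 <= pkn e x.
Proof. by move=> e0; apply: prodr_ge0 => i _; exact: pk_ge0. Qed.

Lemma pkn_subC e x y : pkn e (x - y) = pkn e (y - x).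
Proof. by apply: eq_bigr => i _; rewrite !mxE -pkN opprB. Qed.

Lemma kernel_transform e y : 0 < e ->
  cinteg mu (fun xi => (gkn e xi)%:C * cis (2 * pi * dotp y xi)) /\
  cI mu (fun xi => (gkn e xi)%:C * cis (2 * pi * dotp y xi)) = (pkn e y)%:C.
Proof.
move=> e0.
have [h1 h2] := leb_tensor (fun i : 'I_n => (cI_gk_cis (y 0 i) e0).1).
have E : (fun x : Rn => \prod_i ((gk e (x 0 i))%:C * cis (2 * pi * y 0 i * x 0 i))) =
    (fun xi => (gkn e xi)%:C * cis (2 * pi * dotp y xi)).
  apply/funext => x; rewrite big_split/= -prodC -cis_sum; congr (_ * cis _).
  by rewrite /dotp mulr_sumr; apply: eq_bigr => i _; rewrite mulrA.
rewrite E in h1 h2; split => //; rewrite h2 prodC; apply: eq_bigr => i _.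
by rewrite (cI_gk_cis (y 0 i) e0).2.
Qed.

Lemma measurable_prod_coord (F : 'I_n -> R -> R) : (forall i, measurable_fun setT (F i)) ->
  measurable_fun setT (fun x : Rn => \prod_i F i (x 0 i)).
Proof.
move=> mF; have [h _] := @cmeas_prod_coord R n (fun i t => (F i t)%:C) (fun i => cmeas_real (mF i)).
by move: h; under eq_fun do rewrite -prodC.
Qed.

Lemma measurable_gkn e : measurable_fun setT (gkn e).
Proof.
apply: (measurable_prod_coord (F := fun=> gk e)) => i; apply: continuous_measurable_fun.
exact: continuous_gk.
Qed.

Lemma measurable_pkn e : 0 < e -> measurable_fun setT (pkn e).
Proof.
move=> e0; apply: (measurable_prod_coord (F := fun=> pk e)) => i.
by apply: continuous_measurable_fun; exact: continuous_pk.
Qed.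

Lemma measurable_pkn_sub e : 0 < e ->
  measurable_fun setT (fun z : Rn * Rn => pkn e (z.1 - z.2)).
Proof.
move=> e0; apply: (measurableT_comp (measurable_pkn e0)).
apply/measurable_fun_rVP => i.
rewrite (_ : (fun _ => _) = fun z : Rn * Rn => z.1 0 i - z.2 0 i); last first.
  by apply/funext => z; rewrite !mxE.
apply: measurable_funB.
  exact: (measurableT_comp (measurable_rV_coord i) measurable_fst).
exact: (measurableT_comp (measurable_rV_coord i) measurable_snd).
Qed.

Lemma integrable_gkn e : 0 < e -> mu.-integrable setT (EFin \o gkn e).
Proof.
move=> e0; have [h _] := kernel_transform 0 e0; have := cinteg_normc h.
apply: eq_integrable => // x _; rewrite /comp.
by rewrite Normc.normcM normc_cis mulr1 normc_real ger0_norm// gkn_ge0.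
Qed.

Lemma cinteg_pk e (t : R) : 0 < e ->
  cinteg (@lebesgue_measure R) (fun s => (pk e (t - s))%:C) /\
  cI (@lebesgue_measure R) (fun s => (pk e (t - s))%:C) = 1.
Proof.
move=> e0; have cp : continuous (fun y : R => pk e (t - y)).
  move=> z; apply: (@continuous_comp _ _ _ (fun y : R => t - y) (pk e)).
    by apply: cvgB; [exact: cvg_cst|exact: cvg_id].
  exact: continuous_pk.
split; last by rewrite cI_real /Rintegral integral_pk.
apply/cintegP; split.
  by apply: cmeas_real; exact: continuous_measurable_fun.
under eq_integral do rewrite normc_real ger0_norm ?pk_ge0//.
by rewrite integral_pk// ltry.
Qed.

Lemma integral_pkn e x : 0 < e ->
  mu.-integrable setT (EFin \o (fun y => pkn e (x - y))) /\
  (\int[mu]_y (pkn e (x - y))%:E = 1)%E.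
Proof.
move=> e0.
have [h1 h2] := leb_tensor (fun i : 'I_n => (cinteg_pk (x 0 i) e0).1).
have E : (fun y : Rn => \prod_i ((pk e (x 0 i - y 0 i))%:C : C)) = fun y => (pkn e (x - y))%:C.
  by apply/funext => y; rewrite prodC; apply: eq_bigr => i _; rewrite !mxE.
rewrite E in h1 h2.
have i1 : mu.-integrable setT (EFin \o (fun y => pkn e (x - y))) by case: h1.
split => //; rewrite cI_real big1 in h2; last by move=> i _; rewrite (cinteg_pk (x 0 i) e0).2.
have [h] := h2; rewrite -[LHS]fineK; last exact: (integrable_fin_num measurableT i1).
by rewrite -/(Rintegral _ _ _) h.
Qed.

Definition kconv e u x : C := cI mu (fun y => (pkn e (x - y))%:C * u y).

Lemma cmeas_kernel_mul e u : 0 < e -> cmeas u ->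
  cmeas (fun z : Rn * Rn => (pkn e (z.1 - z.2))%:C * u z.2).
Proof.
move=> e0 mu_; apply: cmeasM.
  by apply: cmeas_real; exact: measurable_pkn_sub.
exact: (cmeas_comp measurable_snd mu_).
Qed.

Lemma cmeas_kconv e u : 0 < e -> cmeas u -> cmeas (kconv e u).
Proof. by move=> e0 mu_; exact: (cmeas_cI_prod mu (cmeas_kernel_mul e0 mu_)). Qed.

(** Inversion formula with a convergence factor: [gkn e] makes the double integral absolutely
    convergent, and after exchange the inner integral is the Poisson kernel at [x - y]. *)
Lemma kconv_transform e u x : 0 < e -> cinteg mu u ->
  cI mu (fun xi => (gkn e xi)%:C * fourier_int u xi * cis (2 * pi * dotp xi x)) = kconv e u x.
Proof.
move=> e0 iu.
pose f (z : Rn * Rn) := (gkn e z.1)%:C * cis (2 * pi * dotp x z.1) *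
   (cis (- 2 * pi * dotp z.1 z.2) * u z.2).
have mf : cmeas f.
  apply: cmeasM; last exact: cmeas_char_mul (cinteg_meas iu).
  exact: (cmeas_comp measurable_fst (cinteg_meas (kernel_transform x e0).1)).
have := @cI_Fubini _ _ _ _ R mu mu _ _ (integrable_gkn e0) (cinteg_normc iu) f mf.
move=> /(_ _)/wrap[z y|].
  by rewrite /f/= !Normc.normcM !normc_cis mul1r mulr1 normc_real ger0_norm// gkn_ge0.
move=> h; rewrite /f/= in h; transitivity (cI mu (fun xi => cI mu (fun y =>
    (gkn e xi)%:C * cis (2 * pi * dotp x xi) * (cis (- 2 * pi * dotp xi y) * u y)))).
  congr cI; apply/funext => xi; rewrite cIZ; last exact: cinteg_char.
  by rewrite (dotpC xi x) mulrAC fourier_intE.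
rewrite h; congr cI; apply/funext => y.
rewrite -(kernel_transform (x - y) e0).2 [RHS]mulrC -cIZ; last exact: (kernel_transform (x - y) e0).1.
congr cI; apply/funext => xi; rewrite dotpBl mulrBr cisD (dotpC y xi).
rewrite (_ : - (2 * pi * dotp xi y) = - 2 * pi * dotp xi y); last by rewrite !mulNr.
ring.
Qed.

(** [fourier_int u] is bounded by the L^1 norm [M] of [u], so the integrand is dominated by the
    tensor product of [M * gkn e] and [|w|], and the previous formula can be integrated against
    [w]. *)
Lemma parseval_kernel e u w : 0 < e -> cinteg mu u -> cinteg mu w ->
  cI mu (fun xi => (gkn e xi)%:C * fourier_int u xi * (fourier_int w xi)^*) =
  cI mu (fun x => kconv e u x * (w x)^*).
Proof.
move=> e0 iu iw; set M := \int[mu]_x normc (u x).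
have iw' := cinteg_conj iw.
pose f (z : Rn * Rn) := (gkn e z.1)%:C * fourier_int u z.1 *
   (cis (2 * pi * dotp z.1 z.2) * (w z.2)^*).
have mf : cmeas f.
  apply: cmeasM.
    apply: (cmeas_comp measurable_fst (h := fun xi => (gkn e xi)%:C * fourier_int u xi)).
    apply: cmeasM; first by apply: cmeas_real; exact: measurable_gkn.
    exact: cmeas_fourier_int (cinteg_meas iu).
  apply: cmeasM.
    apply: cmeas_cis; apply: measurable_funM; first exact: measurable_cst.
    exact: measurable_dotp.
  exact: (cmeas_comp measurable_snd (cinteg_meas iw')).
have ig : mu.-integrable setT (EFin \o (fun xi => M * gkn e xi)).
  exact: integrableZ_EFin (integrable_gkn e0).
have := @cI_Fubini _ _ _ _ R mu mu _ _ ig (cinteg_normc iw') f mf.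
move=> /(_ _)/wrap[xi y|].
  rewrite /f/= !Normc.normcM !normc_cis mul1r normc_real (ger0_norm (gkn_ge0 _ _)).
  rewrite ler_wpM2r ?normc_ge0// mulrC ler_wpM2r ?gkn_ge0//.
  exact: normc_fourier_int.
move=> h; rewrite /f/= in h; transitivity (cI mu (fun xi => cI mu (fun y =>
    (gkn e xi)%:C * fourier_int u xi * (cis (2 * pi * dotp xi y) * (w y)^*)))).
  congr cI; apply/funext => xi; rewrite cIZ; last exact: cinteg_char.
  by rewrite fourier_int_conj.
rewrite h; congr cI; apply/funext => y.
rewrite -(kconv_transform y e0 iu) [RHS]mulrC -cIZ; last first.
  apply: (cinteg_le _ ig).
    apply: cmeasM.
      apply: cmeasM; first by apply: cmeas_real; exact: measurable_gkn.
      exact: cmeas_fourier_int (cinteg_meas iu).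
    apply: cmeas_cis; apply: measurable_funM; first exact: measurable_cst.
    apply: measurable_sum => i; apply: measurable_funM; last exact: measurable_cst.
    exact: measurable_rV_coord.
  move=> xi; rewrite !Normc.normcM normc_cis mulr1 normc_real (ger0_norm (gkn_ge0 _ _)).
  by rewrite mulrC; apply: ler_wpM2r; [exact: gkn_ge0|exact: normc_fourier_int].
by congr cI; apply/funext => xi; ring.
Qed.

End fourier_integral.

Arguments fourier_int : simpl never.
Arguments cI : simpl never.
Arguments kconv : simpl never.

(** * The L^2 bound, and Parseval's identity against indicators of boxes *)

Section plancherel.
Context {R : realType} {n : nat}.
Local Notation "x ^*" := (conjc x) : ring_scope.
Local Notation Rn := 'rV[R]_n.
Local Notation C := R[i].
Local Notation mu := (@leb R n).
Implicit Types (u w f g : Rn -> C) (x y xi : Rn) (e : R).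

Lemma ccvgM (z z' : nat -> C) (a a' : C) : ccvg z a -> ccvg z' a' ->
  ccvg (fun k => z k * z' k) (a * a').
Proof.
move=> [z1 z2] [z1' z2']; split.
  by under eq_fun do rewrite cReM; rewrite cReM; apply: cvgB; exact: cvgM.
by under eq_fun do rewrite cImM; rewrite cImM; apply: cvgD; exact: cvgM.
Qed.

Lemma ccvg_cst (a : C) : ccvg (fun=> a) a.
Proof. by split; exact: cvg_cst. Qed.

Lemma ccvg_real (h : nat -> R) (l : R) : h k @[k --> \oo] --> l ->
  ccvg (fun k => (h k)%:C) l%:C.
Proof. by move=> hl; split => //; exact: cvg_cst. Qed.

Lemma ccvg_scale1 (h : nat -> R) (z : C) : h k @[k --> \oo] --> (1 : R) ->
  ccvg (fun k => (h k)%:C * z) z.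
Proof.
by move=> h1; rewrite -[X in ccvg _ X]mul1r; apply: ccvgM; [exact: ccvg_real|exact: ccvg_cst].
Qed.

(** Schur's test. The kernel is nonnegative and of mass [1] in each variable; bounding
    [|u(x)| |u(y)|] by half the sum of the squares leaves two double integrals, each equal to
    [nrm2 u] by Tonelli's theorem. *)
Lemma kconv_pairing_le e u : 0 < e -> cinteg mu u -> L2 u ->
  normc (cI mu (fun x => kconv e u x * (u x)^*)) <= nrm2 u.
Proof.
move=> e0 iu Lu; have mu_ := cinteg_meas iu.
have mk := cmeas_kconv e0 mu_.
have mku : cmeas (fun x => kconv e u x * (u x)^*) by apply: cmeasM => //; exact: cmeas_conj.
pose h (z : Rn * Rn) : R := pkn e (z.1 - z.2) * (normc (u z.1) ^+ 2).
pose h' (z : Rn * Rn) : R := pkn e (z.1 - z.2) * (normc (u z.2) ^+ 2).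
have mu2 := cmeas_sqr mu_.
have h0 z : 0 <= h z by rewrite mulr_ge0 ?sqr_ge0 ?pkn_ge0.
have h0' z : 0 <= h' z by rewrite mulr_ge0 ?sqr_ge0 ?pkn_ge0.
have mh : measurable_fun setT (EFin \o h).
  apply/measurable_EFinP; apply: measurable_funM; first exact: measurable_pkn_sub.
  exact: (measurableT_comp mu2 measurable_fst).
have mh' : measurable_fun setT (EFin \o h').
  apply/measurable_EFinP; apply: measurable_funM; first exact: measurable_pkn_sub.
  exact: (measurableT_comp mu2 measurable_snd).
have LE := L2sqE Lu.
have mp x : measurable_fun setT (fun y => (pkn e (x - y))%:E).
  by have /integrableP[] := (integral_pkn x e0).1.
have int1 : (\int[mu]_x \int[mu]_y (h (x, y))%:E = (nrm2 u)%:E)%E.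
  rewrite -LE; apply: eq_integral => x _.
  under eq_integral do rewrite /h/= mulrC EFinM.
  rewrite ge0_integralZl_EFin ?sqr_ge0//.
    by rewrite (integral_pkn x e0).2 mule1.
  by move=> y _; rewrite lee_fin pkn_ge0.
have int2 : (\int[mu]_x \int[mu]_y (h' (x, y))%:E = (nrm2 u)%:E)%E.
  have := fubini_tonelli (m1 := mu) (m2 := mu) (EFin \o h') mh' (fun z => h0' z).
  rewrite /= => ->; rewrite -LE; apply: eq_integral => y _.
  under eq_integral do rewrite /h'/= mulrC EFinM pkn_subC.
  rewrite ge0_integralZl_EFin ?sqr_ge0//.
    by rewrite (integral_pkn y e0).2 mule1.
  by move=> x _; rewrite lee_fin pkn_ge0.
have ik x : cinteg mu (fun y => (pkn e (x - y))%:C * u y).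
  (* Each factor [pk e] is largest at [0], where it equals [2 / e]; a bounded kernel times an
     integrable function is integrable. *)
  have [B [B0 pB]] : exists B : R, 0 <= B /\ forall z : Rn, pkn e z <= B.
    exists (\prod_(i < n) (2 / e)); split.
      by apply: prodr_ge0 => i _; rewrite divr_ge0// ltW.
    move=> z; apply: ler_prod => i _; rewrite pk_ge0//=.
    have e2 : 0 < e ^+ 2 by rewrite exprn_gt0.
    rewrite /pk ler_pdivrMr; last by rewrite ltr_wpDr ?sqr_ge0.
    rewrite mulrDr (_ : 2 / e * e ^+ 2 = 2 * e); last by field; rewrite gt_eqF.
    by rewrite lerDl mulr_ge0 ?sqr_ge0// divr_ge0// ltW.
  apply: (cinteg_le _ (integrableZ_EFin B (cinteg_normc iu))).
    by apply: cmeasM => //; apply: cmeas_real; apply/measurable_EFinP; exact: mp.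
  move=> y; rewrite Normc.normcM normc_real ger0_norm ?pkn_ge0//.
  by rewrite ler_wpM2r ?normc_ge0.
have key x : ((normc (kconv e u x * (u x)^*))%:E <=
    2^-1%:E * (\int[mu]_y (h (x, y))%:E + \int[mu]_y (h' (x, y))%:E))%E.
  have ih := ik x.
  have mhx : measurable_fun setT (fun y => (h (x, y))%:E) by exact: (measurableT_comp mh).
  have mhx' : measurable_fun setT (fun y => (h' (x, y))%:E) by exact: (measurableT_comp mh').
  rewrite -ge0_integralD//; last 2 first.
  - by move=> y _; rewrite lee_fin h0.
  - by move=> y _; rewrite lee_fin h0'.
  rewrite -ge0_integralZl_EFin//; last 2 first.
  - by move=> y _; rewrite -EFinD lee_fin addr_ge0.
  - exact: emeasurable_funD.
  have iM := integrableZ_EFin (normc (u x)) (cinteg_normc ih).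
  apply: (@le_trans _ _ (\int[mu]_y (normc (u x) * normc ((pkn e (x - y))%:C * u y))%:E)%E).
    have := integrable_fin_num measurableT iM => fi.
    rewrite -[leRHS]fineK// lee_fin -/(Rintegral _ _ _) RintegralZl//; last exact: cinteg_normc.
    rewrite Normc.normcM normc_conj mulrC ler_wpM2l ?normc_ge0//.
    exact: normc_cI.
  apply: ge0_le_integral => //.
  - by move=> y _; rewrite lee_fin mulr_ge0 ?normc_ge0.
  - by have /integrableP[] := iM.
  - by apply: measurable_funeM; exact: emeasurable_funD.
  - move=> y _; rewrite -EFinD -EFinM lee_fin /h /h'/= Normc.normcM normc_real.
    rewrite ger0_norm ?pkn_ge0// -mulrDr mulrCA [leRHS]mulrCA.
    rewrite ler_wpM2l ?pkn_ge0//; have := sqr_ge0 (normc (u x) - normc (u y)).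
    by rewrite sqrrB; lra.
have fin : (\int[mu]_x (normc (kconv e u x * (u x)^*))%:E <= (nrm2 u)%:E)%E.
  apply: (@le_trans _ _ (\int[mu]_x (2^-1%:E * (\int[mu]_y (h (x, y))%:E +
      \int[mu]_y (h' (x, y))%:E)))%E).
    apply: ge0_le_integral => //.
    - by move=> x _; rewrite lee_fin normc_ge0.
    - by apply/measurable_EFinP; exact: cmeas_normc.
    - apply: measurable_funeM; apply: emeasurable_funD.
        exact: (measurable_fun_fubini_tonelli_F (EFin \o h) mh (fun z => h0 z)).
      exact: (measurable_fun_fubini_tonelli_F (EFin \o h') mh' (fun z => h0' z)).
  have i0 x : setT x -> (0 <= \int[mu]_y (h (x, y))%:E)%E.
    by move=> _; apply: integral_ge0 => y _; rewrite lee_fin h0.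
  have i0' x : setT x -> (0 <= \int[mu]_y (h' (x, y))%:E)%E.
    by move=> _; apply: integral_ge0 => y _; rewrite lee_fin h0'.
  have m1 := measurable_fun_fubini_tonelli_F (m2 := mu) (EFin \o h) mh (fun z => h0 z).
  have m2 := measurable_fun_fubini_tonelli_F (m2 := mu) (EFin \o h') mh' (fun z => h0' z).
  rewrite ge0_integralZl_EFin//; last 2 first.
  - by move=> x _; apply: adde_ge0; [exact: i0|exact: i0'].
  - exact: emeasurable_funD.
  by rewrite ge0_integralD// int1 int2 -EFinD -EFinM lee_fin; lra.
have ci : cinteg mu (fun x => kconv e u x * (u x)^*).
  by apply/cintegP; split => //; rewrite (le_lt_trans fin)// ltry.
rewrite (le_trans (normc_cI ci))// -lee_fin.
by rewrite /Rintegral fineK//; exact: (integrable_fin_num measurableT (cinteg_normc ci)).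
Qed.

(** Shares the weight of [parseval_kernel] between its two factors, so that for [w = u] its
    left-hand side becomes a squared norm. *)
Lemma gk_half (e t : R) : gk e t = gk (e / 2) t ^+ 2.
Proof. by rewrite /gk expr2 -expRD; congr expR; lra. Qed.

Lemma gkn_half e xi : gkn e xi = gkn (e / 2) xi ^+ 2.
Proof. by rewrite /gkn -prodrXl; apply: eq_bigr => i _; exact: gk_half. Qed.

Lemma gkn_le1 e xi : 0 < e -> gkn e xi <= 1.
Proof.
move=> e0; apply: prodr_ile1 => i _; rewrite gk_ge0/= /gk -expR0 ler_expR.
by rewrite oppr_le0 mulr_ge0// ltW.
Qed.

Lemma cvg_gkn (a : nat -> R) xi : a k @[k --> \oo] --> (0 : R) ->
  gkn (a k) xi @[k --> \oo] --> (1 : R).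
Proof.
move=> a0; rewrite (_ : (1 : R) = \prod_(i < n) 1); last by rewrite big1.
apply: cvg_big => //; first by move=> x; exact: mul_continuous.
move=> i _; rewrite -expR0; apply: continuous_cvg; first exact: continuous_expR.
have := cvgN (cvgM a0 (cvg_cst `|xi 0 i|)).
by rewrite mul0r oppr0; apply.
Qed.

(** By [parseval_kernel] with [w = u], the function [gkn (e/2)] times the transform has squared norm
    at most [nrm2 u]; Fatou's lemma lets [e] tend to [0]. Only the inequality is needed to extend
    the transformation to L^2; equality follows later from inversion. *)
Lemma fourier_int_L2 u : cinteg mu u -> L2 u ->
  L2 (fourier_int u) /\ nrm2 (fourier_int u) <= nrm2 u.
Proof.
move=> iu Lu; have mF := cmeas_fourier_int (cinteg_meas iu).
suff le : (L2sq setT (fourier_int u) <= (nrm2 u)%:E)%E.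
  have LF : L2 (fourier_int u) by split => //; rewrite (le_lt_trans le)// ltry.
  by split => //; rewrite -lee_fin -L2sqE.
pose a k : R := harmonic k.
have a0 k : 0 < a k by exact: harmonic_gt0.
apply: (@L2sq_fatou _ _ (fun k xi => (gkn (a k / 2) xi)%:C * fourier_int u xi)) => //.
- by move=> k; apply: cmeasM => //; apply: cmeas_real; exact: measurable_gkn.
- apply: aeW => xi.
  apply: ccvg_scale1; apply: cvg_gkn; rewrite -[X in _ --> X](mul0r 2^-1).
  by apply: cvgM; [exact: cvg_harmonic|exact: cvg_cst].
- move=> k; set M := \int[mu]_x normc (u x).
  have E xi : normc ((gkn (a k / 2) xi)%:C * fourier_int u xi) ^+ 2 =
      gkn (a k) xi * normc (fourier_int u xi) ^+ 2.
    by rewrite Normc.normcM normc_real ger0_norm ?gkn_ge0// exprMn -gkn_half.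
  have ii : mu.-integrable setT (EFin \o (fun xi => gkn (a k) xi * normc (fourier_int u xi) ^+ 2)).
    have nF xi : normc (fourier_int u xi) <= M := normc_fourier_int xi iu.
    move: (fourier_int u) mF nF {E} => F mF nF.
    apply: (le_integrable measurableT _ _ (integrableZ_EFin (M ^+ 2) (integrable_gkn (a0 k)))).
      apply/measurable_EFinP; apply: measurable_funM; first exact: measurable_gkn.
      exact: cmeas_sqr.
    move=> xi _ /=; rewrite lee_fin !normrM (ger0_norm (gkn_ge0 _ _)) mulrC.
    have M0 : 0 <= M by exact: (le_trans (normc_ge0 _) (nF 0)).
    rewrite ler_wpM2r ?gkn_ge0// !ger0_norm ?mulr_ge0 ?normc_ge0//.
    by apply: ler_pM; rewrite ?normc_ge0.
  rewrite /L2sq; under eq_integral do rewrite E.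
  rewrite -[leLHS]fineK; last exact: (integrable_fin_num measurableT ii).
  rewrite lee_fin -/(Rintegral _ _ _).
  have := kconv_pairing_le (a0 k) iu Lu; rewrite -(parseval_kernel (a0 k) iu iu).
  rewrite (_ : (fun xi => _) = fun xi => (gkn (a k) xi * normc (fourier_int u xi) ^+ 2)%:C).
    by rewrite cI_real normc_real; apply: le_trans; exact: ler_norm.
  by apply/funext => xi; rewrite -mulrA mulcC_normc -rmorphM.
Qed.

Definition box1 (a b : Rn) x : C := (\1_(rV_box a b) x)%:C.

Lemma box1_prod a b x : box1 a b x = \prod_i (((a 0 i < x 0 i <= b 0 i)%R%:R : R)%:C).
Proof.
rewrite /box1 indicE; have [|xn] := boolP (x \in rV_box a b).
  by rewrite inE => xab; rewrite big1// => i _; rewrite xab.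
have [i /negbTE xi] : exists i, ~~ (a 0 i < x 0 i <= b 0 i).
  apply: contrapT => h; move: xn; rewrite notin_setE; apply => i.
  by apply: contrapT => /negP xi; apply: h; exists i.
by rewrite (bigD1 i)//= xi mul0r.
Qed.

Lemma cinteg_box1 a b : cinteg mu (box1 a b).
Proof.
have [h _] := leb_tensor (fun i => (cinteg_indic_itv (a 0 i) (b 0 i)).1).
by move: h; congr cinteg; apply/funext => x; rewrite box1_prod.
Qed.

Lemma L2_box1 a b : L2 (box1 a b).
Proof.
have /cintegP[mb fb] := cinteg_box1 a b; split => //; apply: le_lt_trans fb.
apply: ge0_le_integral => //.
- by move=> x _; rewrite lee_fin sqr_ge0.
- by apply/measurable_EFinP; exact: cmeas_sqr.
- by apply/measurable_EFinP; exact: cmeas_normc.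
- move=> x _; rewrite lee_fin normc_real indicE.
  by case: (x \in _); rewrite ?normr1 ?normr0 ?expr1n ?expr0n.
Qed.

(** Inside a cube the indicator of the hyperplane is a tensor product, one factor of which is the
    indicator of the point [c] and has integral [0]. The cubes make the other factors integrable. *)
Lemma hyperplane_null (i : 'I_n) (c : R) : {ae mu, forall x, x 0 i != c}.
Proof.
have cube0 k : {ae mu, forall x, cube k x -> x 0 i != c}.
  pose F (j : 'I_n) (t : R) : C := if j == i then ((t == c)%:R : R)%:C else
    ((- k%:R < t <= k%:R)%R%:R : R)%:C.
  have ic : cinteg (@lebesgue_measure R) (fun t => ((t == c)%:R : R)%:C) /\
      cI (@lebesgue_measure R) (fun t => ((t == c)%:R : R)%:C) = 0.
    have E : (fun t => ((t == c)%:R : R)) = \1_[set c].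
      apply/funext => t; rewrite indicE; case: eqP => [->|tc]; first by rewrite mem_set.
      by rewrite memNset.
    have mm : measurable_fun [set: R] (fun t : R => ((t == c)%:R : R)).
      by rewrite E; exact: measurable_indic.
    have I0 : (\int[@lebesgue_measure R]_t (((t == c)%:R : R))%:E = 0)%E.
      transitivity (\int[@lebesgue_measure R]_t (\1_[set c] t)%:E)%E.
        by apply: eq_integral => t _; rewrite -E.
      by rewrite integral_indic// setIT; exact: lebesgue_measure_set1.
    split; last by rewrite cI_real /Rintegral I0.
    apply/cintegP; split; first exact: cmeas_real.
    by under eq_integral do rewrite normc_real ger0_norm//; rewrite I0 ltry.
  have iF j : cinteg (@lebesgue_measure R) (F j).
    by rewrite /F; case: eqP => _; [exact: ic.1|exact: (cinteg_indic_itv _ _).1].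
  have [h1 h2] := leb_tensor iF.
  have z0 : cI mu (fun x => \prod_j F j (x 0 j)) = 0.
    by rewrite h2 (bigD1 i)//= {1}/F eqxx ic.2 mul0r.
  pose G (j : 'I_n) (t : R) : R := if j == i then (t == c)%:R else (- k%:R < t <= k%:R)%R%:R.
  have FG x : \prod_j F j (x 0 j) = (\prod_j G j (x 0 j))%:C.
    by rewrite prodC; apply: eq_bigr => j _; rewrite /F /G; case: eqP.
  have G0 x : 0 <= \prod_j G j (x 0 j).
    by apply: prodr_ge0 => j _; rewrite /G; case: eqP.
  have mG : measurable_fun setT (fun x : Rn => (\prod_j G j (x 0 j))%:E).
    apply/measurable_EFinP; have [m _] := cinteg_meas h1.
    by move: m; under eq_fun do rewrite FG.
  have iG : (\int[mu]_x `|(\prod_j G j (x 0 j))%:E| = 0)%E.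
    have [] : (\int[mu]_x (\prod_j G j (x 0 j)))%:C = 0 :> C.
      by rewrite -cI_real -[RHS]z0; congr cI; apply/funext => x; rewrite FG.
    under eq_integral do rewrite gee0_abs ?lee_fin//.
    have ig : mu.-integrable setT (EFin \o (fun x : Rn => \prod_j G j (x 0 j))).
      by have [m _] := h1; apply: eq_integrable m => // x _ /=; rewrite FG.
    by rewrite /Rintegral => r0; rewrite -[LHS]fineK ?r0//; exact: (integrable_fin_num measurableT ig).
  have := (ae_eq_integral_abs mu measurableT mG).1 iG.
  apply: filterS => x /= /(_ Logic.I)[] G00 /cubeP xk; apply/eqP => xi.
  suff : \prod_j G j (x 0 j) = 1 by rewrite G00 => /esym/eqP; rewrite oner_eq0.
  by apply: big1 => j _; rewrite /G; case: eqP => [->|_]; rewrite ?xi ?eqxx ?xk.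
apply: filterS (ae_foralln cube0) => x h.
have : [set: Rn] x by []. rewrite -bigcup_cube => -[k _]; exact: h.
Qed.

Lemma kconv_box a b x e : 0 < e ->
  kconv e (box1 a b) x = \prod_i ((if a 0 i < b 0 i then
    atk e (x 0 i - a 0 i) - atk e (x 0 i - b 0 i) else 0)%:C).
Proof.
move=> e0.
pose F (i : 'I_n) (t : R) : C := (pk e (x 0 i - t))%:C * ((a 0 i < t <= b 0 i)%R%:R : R)%:C.
have IF i : cinteg (@lebesgue_measure R) (F i) /\ cI (@lebesgue_measure R) (F i) =
    (if a 0 i < b 0 i then atk e (x 0 i - a 0 i) - atk e (x 0 i - b 0 i) else 0)%:C.
  have E : F i = fun t => (((fun t => pk e (x 0 i - t)) \_ `]a 0 i, b 0 i]) t)%:C.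
    apply/funext => t; rewrite /F patchE mem_setE -rmorphM; congr (_%:C).
    by rewrite in_itv/=; case: ifP; rewrite ?mulr1 ?mulr0.
  have iF : cinteg (@lebesgue_measure R) (F i).
    apply: (cinteg_le _ (cinteg_normc (cinteg_pk (x 0 i) e0).1)).
      apply: cmeasM; first exact: cinteg_meas (cinteg_pk (x 0 i) e0).1.
      exact: cinteg_meas (cinteg_indic_itv _ _).1.
    move=> t; rewrite Normc.normcM ler_piMr ?normc_ge0// normc_real ger0_norm//.
    by case: (_ < _ <= _).
  split => //; rewrite E cI_real -Rintegral_mkcond; congr (_%:C); case: ltP => ab.
    by rewrite /Rintegral integral_pk_itv.
  by rewrite set_itv_ge ?Rintegral_set0// bnd_simp -leNgt.
have [_ h] := leb_tensor (fun i => (IF i).1).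
rewrite (eq_bigr (fun i => cI (@lebesgue_measure R) (F i))); last by move=> i _; rewrite (IF i).2.
rewrite -h; congr cI; apply/funext => y; rewrite box1_prod /F big_split/=; congr (_ * _).
by rewrite /pkn prodC; apply: eq_bigr => i _; rewrite !mxE.
Qed.

Lemma atk_bound e (t : R) : `|atk e t| <= 2^-1.
Proof.
rewrite /atk normrM [X in _ * X]ger0_norm ?invr_ge0 ?pi_ge0// ler_pdivrMr ?pi_gt0//.
rewrite ler_norml; apply/andP; split.
  by apply/ltW; rewrite (le_lt_trans _ (atan_gtNpi2 _))// mulrC.
by apply/ltW; rewrite (lt_le_trans (atan_ltpi2 _))// mulrC.
Qed.

Lemma cvg_atk0 (a : nat -> R) (t : R) : (forall k, 0 < a k) -> a k @[k --> \oo] --> (0 : R) ->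
  t != 0 -> atk (a k) t @[k --> \oo] --> (Num.sg t / 2 : R).
Proof.
move=> a0 ac t0.
wlog tp : t t0 / 0 < t.
  move=> h; have [tp|tn|tz] := ltgtP t 0; last by rewrite tz eqxx in t0.
    have := h (- t); rewrite oppr_eq0 oppr_gt0 => /(_ t0 tp) ht.
    rewrite (_ : (fun k => _) = fun k => - atk (a k) (- t)); last first.
      by apply/funext => k; rewrite atkN opprK.
    by rewrite -[X in _ --> X]opprK -mulNr -sgrN; apply: cvgN.
  exact: h.
rewrite gtr0_sg// mul1r (_ : 2^-1 = pi / 2 / pi); last first.
  by rewrite mulrAC divff ?mul1r// pi_neq0.
apply: cvgM; last exact: cvg_cst.
apply: (cvg_comp (fun k => 2 * pi / a k * t) atan); last exact: cvgy_atan.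
apply/cvgryPge => A.
have /cvg0P/(_ (2 * pi * t / (`|A| + 1))) := ac.
have A1 : 0 < `|A| + 1 by rewrite ltr_wpDl.
have P0 : 0 < 2 * pi * t by rewrite !mulr_gt0// pi_gt0.
rewrite divr_gt0// => /(_ isT)[K hK]; exists K => // k /= /hK.
rewrite ger0_norm ?(ltW (a0 k))// ltr_pdivlMr// mulrC -ltr_pdivlMr// => h.
rewrite mulrAC; apply: (le_trans (ler_norm A)); apply/ltW.
by apply: lt_trans h; rewrite ltrDl.
Qed.

(** Off the finitely many hyperplanes carrying the faces, each factor of [kconv_box] tends to half a
    difference of signs, which is the indicator of the side. *)
Lemma kconv_box_cvg (a : nat -> R) l r : (forall k, 0 < a k) -> a k @[k --> \oo] --> (0 : R) ->
  {ae mu, forall x, ccvg (fun k => kconv (a k) (box1 l r) x) (box1 l r x)}.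
Proof.
move=> a0 ac.
have : {ae mu, forall x, forall i, x 0 i != l 0 i /\ x 0 i != r 0 i}.
  have h (s : seq 'I_n) : {ae mu, forall x, forall i, i \in s -> x 0 i != l 0 i /\ x 0 i != r 0 i}.
    elim: s => [|j s ih]; first by apply: aeW.
    apply: filterS3 ih (hyperplane_null j (l 0 j)) (hyperplane_null j (r 0 j)) => x hx h1 h2 i.
    by rewrite inE => /orP[/eqP ->//|]; exact: hx.
  by apply: filterS (h (index_enum _)) => x hx i; apply: hx; exact: mem_index_enum.
apply: filterS => x hx.
have E k : kconv (a k) (box1 l r) x = (\prod_i (if l 0 i < r 0 i then
    atk (a k) (x 0 i - l 0 i) - atk (a k) (x 0 i - r 0 i) else 0))%:C.
  by rewrite kconv_box// prodC.
split; under eq_fun do rewrite E/=; rewrite box1_prod -prodC/=; last exact: cvg_cst.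
apply: cvg_big => //; first by move=> y; exact: mul_continuous.
move=> i _; have [x1 x2] := hx i; case: ltP => [lr|rl].
  have x1' : x 0 i - l 0 i != 0 by rewrite subr_eq0.
  have x2' : x 0 i - r 0 i != 0 by rewrite subr_eq0.
  have := cvgB (cvg_atk0 a0 ac x1') (cvg_atk0 a0 ac x2').
  rewrite (_ : Num.sg _ / 2 - _ = (l 0 i < x 0 i <= r 0 i)%R%:R); first exact.
  move: x1 x2; rewrite -(subr_eq0 (x 0 i) (l 0 i)) -(subr_eq0 (x 0 i) (r 0 i)).
  rewrite -(subr_gt0 (l 0 i)) -(subr_le0 (r 0 i)).
  have : x 0 i - r 0 i < x 0 i - l 0 i by lra.
  move: (x 0 i - l 0 i) (x 0 i - r 0 i) => s t ts s0 t0.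
  have [tp|tn|tz] := ltgtP t 0; last by rewrite tz eqxx in t0.
    rewrite andbT; have [sp|sn|sz] := ltgtP s 0; last by rewrite sz eqxx in s0.
      by rewrite !ltr0_sg// subrr.
    by rewrite (gtr0_sg sn) (ltr0_sg tp) /=; lra.
  by rewrite andbF (gtr0_sg (lt_trans tn ts)) (gtr0_sg tn) subrr.
rewrite (_ : _ && _ = false); first exact: cvg_cst.
by apply/negbTE/negP => /andP[h1 h2]; have := lt_le_trans h1 (le_trans h2 rl); rewrite ltxx.
Qed.

(** Let [e] tend to [0] in [parseval_kernel]. For a box the convolutions are explicit, bounded by
    [1] and convergent almost everywhere, so [|w|] dominates on the space side; the frequency side
    is dominated by the product of two L^2 functions. *)
Lemma parseval_box a b w : cinteg mu w -> L2 w ->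
  ip (fourier_int (box1 a b)) (fourier_int w) = ip (box1 a b) w.
Proof.
move=> iw Lw; have ib := cinteg_box1 a b; have Lb := L2_box1 a b.
have [LFb _] := fourier_int_L2 ib Lb; have [LFw _] := fourier_int_L2 iw Lw.
pose h k : R := harmonic k.
have h0 k : 0 < h k by exact: harmonic_gt0.
have hc : h k @[k --> \oo] --> (0 : R) by exact: cvg_harmonic.
have c1 : ccvg (fun k => cI mu (fun xi => (gkn (h k) xi)%:C * fourier_int (box1 a b) xi *
    (fourier_int w xi)^*)) (ip (fourier_int (box1 a b)) (fourier_int w)).
  have ig := cinteg_ip LFb LFw.
  apply: (cI_dominated (h := fun xi => normc (fourier_int (box1 a b) xi * (fourier_int w xi)^*))).
  - move=> k; under eq_fun do rewrite -mulrA; apply: cmeasM; last exact: cinteg_meas ig.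
    by apply: cmeas_real; exact: measurable_gkn.
  - exact: cinteg_meas ig.
  - exact: cinteg_normc.
  - apply: aeW => xi; under eq_fun do rewrite -mulrA.
    by apply: ccvg_scale1; exact: cvg_gkn.
  - move=> k; apply: aeW => xi; rewrite -mulrA Normc.normcM normc_real.
    by rewrite ger0_norm ?gkn_ge0// ler_piMl ?normc_ge0// gkn_le1.
have c2 : ccvg (fun k => cI mu (fun x => kconv (h k) (box1 a b) x * (w x)^*)) (ip (box1 a b) w).
  have iwc := cinteg_conj iw.
  apply: (cI_dominated (h := fun x => normc (w x))).
  - move=> k; apply: cmeasM; last exact: cinteg_meas iwc.
    by apply: cmeas_kconv => //; exact: cinteg_meas ib.
  - by apply: cmeasM; [exact: cinteg_meas ib|exact: cinteg_meas iwc].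
  - exact: cinteg_normc.
  - apply: filterS (kconv_box_cvg a b h0 hc) => x k1.
    by apply: ccvgM => //; exact: ccvg_cst.
  - move=> k; apply: aeW => x; rewrite Normc.normcM normc_conj ler_piMl ?normc_ge0//.
    rewrite kconv_box// -prodC normc_real normr_prod; apply: prodr_ile1 => i _.
    rewrite normr_ge0/=; case: ifP => _; last by rewrite normr0.
    have := ler_normB (atk (h k) (x 0 i - a 0 i)) (atk (h k) (x 0 i - b 0 i)).
    have := atk_bound (h k) (x 0 i - a 0 i); have := atk_bound (h k) (x 0 i - b 0 i).
    by lra.
have E k : cI mu (fun xi => (gkn (h k) xi)%:C * fourier_int (box1 a b) xi *
    (fourier_int w xi)^*) = cI mu (fun x => kconv (h k) (box1 a b) x * (w x)^*).
  exact: parseval_kernel.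
move: c1; rewrite /ccvg; under eq_fun do rewrite E; under [X in _ /\ (X @ _ --> _)]eq_fun do rewrite E.
move=> [r1 i1]; have [r2 i2] := c2.
by apply: complex_ext; [exact: (cvg_unique _ r1 r2)|exact: (cvg_unique _ i1 i2)].
Qed.

End plancherel.

(** * The Fourier transformation on L^2 *)

Section fourier_L2.
Context {R : realType} {n : nat}.
Local Notation "x ^*" := (conjc x) : ring_scope.
Local Notation Rn := 'rV[R]_n.
Local Notation C := R[i].
Local Notation mu := (@leb R n).
Implicit Types (u v w f g h : Rn -> C) (x y xi : Rn) (e : R).

Lemma L2_cvg_le (c : R) (f_ g_ : nat -> Rn -> C) f g :
  (forall k, L2 (f_ k)) -> L2 f -> (forall k, L2 (g_ k)) -> L2 g ->
  (forall k, nrm (fun x => g_ k x - g x) <= c * nrm (fun x => f_ k x - f x)) ->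
  L2_cvg setT f_ f -> L2_cvg setT g_ g.
Proof.
move=> Lf_ Lf Lg_ Lg H /(L2_cvg_nrmP Lf_ Lf) cf; apply/(L2_cvg_nrmP Lg_ Lg).
apply: (@squeeze0 _ _ (fun k => c * nrm (fun x => f_ k x - f x))) => [k|].
  by rewrite nrm_ge0 H.
by rewrite -(mulr0 c); apply: cvgM => //; exact: cvg_cst.
Qed.

Lemma L2_cvgD (f_ g_ : nat -> Rn -> C) f g :
  (forall k, L2 (f_ k)) -> L2 f -> (forall k, L2 (g_ k)) -> L2 g ->
  L2_cvg setT f_ f -> L2_cvg setT g_ g ->
  L2_cvg setT (fun k x => f_ k x + g_ k x) (fun x => f x + g x).
Proof.
move=> Lf_ Lf Lg_ Lg /(L2_cvg_nrmP Lf_ Lf) cf /(L2_cvg_nrmP Lg_ Lg) cg.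
apply/L2_cvg_nrmP => [k||]; [exact: L2D|exact: L2D|].
apply: (@squeeze0 _ _ (fun k => nrm (fun x => f_ k x - f x) + nrm (fun x => g_ k x - g x))) => [k|].
  rewrite nrm_ge0 -[X in nrm X <= _](_ : (fun x => (f_ k x - f x) + (g_ k x - g x)) = _).
    by apply: nrmD; exact: L2B.
  by apply/funext => x; ring.
by rewrite -(addr0 0); exact: cvgD.
Qed.

Lemma nrm_leZ (c : R) f g : 0 <= c -> nrm2 f <= c ^+ 2 * nrm2 g -> nrm f <= c * nrm g.
Proof.
move=> c0 H; rewrite -(@ler_sqr _ (nrm f)) ?nnegrE ?mulr_ge0 ?nrm_ge0//.
by rewrite exprMn !sqr_nrm.
Qed.

Lemma nrmZ (c : C) f : L2 f -> nrm (fun x => c * f x) = normc c * nrm f.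
Proof.
by move=> Lf; rewrite /nrm nrm2Z// sqrtrM ?sqr_ge0// sqrtr_sqr ger0_norm// normc_ge0.
Qed.

Lemma nrm_conj f : nrm (fun x => (f x)^*) = nrm f.
Proof. by rewrite /nrm nrm2_conj. Qed.

Lemma nrm_subC f g : nrm (fun x => f x - g x) = nrm (fun x => g x - f x).
Proof. by rewrite /nrm nrm2_subC. Qed.

Lemma ae_nrm f g : cmeas f -> cmeas g -> {ae mu, forall x, f x = g x} -> nrm g = nrm f.
Proof. by move=> mf mg fg; rewrite /nrm (ae_nrm2 mf mg fg). Qed.

Lemma nrm_eq0 f : L2 f -> nrm f = 0 -> {ae mu, forall x, f x = 0}.
Proof. by move=> Lf f0; apply: nrm2_eq0 => //; rewrite -sqr_nrm f0 expr0n. Qed.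

Lemma L2_cvgZ (c : C) (f_ : nat -> Rn -> C) f : (forall k, L2 (f_ k)) -> L2 f ->
  L2_cvg setT f_ f -> L2_cvg setT (fun k x => c * f_ k x) (fun x => c * f x).
Proof.
move=> Lf_ Lf; apply: (@L2_cvg_le (normc c)) => [k||k||k]; [exact: Lf_|exact: Lf|exact: L2Z|exact: L2Z|].
rewrite -nrmZ; last exact: L2B.
by under eq_fun do rewrite -mulrBr.
Qed.

Lemma L2_cvg_conj (f_ : nat -> Rn -> C) f : (forall k, L2 (f_ k)) -> L2 f ->
  L2_cvg setT f_ f -> L2_cvg setT (fun k x => (f_ k x)^*) (fun x => (f x)^*).
Proof.
move=> Lf_ Lf; apply: (@L2_cvg_le 1) => [k||k||k]; [exact: Lf_|exact: Lf|exact: L2_conj|exact: L2_conj|].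
rewrite mul1r -[X in X <= _]nrm_conj.
by under eq_fun do rewrite conjcB !conjcK.
Qed.

Lemma L2_cvg_cst f : L2 f -> L2_cvg setT (fun=> f) f.
Proof.
move=> Lf; apply/L2_cvg_nrmP => //.
rewrite [X in X @ _](_ : _ = fun=> 0); first exact: cvg_cst.
apply/funext => k; rewrite /nrm [X in nrm2 X](_ : _ = fun=> 0) ?nrm20 ?sqrtr0//.
by apply/funext => x; rewrite subrr.
Qed.

(** On the space side it brings L^2 functions into L^1; on the frequency side it later isolates the
    low frequencies. *)
Definition trunc (k : nat) u x : C := box1 (const_mx (- k%:R)) (const_mx k%:R) x * u x.

Lemma normc_trunc k u x : normc (trunc k u x) <= normc (u x).
Proof.
rewrite /trunc /box1 Normc.normcM normc_real indicE.
by case: (_ \in _); rewrite ?normr1 ?mul1r// normr0 mul0r normc_ge0.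
Qed.

Lemma cinteg_trunc k u : L2 u -> cinteg mu (trunc k u).
Proof. by move=> Lu; apply: cinteg_mul => //; exact: L2_box1. Qed.

Lemma L2_trunc k u : L2 u -> L2 (trunc k u).
Proof.
move=> Lu; have [] := @L2_le _ _ 1 u (trunc k u); rewrite ?ler01//.
- by apply: cinteg_meas; exact: cinteg_trunc.
- by move=> x; rewrite mul1r; exact: normc_trunc.
Qed.

Lemma trunc_near u x : exists K, forall k, (K <= k)%N -> trunc k u x = u x.
Proof.
have [K _ Kx] : (\bigcup_k cube k) x by rewrite bigcup_cube.
exists K => k Kk; rewrite /trunc /box1 indicE mem_set ?mul1r//.
exact: (subset_cube Kk Kx).
Qed.

Lemma trunc_cvg u : L2 u -> L2_cvg setT (fun k => trunc k u) u.
Proof.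
move=> Lu; apply/L2_cvgP => // [k|]; first exact: L2_trunc.
have H : ccvg (fun k => cI mu (fun x => (normc (trunc k u x - u x) ^+ 2)%:C)) (cI mu (fun=> 0)).
  (* The factor [4] comes from [|a - b|^2 <= 2 (|a|^2 + |b|^2)] and [|trunc k u| <= |u|]. *)
  apply: (@cI_dominated _ _ _ mu _ _ (fun x => 4 * normc (u x) ^+ 2)) => [k||||].
  - apply: cmeas_real; apply: cmeas_sqr; apply: cmeasB; first by apply: L2_meas; exact: L2_trunc.
    exact: L2_meas.
  - exact: cmeas_cst.
  - by apply: integrableZ_EFin; exact: ((L2P u).1 Lu).2.
  - apply: aeW => x; change (0 : C) with ((0 : R)%:C); apply: ccvg_real; apply/cvg0P => e e0.
    have [K HK] := trunc_near u x; exists K => k Kk; rewrite HK// subrr.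
    by rewrite Normc.normc0 expr0n normr0.
  - move=> k; apply: aeW => x; rewrite normc_real ger0_norm ?sqr_ge0//.
    have /le_trans := normcD_sqr (trunc k u x) (- u x); apply.
    rewrite normcN; have := normc_trunc k u x; have := normc_ge0 (trunc k u x).
    by move: (normc _) (normc _) => a b a0 ab; nra.
have [+ _] := H.
rewrite /cI /= [X in _ --> X](_ : _ = 0); last by rewrite /Rintegral integral0.
by under eq_fun do rewrite -nrm2E.
Qed.

Lemma is_fourier_exists u : L2 u -> exists v, is_fourier u v.
Proof.
move=> Lu.
(* The exponent [k.+1] leaves room for the triangle inequality: consecutive truncations are then at
   distance at most [4^-k], as [L2_complete] requires. *)
have H k : exists l, nrm (fun x => trunc l u x - u x) <= (4 ^+ k.+1)^-1.
  have /(L2_cvg_nrmP _ Lu)/cvg0P/(_ (4 ^+ k.+1)^-1) := trunc_cvg Lu.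
  move=> /(_ _ _)[k'||K HK]; [exact: L2_trunc|by rewrite invr_gt0 exprn_gt0|].
  exists K; apply/ltW; apply: le_lt_trans (HK K _) => //; exact: ler_norm.
have [s Hs] := choice H.
pose w k := trunc (s k) u.
have Iw k : cinteg mu (w k) by exact: cinteg_trunc.
have Lw k : L2 (w k) by exact: L2_trunc.
have wstep k : nrm (fun x => w k.+1 x - w k x) <= (4 ^+ k)^-1.
  apply: le_trans (nrm_tri (Lw _) Lu (Lw _)) _; rewrite (nrm_subC u).
  have := lerD (Hs k.+1) (Hs k).
  have := exprn_gt0 k (ltr0n R 4); rewrite !exprS !invfM => k0 /le_trans; apply.
  have : 0 < (4 ^+ k)^-1 :> R by rewrite invr_gt0.
  by move: (4 ^+ k)^-1 => a a0; lra.
have LF k : L2 (fourier_int (w k)) by have [] := fourier_int_L2 (Iw k) (Lw k).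
have Fstep k : nrm (fun x => fourier_int (w k.+1) x - fourier_int (w k) x) <= (4 ^+ k)^-1.
  apply: le_trans (wstep k).
  rewrite -[X in nrm X](fourier_intB (Iw _) (Iw _)) /nrm ler_wsqrtr//.
  by have [] := fourier_int_L2 (cintegB (Iw k.+1) (Iw k)) (L2B (Lw k.+1) (Lw k)).
have [v Lv Hv] := L2_complete LF Fstep.
have c4 : 2 / 4 ^+ k @[k --> \oo] --> (0 : R).
  rewrite -(mulr0 2); apply: cvgM; first exact: cvg_cst.
  under eq_fun do rewrite -exprVn; apply: cvg_expr.
  by rewrite ger0_norm// invf_lt1// ltr1n.
exists v; split => //; exists w => [k|]; first by split => //; exact/L1P.
split.
  apply/L2_cvg_nrmP => //; apply: (squeeze0 _ c4) => k; rewrite nrm_ge0/=.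
  apply: le_trans (Hs k) _; rewrite exprS invfM.
  have : 0 < (4 ^+ k)^-1 :> R by rewrite invr_gt0 exprn_gt0.
  by move: (4 ^+ k)^-1 => a a0; lra.
apply/L2_cvg_nrmP => //; apply: (squeeze0 _ c4) => k; rewrite nrm_ge0/=.
exact: Hv.
Qed.

Lemma is_fourierD u v u' v' : is_fourier u v -> is_fourier u' v' ->
  is_fourier (fun x => u x + u' x) (fun x => v x + v' x).
Proof.
move=> [Lu Lv [w Lw [wu wv]]] [Lu' Lv' [w' Lw' [wu' wv']]].
have Iw k : cinteg mu (w k) by apply/L1P; have [] := Lw k.
have Iw' k : cinteg mu (w' k) by apply/L1P; have [] := Lw' k.
have L2w k : L2 (w k) by have [] := Lw k.
have L2w' k : L2 (w' k) by have [] := Lw' k.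
split; [exact: L2D|exact: L2D|].
exists (fun k x => w k x + w' k x) => [k|].
  by split; [apply/L1P; exact: cintegD|exact: L2D].
split; first exact: L2_cvgD.
under [X in L2_cvg _ X]eq_fun do rewrite fourier_intD//.
apply: L2_cvgD => // k; first by have [] := fourier_int_L2 (Iw k) (L2w k).
by have [] := fourier_int_L2 (Iw' k) (L2w' k).
Qed.

Lemma is_fourierZ (c : C) u v : is_fourier u v ->
  is_fourier (fun x => c * u x) (fun x => c * v x).
Proof.
move=> [Lu Lv [w Lw [wu wv]]].
have Iw k : cinteg mu (w k) by apply/L1P; have [] := Lw k.
have L2w k : L2 (w k) by have [] := Lw k.
split; [exact: L2Z|exact: L2Z|].
exists (fun k x => c * w k x) => [k|].
  by split; [apply/L1P; exact: cintegZ|exact: L2Z].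
split; first exact: L2_cvgZ.
under [X in L2_cvg _ X]eq_fun do rewrite fourier_intZ//.
by apply: L2_cvgZ => // k; have [] := fourier_int_L2 (Iw k) (L2w k).
Qed.

Lemma is_fourierB u v u' v' : is_fourier u v -> is_fourier u' v' ->
  is_fourier (fun x => u x - u' x) (fun x => v x - v' x).
Proof.
move=> H /(is_fourierZ (-1)) /(is_fourierD H); congr is_fourier; apply/funext => x; ring.
Qed.

Lemma is_fourier_le u v : is_fourier u v -> nrm v <= nrm u.
Proof.
move=> [Lu Lv [w Lw [wu wv]]].
have L2w k : L2 (w k) by have [] := Lw k.
have LF k : L2 (fourier_int (w k)) /\ nrm2 (fourier_int (w k)) <= nrm2 (w k).
  by apply: fourier_int_L2 => //; apply/L1P; have [] := Lw k.
have c1 := nrm_cvg L2w Lu wu.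
have c2 := nrm_cvg (fun k => (LF k).1) Lv wv.
by apply: (ler_cvg_to c2 c1); apply: nearW => k; rewrite ler_wsqrtr//; exact: (LF k).2.
Qed.

Lemma is_fourier_ae u u' v v' : is_fourier u v -> is_fourier u' v' ->
  {ae mu, forall x, u x = u' x} -> {ae mu, forall x, v x = v' x}.
Proof.
move=> H H' uu'; have [Lu Lv _] := H; have [Lu' Lv' _] := H'.
have : nrm (fun x => v x - v' x) = 0.
  apply/eqP; rewrite eq_le nrm_ge0 andbT.
  apply: le_trans (is_fourier_le (is_fourierB H H')) _.
  rewrite (@ae_nrm (fun=> 0) (fun x => u x - u' x)).
  - by rewrite /nrm nrm20 sqrtr0.
  - exact: cmeas_cst.
  - by apply: L2_meas; exact: L2B.
  - by apply: filterS uu' => x ->; rewrite subrr.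
move=> /(nrm_eq0 (L2B Lv Lv')); apply: filterS => x /eqP.
by rewrite subr_eq0 => /eqP.
Qed.

Lemma fourierP u : L2 u -> is_fourier u (fourier u).
Proof.
by move=> /is_fourier_exists[v Hv]; rewrite /fourier; case: xgetP => [w _ //|/(_ v)].
Qed.

Lemma L2_fourier u : L2 u -> L2 (fourier u).
Proof. by move=> /fourierP[]. Qed.

Lemma fourier_uniq u v : is_fourier u v -> {ae mu, forall x, fourier u x = v x}.
Proof.
move=> H; have [Lu _ _] := H.
by apply: (is_fourier_ae (fourierP Lu) H); apply: aeW.
Qed.

Lemma fourierD u u' : L2 u -> L2 u' ->
  {ae mu, forall x, fourier (fun y => u y + u' y) x = fourier u x + fourier u' x}.
Proof. by move=> Lu Lu'; apply: fourier_uniq; apply: is_fourierD; exact: fourierP. Qed.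

Lemma fourierB u u' : L2 u -> L2 u' ->
  {ae mu, forall x, fourier (fun y => u y - u' y) x = fourier u x - fourier u' x}.
Proof. by move=> Lu Lu'; apply: fourier_uniq; apply: is_fourierB; exact: fourierP. Qed.

Lemma fourierZ (c : C) u : L2 u ->
  {ae mu, forall x, fourier (fun y => c * u y) x = c * fourier u x}.
Proof. by move=> Lu; apply: fourier_uniq; apply: is_fourierZ; exact: fourierP. Qed.

Lemma fourier_fourier_int u : cinteg mu u -> L2 u ->
  {ae mu, forall x, fourier u x = fourier_int u x}.
Proof.
move=> Iu Lu; apply: fourier_uniq.
have LF := (fourier_int_L2 Iu Lu).1.
split => //; exists (fun=> u) => [k|]; first by split => //; exact/L1P.
by split; exact: L2_cvg_cst.
Qed.

(** Conjugate, transform, conjugate again: this reverses the sign in the exponential. It is the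
    adjoint of [fourier] by [ip_fourier_adj], and its inverse by [fourier_invK] and
    [fourier_fourier_inv]. *)
Definition fourier_inv u x : C := (fourier (fun y => (u y)^*) x)^*.

Lemma L2_fourier_inv u : L2 u -> L2 (fourier_inv u).
Proof. by move=> Lu; apply: L2_conj; apply: L2_fourier; exact: L2_conj. Qed.

(** Both sides are continuous in [f] and [g]; on the approximating integrable functions the identity
    is [fourier_int_duality]. *)
Lemma ip_fourier_adj f g : L2 f -> L2 g -> ip (fourier f) g = ip f (fourier_inv g).
Proof.
move=> Lf Lg.
have [_ LFf [w Lw [wf wFf]]] := fourierP Lf.
have Lcg := L2_conj Lg.
have [_ LFg [w' Lw' [wg wFg]]] := fourierP Lcg.
have Iw k : cinteg mu (w k) by apply/L1P; have [] := Lw k.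
have Iw' k : cinteg mu (w' k) by apply/L1P; have [] := Lw' k.
have L2w k : L2 (w k) by have [] := Lw k.
have L2w' k : L2 (w' k) by have [] := Lw' k.
have LF k : L2 (fourier_int (w k)) by have [] := fourier_int_L2 (Iw k) (L2w k).
have LF' k : L2 (fourier_int (w' k)) by have [] := fourier_int_L2 (Iw' k) (L2w' k).
have wgc := L2_cvg_conj L2w' Lcg wg.
have wFgc := L2_cvg_conj LF' LFg wFg.
have gE : (fun x => ((g x)^*)^*) = g by apply/funext => x; rewrite conjcK.
rewrite gE in wgc.
have c1 := ip_cvg LF LFf (fun k => L2_conj (L2w' k)) Lg wFf wgc.
have c2 := ip_cvg L2w Lf (fun k => L2_conj (LF' k)) (L2_fourier_inv Lg) wf wFgc.
apply: (cvg_normc_eq _ c1 c2) => k.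
rewrite /ip; under eq_fun do rewrite conjcK.
rewrite fourier_int_duality//; congr cI; apply/funext => x; by rewrite conjcK.
Qed.

Lemma ip_fourier_box a b g : L2 g ->
  ip (fourier (box1 a b)) (fourier g) = ip (box1 a b) g.
Proof.
move=> Lg.
have [_ LFg [w Lw [wg wFg]]] := fourierP Lg.
have Iw k : cinteg mu (w k) by apply/L1P; have [] := Lw k.
have L2w k : L2 (w k) by have [] := Lw k.
have LF k : L2 (fourier_int (w k)) by have [] := fourier_int_L2 (Iw k) (L2w k).
have Lb : L2 (@box1 R n a b) := L2_box1 a b.
have LFb := L2_fourier Lb.
have c1 := ip_cvg (fun=> LFb) LFb LF LFg (L2_cvg_cst LFb) wFg.
have c2 := ip_cvg (fun=> Lb) Lb L2w Lg (L2_cvg_cst Lb) wg.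
apply: (cvg_normc_eq _ c1 c2) => k.
rewrite -(parseval_box _ _ (Iw k) (L2w k)); apply: ae_ip => //.
- by have [] := fourier_int_L2 (cinteg_box1 a b) Lb.
- by apply: fourier_fourier_int => //; exact: cinteg_box1.
- exact: aeW.
Qed.

(** [h] need not be integrable, so it is first cut to a cube; the intersection of a box with a cube
    is again a box, hence the hypothesis survives the truncation. *)
Lemma L2_box0_ae h : L2 h -> (forall a b, ip (box1 a b) h = 0) ->
  {ae mu, forall x, h x = 0}.
Proof.
move=> Lh H.
have conjC (z : C) : z^* = 0 -> z = 0 by move=> /(congr1 conjc); rewrite conjcK conjc0.
have H0 a b : cI mu (fun x => box1 a b x * h x) = 0.
  apply: conjC; rewrite -cI_conj; last by apply: cinteg_mul => //; exact: L2_box1.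
  rewrite -(H a b) /ip; congr cI; apply/funext => x.
  by rewrite conjcM /box1 conjc_real.
have boxM a b k x : (\1_(rV_box a b) x)%:C * trunc k h x =
    box1 (\row_i Num.max (a 0 i) (- k%:R)) (\row_i Num.min (b 0 i) k%:R) x * h x.
  rewrite /trunc mulrA /box1 -rmorphM; congr (_%:C * _).
  have /(congr1 (@^~ x))/= <- := indicI R (rV_box a b) (cube k).
  rewrite rV_boxI; congr (\1_(rV_box _ _) x); apply/rowP => i; by rewrite !mxE.
suff : {ae mu, forall x k, trunc k h x = 0}.
  by apply: filterS => x Hx; have [K HK] := trunc_near h x; rewrite -(HK K)//.
apply: ae_foralln => k.
have Ih := cinteg_trunc k Lh.
have part (P : C -> R) : (forall (r : R) z, P (r%:C * z) = r * P z) ->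
    mu.-integrable setT (EFin \o (P \o trunc k h)) ->
    (forall a b, \int[mu]_x (P (box1 a b x * h x)) = 0) ->
    {ae mu, forall x, P (trunc k h x) = 0}.
  move=> PZ IP P0; apply: integral_box0_ae => // a b.
  have mb := measurable_rV_box a b.
  rewrite -[LHS]fineK; last first.
    by apply: integrable_fin_num => //; apply: integrableS IP.
  congr _%:E; rewrite -(P0 (\row_i Num.max (a 0 i) (- k%:R)) (\row_i Num.min (b 0 i) k%:R)).
  rewrite integral_mkcond /Rintegral; congr fine; apply: eq_integral => x _.
  by rewrite -boxM PZ patchE indicE; case: (x \in _); rewrite ?mul1r ?mul0r.
have hR : {ae mu, forall x, Re (trunc k h x) = 0}.
  apply: part => [r z||a b]; [by rewrite cReM /= mul0r subr0|exact: Ih.1|].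
  exact: (congr1 Re (H0 a b)).
have hI : {ae mu, forall x, Im (trunc k h x) = 0}.
  apply: part => [r z||a b]; [by rewrite cImM /= mul0r addr0|exact: Ih.2|].
  exact: (congr1 Im (H0 a b)).
by apply: filterS2 hR hI => x hRx hIx; apply: complex_ext; rewrite ?hRx ?hIx.
Qed.

(** By adjunction and Parseval's identity for boxes, the difference of the two sides is orthogonal
    to every box. No Parseval identity between general functions is used. *)
Lemma fourier_invK f : L2 f -> {ae mu, forall x, fourier_inv (fourier f) x = f x}.
Proof.
move=> Lf.
have LFf := L2_fourier Lf.
have LFi := L2_fourier_inv LFf.
have : {ae mu, forall x, fourier_inv (fourier f) x - f x = 0}.
  apply: L2_box0_ae; first exact: L2B.
  move=> a b; have Lb : L2 (@box1 R n a b) := L2_box1 a b.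
  by rewrite ipBr// -ip_fourier_adj// ip_fourier_box// subrr.
by apply: filterS => x /eqP; rewrite subr_eq0 => /eqP.
Qed.

(** Conjugation exchanges [fourier] and [fourier_inv], so surjectivity is [fourier_invK] applied to
    the conjugate of [f]. *)
Lemma fourier_fourier_inv f : L2 f -> {ae mu, forall x, fourier (fourier_inv f) x = f x}.
Proof.
move=> Lf; have := fourier_invK (L2_conj Lf); apply: filterS => x Hx.
by rewrite -[LHS]conjcK [X in X^*]Hx conjcK.
Qed.

Lemma nrm2_fourier f : L2 f -> nrm2 (fourier f) = nrm2 f.
Proof.
move=> Lf; have LFf := L2_fourier Lf.
have : ip (fourier f) (fourier f) = ip f f.
  rewrite ip_fourier_adj//; apply: ae_ip => //; first exact: L2_fourier_inv.
    exact: aeW.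
  exact: fourier_invK.
by rewrite !ip_nrm2 => -[].
Qed.

Lemma nrm_fourier f : L2 f -> nrm (fourier f) = nrm f.
Proof. by move=> Lf; rewrite /nrm nrm2_fourier. Qed.

Lemma fourier_inj f g : L2 f -> L2 g ->
  {ae mu, forall x, fourier f x = fourier g x} -> {ae mu, forall x, f x = g x}.
Proof.
move=> Lf Lg H.
have : nrm (fun x => f x - g x) = 0.
  rewrite -nrm_fourier; last exact: L2B.
  have L0 : cmeas (fun _ : Rn => 0 : C) by exact: cmeas_cst.
  have LB := L2_fourier (L2B Lf Lg).
  have F0 : {ae mu, forall x, 0 = fourier (fun y => f y - g y) x}.
    by apply: filterS2 H (fourierB Lf Lg) => x e ->; rewrite e subrr.
  by rewrite (ae_nrm L0 (L2_meas LB) F0) /nrm nrm20 sqrtr0.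
move=> /(nrm_eq0 (L2B Lf Lg)); apply: filterS => x /eqP.
by rewrite subr_eq0 => /eqP.
Qed.

End fourier_L2.

(** * Pseudo-differential operators and the algebra A *)

Section pseudo_differential_def.
Context {R : realType} {n : nat}.
Local Notation "x ^*" := (conjc x) : ring_scope.
Local Notation Rn := 'rV[R]_n.
Local Notation C := R[i].
Local Notation mu := (@leb R n).
Implicit Types (u v w f g h psi phi Phi : Rn -> C) (x y xi : Rn) (e : R).

Lemma L2_le_ae (M : R) f g : 0 <= M -> cmeas g -> L2 f ->
  {ae mu, forall x, normc (g x) <= M * normc (f x)} ->
  L2 g /\ nrm g <= M * nrm f.
Proof.
move=> M0 mg Lf gf.
have LMf := L2Z (M%:C) Lf.
have le : (L2sq setT g <= L2sq setT (fun x => (M%:C * f x)%R))%E.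
  apply: ae_ge0_le_integral => //.
  - by move=> x _; rewrite lee_fin sqr_ge0.
  - by apply/measurable_EFinP; exact: cmeas_sqr.
  - by move=> x _; rewrite lee_fin sqr_ge0.
  - by apply/measurable_EFinP; apply: cmeas_sqr; exact: L2_meas.
  - apply: filterS gf => x H _; rewrite lee_fin ler_pXn2r ?nnegrE ?normc_ge0//.
    by rewrite Normc.normcM normc_real ger0_norm.
have Lg : L2 g by split => //; apply: le_lt_trans le _; have [] := LMf.
split=> //; apply: nrm_leZ => //.
have <- : nrm2 (fun x => M%:C * f x) = M ^+ 2 * nrm2 f.
  by rewrite nrm2Z// normc_real ger0_norm.
by rewrite -lee_fin -!L2sqE.
Qed.

Lemma Linfty_bound psi : Linfty psi -> exists M : R, 0 <= M /\
  {ae mu, forall x, normc (psi x) <= M}.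
Proof.
move=> [_ [M HM]]; exists `|M|; split; first exact: normr_ge0.
by apply: filterS HM => x /le_trans; apply; exact: ler_norm.
Qed.

Lemma L2_mulr (M : R) psi f : 0 <= M -> cmeas psi -> {ae mu, forall x, normc (psi x) <= M} ->
  L2 f -> L2 (fun x => psi x * f x) /\ nrm (fun x => psi x * f x) <= M * nrm f.
Proof.
move=> M0 mp pM Lf; apply: L2_le_ae => //; first by apply: cmeasM => //; exact: L2_meas.
by apply: filterS pM => x H; rewrite Normc.normcM ler_wpM2r// normc_ge0.
Qed.

Lemma L2_Linfty psi f : Linfty psi -> L2 f -> L2 (fun x => psi x * f x).
Proof.
move=> Lp Lf; have [M [M0 HM]] := Linfty_bound Lp.
by have [] := L2_mulr M0 Lp.1 HM Lf.
Qed.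

Lemma LinftyD phi psi : Linfty phi -> Linfty psi -> Linfty (fun x => phi x + psi x).
Proof.
move=> [mp [M HM]] [mq [M' HM']]; split; first exact: cmeasD.
exists (M + M'); apply: filterS2 HM HM' => x a b.
by apply: le_trans (le_normcD _ _) _; exact: lerD.
Qed.

Lemma LinftyM phi psi : Linfty phi -> Linfty psi -> Linfty (fun x => phi x * psi x).
Proof.
move=> [mp [M HM]] [mq [M' HM']]; split; first exact: cmeasM.
exists (M * M'); apply: filterS2 HM HM' => x a b.
by rewrite Normc.normcM; apply: ler_pM => //; exact: normc_ge0.
Qed.

Lemma Linfty_cst (c : C) : Linfty (fun _ : Rn => c).
Proof. by split; [exact: cmeas_cst|exists (normc c); exact: aeW]. Qed.

Lemma Linfty_conj psi : Linfty psi -> Linfty (fun x => (psi x)^*).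
Proof.
move=> [mp [M HM]]; split; first exact: cmeas_conj.
by exists M; apply: filterS HM => x; rewrite normc_conj.
Qed.

(** The set from which [psdoA] picks is nonempty: it contains the inverse transform of
    [psi * fourier u]. By injectivity of the transformation the choice is determined almost
    everywhere. *)
Lemma psdoA_spec psi u : Linfty psi -> L2 u -> L2 (psdoA psi u) /\
  {ae mu, forall xi, fourier (psdoA psi u) xi = psi xi * fourier u xi}.
Proof.
move=> Lp Lu; rewrite /psdoA; case: xgetP => [w _ //|].
have LL : L2 (fun xi => psi xi * fourier u xi) by apply: L2_Linfty => //; exact: L2_fourier.
move=> /(_ (fourier_inv (fun xi => psi xi * fourier u xi))) [].
by split; [exact: L2_fourier_inv|exact: fourier_fourier_inv].
Qed.

End pseudo_differential_def.

#[global] Opaque fourier psdoA.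

Section pseudo_differential.
Context {R : realType} {n : nat}.
Local Notation "x ^*" := (conjc x) : ring_scope.
Local Notation Rn := 'rV[R]_n.
Local Notation C := R[i].
Local Notation mu := (@leb R n).
Implicit Types (u v w f g h psi phi Phi : Rn -> C) (x y xi : Rn) (e : R).

Lemma L2_psdoA psi u : Linfty psi -> L2 u -> L2 (psdoA psi u).
Proof. by move=> Lp /(psdoA_spec Lp)[]. Qed.

Lemma fourier_psdoA psi u : Linfty psi -> L2 u ->
  {ae mu, forall xi, fourier (psdoA psi u) xi = psi xi * fourier u xi}.
Proof. by move=> Lp /(psdoA_spec Lp)[]. Qed.

Lemma psdoA_uniq psi u w : Linfty psi -> L2 u -> L2 w ->
  {ae mu, forall xi, fourier w xi = psi xi * fourier u xi} ->
  {ae mu, forall x, psdoA psi u x = w x}.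
Proof.
move=> Lp Lu Lw H; apply: fourier_inj => //; first exact: L2_psdoA.
by apply: filterS2 H (fourier_psdoA Lp Lu) => x -> ->.
Qed.

Lemma psdoA_le (M : R) psi u : 0 <= M -> Linfty psi -> {ae mu, forall x, normc (psi x) <= M} ->
  L2 u -> nrm (psdoA psi u) <= M * nrm u.
Proof.
move=> M0 Lp HM Lu; have [LA FA] := psdoA_spec Lp Lu.
have LFu := L2_fourier Lu.
rewrite -nrm_fourier// -(nrm_fourier Lu).
have H : {ae mu, forall x, normc (fourier (psdoA psi u) x) <= M * normc (fourier u x)}.
  by apply: filterS2 HM FA => x a ->; rewrite Normc.normcM ler_wpM2r// normc_ge0.
by have [_] := L2_le_ae M0 (L2_meas (L2_fourier LA)) LFu H.
Qed.

Lemma psdoAB psi u v : Linfty psi -> L2 u -> L2 v ->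
  {ae mu, forall x, psdoA psi (fun y => u y - v y) x = psdoA psi u x - psdoA psi v x}.
Proof.
move=> Lp Lu Lv; have [LA FA] := psdoA_spec Lp Lu; have [LA' FA'] := psdoA_spec Lp Lv.
apply: (psdoA_uniq Lp (L2B Lu Lv) (L2B LA LA')).
apply: filterS2 (filterI FA FA') (filterI (fourierB LA LA') (fourierB Lu Lv)).
have E (q a a' s s' t t' : C) : s = q * a -> s' = q * a' -> t = s - s' -> t' = a - a' -> t = q * t'.
  by move=> -> -> -> ->; rewrite mulrBr.
by move=> x [a b] [c d]; exact: E a b c d.
Qed.

Lemma psdoA_symD phi psi u : Linfty phi -> Linfty psi -> L2 u ->
  {ae mu, forall x, psdoA (phi \+ psi) u x = psdoA phi u x + psdoA psi u x}.
Proof.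
move=> Lp Lq Lu; have [LA FA] := psdoA_spec Lp Lu; have [LA' FA'] := psdoA_spec Lq Lu.
apply: (psdoA_uniq (LinftyD Lp Lq) Lu (L2D LA LA')).
by apply: filterS3 FA FA' (fourierD LA LA') => x a b ->; rewrite a b /= mulrDl.
Qed.

Lemma psdoA_symZ (c : C) psi u : Linfty psi -> L2 u ->
  {ae mu, forall x, psdoA (fun xi => c * psi xi) u x = c * psdoA psi u x}.
Proof.
move=> Lp Lu; have [LA FA] := psdoA_spec Lp Lu.
apply: (psdoA_uniq (LinftyM (Linfty_cst c) Lp) Lu (L2Z c LA)).
by apply: filterS2 FA (fourierZ c LA) => x a ->; rewrite a mulrA.
Qed.

Lemma psdoA_symM phi psi u : Linfty phi -> Linfty psi -> L2 u ->
  {ae mu, forall x, psdoA (phi \* psi) u x = psdoA phi (psdoA psi u) x}.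
Proof.
move=> Lp Lq Lu; have [LA FA] := psdoA_spec Lq Lu; have [LA' FA'] := psdoA_spec Lp LA.
apply: (psdoA_uniq (LinftyM Lp Lq) Lu LA').
by apply: filterS2 FA FA' => x a ->; rewrite a /= mulrA.
Qed.

Lemma psdoA_sym1 u : L2 u -> {ae mu, forall x, psdoA (fun=> 1) u x = u x}.
Proof.
move=> Lu; apply: psdoA_uniq => //; first exact: Linfty_cst.
by apply: aeW => x; rewrite mul1r.
Qed.

Lemma ip_fourier f g : L2 f -> L2 g -> ip (fourier f) (fourier g) = ip f g.
Proof.
move=> Lf Lg; have LFg := L2_fourier Lg.
rewrite ip_fourier_adj//; apply: ae_ip => //; first exact: L2_fourier_inv.
  exact: aeW.
exact: fourier_invK.
Qed.

Lemma ip_psdoA psi f g : Linfty psi -> L2 f -> L2 g ->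
  ip (psdoA psi f) g = ip f (psdoA (fun x => (psi x)^*) g).
Proof.
move=> Lp Lf Lg; have Lc := Linfty_conj Lp.
have [LA FA] := psdoA_spec Lp Lf; have [LA' FA'] := psdoA_spec Lc Lg.
rewrite -(ip_fourier LA Lg) -(ip_fourier Lf LA').
have mip a b : L2 a -> L2 b -> cmeas (fun x => a x * (b x)^*).
  by move=> La Lb; apply: cmeasM; [exact: L2_meas|apply: cmeas_conj; exact: L2_meas].
apply: ae_eq_cI; [by apply: mip; exact: L2_fourier|by apply: mip; exact: L2_fourier|].
apply: filterS2 FA FA' => x.
have E (q a b s t : C) : s = q * a -> t = q^* * b -> s * b^* = a * t^*.
  by move=> -> ->; rewrite conjcM conjcK; ring.
exact: E.
Qed.

Lemma homo_lt_id (s : nat -> nat) : {homo s : i j / (i < j)%N} -> forall k, (k <= s k)%N.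
Proof. by move=> Hs; elim=> // k IH; apply: leq_ltn_trans IH _; exact: Hs. Qed.

Lemma cvg_subseq (a : nat -> R) (l : R) (s : nat -> nat) : {homo s : i j / (i < j)%N} ->
  a k @[k --> \oo] --> l -> a (s k) @[k --> \oo] --> l.
Proof.
move=> Hs /cvgnP ca; apply/cvgnP => e e0; have [K HK] := ca e e0.
by exists K => k Kk; apply: HK; apply: leq_trans Kk _; exact: homo_lt_id.
Qed.

Lemma compact_opP (T : (Rn -> C) -> Rn -> C) : (forall u, L2 u -> L2 (T u)) ->
  compact_operator T <-> forall u_ : nat -> Rn -> C, (forall k, L2 (u_ k)) ->
    (exists M, forall k, nrm (u_ k) <= M) ->
  exists2 s : nat -> nat, {homo s : i j / (i < j)%N} &
  exists2 v, L2 v & nrm (fun x => T (u_ (s k)) x - v x) @[k --> \oo] --> (0 : R).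
Proof.
move=> LT; split=> H u_ Lu [M HM].
  have [|s Hs [v Lv Hv]] := H u_ Lu; last first.
    exists s => //; exists v; first exact: Lv.
    by apply/(L2_cvg_nrmP _ Lv) => [k|]; [exact: LT|exact: Hv].
  exists (M ^+ 2) => k; rewrite L2sqE// lee_fin -sqr_nrm.
  by rewrite ler_pXn2r ?nnegrE ?nrm_ge0//; apply: le_trans (HM k); exact: nrm_ge0.
have [|s Hs [v Lv Hv]] := H u_ Lu.
  exists (Num.sqrt M) => k; rewrite /nrm ler_wsqrtr//.
  by have := HM k; rewrite L2sqE// lee_fin.
exists s => //; exists v; first exact: Lv.
by apply/(L2_cvg_nrmP _ Lv) => [k|]; [exact: LT|exact: Hv].
Qed.

(** The decomposition of [T] is required almost everywhere only, since identities between the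
    operators [psdoA] hold in no stronger sense. The second subsequence is extracted from the
    first. *)
Lemma compact_op_add (T S1 S2 : (Rn -> C) -> Rn -> C) :
  (forall u, L2 u -> [/\ L2 (T u), L2 (S1 u) & L2 (S2 u)]) ->
  (forall u, L2 u -> {ae mu, forall x, T u x = S1 u x + S2 u x}) ->
  compact_operator S1 -> compact_operator S2 -> compact_operator T.
Proof.
move=> LT TE H1 H2; apply/compact_opP => [u /LT[]//|u_ Lu [M HM]].
have L1 u : L2 u -> L2 (S1 u) by move=> /LT[].
have L2' u : L2 u -> L2 (S2 u) by move=> /LT[].
have [s1 Hs1 [v1 Lv1 c1]] := (compact_opP L1).1 H1 u_ Lu (ex_intro _ M HM).
have [s2 Hs2 [v2 Lv2 c2]] := (compact_opP L2').1 H2 (u_ \o s1) (fun k => Lu _)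
  (ex_intro _ M (fun k => HM (s1 k))).
exists (s1 \o s2); first by move=> i j ij; apply: Hs1; exact: Hs2.
exists (fun x => v1 x + v2 x); first exact: L2D.
apply: (@squeeze0 _ _ (fun k => nrm (fun x => S1 (u_ (s1 (s2 k))) x - v1 x) +
  nrm (fun x => S2 (u_ (s1 (s2 k))) x - v2 x))).
  move=> k; rewrite nrm_ge0 /=; set w := u_ _; have [LTw LSw LS2w] := LT w (Lu _).
  have L12 := L2B (L2D LSw LS2w) (L2D Lv1 Lv2).
  rewrite (ae_nrm (L2_meas L12) (L2_meas (L2B LTw (L2D Lv1 Lv2)))); last first.
    by apply: filterS (TE w (Lu _)) => x ->.
  rewrite [X in nrm X <= _](_ : _ = fun x => (S1 w x - v1 x) + (S2 w x - v2 x)).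
    by apply: nrmD; exact: L2B.
  by apply/funext => x; ring.
rewrite -(addr0 0); apply: cvgD; [exact: (cvg_subseq Hs2 c1)|exact: c2].
Qed.

(** A Lipschitz bound on the outer operator takes the place of linearity and boundedness: it makes
    the operator continuous along the convergent subsequence. *)
Lemma compact_op_comp (B : R) (T S1 S2 : (Rn -> C) -> Rn -> C) :
  (forall u, L2 u -> [/\ L2 (T u), L2 (S1 u) & L2 (S2 u)]) ->
  0 <= B -> (forall u v, L2 u -> L2 v -> nrm (fun x => S1 u x - S1 v x) <= B * nrm (fun x => u x - v x)) ->
  (forall u, L2 u -> {ae mu, forall x, T u x = S1 (S2 u) x}) ->
  compact_operator S2 -> compact_operator T.
Proof.
move=> LT B0 HB TE H2; apply/compact_opP => [u /LT[]//|u_ Lu bu].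
have L1 u : L2 u -> L2 (S1 u) by move=> /LT[].
have L2' u : L2 u -> L2 (S2 u) by move=> /LT[].
have LTu u : L2 u -> L2 (T u) by move=> /LT[].
have [s Hs [v Lv c]] := (compact_opP L2').1 H2 u_ Lu bu.
exists s => //; exists (S1 v); first exact: L1.
apply: (@squeeze0 _ _ (fun k => B * nrm (fun x => S2 (u_ (s k)) x - v x))) => [k|].
  rewrite nrm_ge0/=; set w := u_ _.
  have Lw : L2 w := Lu _.
  have LSS := L1 _ (L2' _ Lw).
  rewrite (ae_nrm (L2_meas (L2B LSS (L1 _ Lv))) (L2_meas (L2B (LTu _ Lw) (L1 _ Lv)))).
    by apply: HB => //; exact: L2'.
  by apply: filterS (TE w Lw) => x ->.
by rewrite -(mulr0 B); apply: cvgM => //; exact: cvg_cst.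
Qed.

Lemma compact_op_precomp (B : R) (T S1 S2 : (Rn -> C) -> Rn -> C) :
  (forall u, L2 u -> [/\ L2 (T u), L2 (S1 u) & L2 (S2 u)]) ->
  (forall u, L2 u -> nrm (S2 u) <= B * nrm u) -> 0 <= B ->
  (forall u, L2 u -> {ae mu, forall x, T u x = S1 (S2 u) x}) ->
  compact_operator S1 -> compact_operator T.
Proof.
move=> LT HB B0 TE H1; apply/compact_opP => [u /LT[]//|u_ Lu [M HM]].
have L1 u : L2 u -> L2 (S1 u) by move=> /LT[].
have L2' u : L2 u -> L2 (S2 u) by move=> /LT[].
have LTu u : L2 u -> L2 (T u) by move=> /LT[].
have [|s Hs [v Lv c]] := (compact_opP L1).1 H1 (S2 \o u_) (fun k => L2' _ (Lu k)).
  exists (B * M) => k; apply: le_trans (HB _ (Lu k)) _.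
  by apply: ler_wpM2l => //; exact: HM.
exists s => //; exists v => //.
apply: (squeeze0 _ c) => k; rewrite nrm_ge0 /=; set w := u_ _.
have Lw : L2 w := Lu _.
rewrite (ae_nrm (L2_meas (L2B (L1 _ (L2' _ Lw)) Lv)) (L2_meas (L2B (LTu _ Lw) Lv)))//.
by apply: filterS (TE w Lw) => x ->.
Qed.

Lemma csupport0 f x : ~ csupport f x -> f x = 0.
Proof.
by move=> H; apply/eqP/negPn/negP => fx; apply: H; apply: subset_closure.
Qed.

Lemma C0_bounded D Phi : C0 D Phi -> exists M : R, 0 <= M /\ forall x, normc (Phi x) <= M.
Proof.
move=> [[cR cI] cK _].
have bd (h : Rn -> R) : {within setT, continuous h} -> exists M : R, forall x, csupport Phi x -> `|h x| <= M.
  move=> ch.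
  have : compact (h @` csupport Phi).
    by apply: continuous_compact cK; exact: continuous_subspaceW ch.
  move=> /compact_bounded[M [_ HM]]; exists (M + 1) => x Kx.
  by apply: (HM (M + 1)); [rewrite ltrDl|exists x].
have [M1 H1] := bd _ cR.
have [M2 H2] := bd _ cI.
exists (`|M1| + `|M2|); split=> [|x]; first by rewrite addr_ge0.
have [Kx|nKx] := pselect (csupport Phi x); last by rewrite csupport0// Normc.normc0 addr_ge0.
apply: le_trans (normc_le _) _; apply: lerD.
  by apply: le_trans (H1 x Kx) _; exact: ler_norm.
by apply: le_trans (H2 x Kx) _; exact: ler_norm.
Qed.

Lemma C0_Linfty D Phi : C0 D Phi -> Linfty Phi.
Proof.
move=> H; have [M [_ HM]] := C0_bounded H; split; last by exists M; exact: aeW.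
by case: H => cP _ _; apply: ccontinuous_cmeasurable => //; exact: openT.
Qed.

Lemma L2_commutator psi Phi u : Linfty psi -> Linfty Phi -> L2 u ->
  L2 (commutator (psdoA psi) (multB Phi) u).
Proof.
move=> Lp LP Lu; apply: L2B; first by apply: L2_psdoA => //; exact: L2_Linfty.
by apply: L2_Linfty => //; exact: L2_psdoA.
Qed.

Lemma algA_D phi psi : algA phi -> algA psi -> algA (phi \+ psi).
Proof.
move=> [Lp Hp] [Lq Hq]; have LD := LinftyD Lp Lq; split; [exact: LD|move=> Phi CP].
have LP := C0_Linfty CP.
apply: compact_op_add (Hp Phi CP) (Hq Phi CP) => u Lu.
  by split; exact: L2_commutator.
have LPu : L2 (multB Phi u) by exact: L2_Linfty.
apply: filterS2 (psdoA_symD Lp Lq LPu) (psdoA_symD Lp Lq Lu) => x.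
have E (f a b c d s t : C) : a = b + c -> d = s + t -> a - f * d = (b - f * s) + (c - f * t).
  by move=> -> ->; ring.
exact: E.
Qed.

Lemma algA_Z (c : C) psi : algA psi -> algA (fun xi => c * psi xi).
Proof.
move=> [Lq Hq]; have Lc := LinftyM (Linfty_cst c) Lq; split; [exact: Lc|move=> Phi CP].
have LP := C0_Linfty CP.
apply: (@compact_op_comp (normc c) _ (fun u x => c * u x) _ _ _ _ _ (Hq Phi CP)) => [u Lu||u v Lu Lv|u Lu].
- split; [exact: L2_commutator|exact: L2Z|exact: L2_commutator].
- exact: normc_ge0.
- by under eq_fun do rewrite -mulrBr; rewrite nrmZ//; exact: L2B.
have LPu : L2 (multB Phi u) by exact: L2_Linfty.
apply: filterS2 (psdoA_symZ c Lq LPu) (psdoA_symZ c Lq Lu) => x.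
have E (f a b d s : C) : a = c * b -> d = c * s -> a - f * d = c * (b - f * s).
  by move=> -> ->; ring.
exact: E.
Qed.

(** The commutator with the identity vanishes almost everywhere. This symbol witnesses that the
    functional built from an ultrafilter is not zero. *)
Lemma algA_1 : algA (fun _ : Rn => 1 : C).
Proof.
have L1 : Linfty (fun _ : Rn => 1 : C) by exact: Linfty_cst.
split; [exact: L1|move=> Phi CP]; have LP := C0_Linfty CP.
apply/compact_opP => [u Lu|u_ Lu _]; first exact: L2_commutator.
exists id => //; exists (fun=> 0); first exact: L20.
apply: (@squeeze0 _ _ (fun=> 0)) => [k|]; last exact: cvg_cst.
rewrite nrm_ge0/=.
have LC := L2_commutator L1 LP (Lu k).
have m0 : cmeas (fun _ : Rn => 0 : C) by exact: cmeas_cst.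
rewrite (ae_nrm m0 (L2_meas (L2B LC L20))) /nrm ?nrm20 ?sqrtr0//.
have LPu : L2 (multB Phi (u_ k)) by exact: L2_Linfty.
apply: filterS2 (psdoA_sym1 LPu) (psdoA_sym1 (Lu k)) => x.
have E (f a b c : C) : a = f * b -> c = b -> 0 = a - f * c - 0.
  by move=> -> ->; ring.
exact: E.
Qed.

(** The commutator of a product is [A_phi [A_psi, B] + [A_phi, B] A_psi]: one compact operator
    followed by a bounded one, and one preceded by a bounded one. *)
Lemma algA_M phi psi : algA phi -> algA psi -> algA (phi \* psi).
Proof.
move=> [Lp Hp] [Lq Hq]; have LM := LinftyM Lp Lq; split; [exact: LM|move=> Phi CP].
have LP := C0_Linfty CP.
have [M [M0 HM]] := Linfty_bound Lp; have [M' [M'0 HM']] := Linfty_bound Lq.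
pose S1 u := psdoA phi (commutator (psdoA psi) (multB Phi) u).
pose S2 u := commutator (psdoA phi) (multB Phi) (psdoA psi u).
have LS1 u : L2 u -> L2 (S1 u) by move=> Lu; apply: L2_psdoA => //; exact: L2_commutator.
have LS2 u : L2 u -> L2 (S2 u) by move=> Lu; apply: L2_commutator => //; exact: L2_psdoA.
apply: (@compact_op_add _ S1 S2) => [u Lu|u Lu||].
- split; [exact: L2_commutator|exact: LS1|exact: LS2].
- have LPu : L2 (multB Phi u) by exact: L2_Linfty.
  have LA := L2_psdoA Lq Lu; have LPA := L2_Linfty LP LA; have LAP := L2_psdoA Lq LPu.
  apply: filterS3 (psdoA_symM Lp Lq LPu) (psdoA_symM Lp Lq Lu) (psdoAB Lp LAP LPA) => x.
  have E (f a b c d s t : C) : a = b -> c = d -> s = b - t -> a - f * c = s + (t - f * d).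
    by move=> -> -> ->; ring.
  exact: E.
- apply: (@compact_op_comp M S1 (psdoA phi) (commutator (psdoA psi) (multB Phi))) => [u Lu||u v Lu Lv|u Lu|].
  + split; [exact: LS1|exact: L2_psdoA|exact: L2_commutator].
  + exact: M0.
  + have LA := L2_psdoA Lp Lu; have LA' := L2_psdoA Lp Lv.
    have L12 := L2B Lu Lv; have LA2 := L2_psdoA Lp L12.
    by rewrite (ae_nrm (L2_meas LA2) (L2_meas (L2B LA LA')) (psdoAB Lp Lu Lv)); exact: psdoA_le.
  + exact: aeW.
  + exact: Hq.
- apply: (@compact_op_precomp M' S2 (commutator (psdoA phi) (multB Phi)) (psdoA psi)) => [u Lu|u Lu||u Lu|].
  + split; [exact: LS2|exact: L2_commutator|exact: L2_psdoA].
  + exact: psdoA_le.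
  + exact: M'0.
  + exact: aeW.
  + exact: Hp.
Qed.

End pseudo_differential.

(** * Weakly null sequences *)

Section weak_convergence.
Context {R : realType} {n : nat}.
Local Notation "x ^*" := (conjc x) : ring_scope.
Local Notation Rn := 'rV[R]_n.
Local Notation C := R[i].
Local Notation mu := (@leb R n).
Implicit Types (u v w f g h psi phi Phi : Rn -> C) (x y xi : Rn) (e : R).

Definition wnull (f_ : nat -> Rn -> C) := forall g, L2 g ->
  normc (ip (f_ k) g) @[k --> \oo] --> (0 : R).

Lemma cvg0_bounded (a : nat -> R) : a k @[k --> \oo] --> (0 : R) ->
  exists B, forall k, a k <= B.
Proof.
move=> ca; have /cvg_seq_bounded[M [_ HM]] : cvgn a by apply/cvg_ex; exists 0.
exists (M + 1) => k; apply: le_trans (ler_norm _) _.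
by apply: (HM (M + 1)) => //; rewrite ltrDl.
Qed.

(** The numbers [a + b] and [a - b] differ by [2 b], so they cannot both have modulus less than
    [|b|]. *)
Lemma normc_hump (a b : C) : exists s : bool, normc b <= normc (a + (-1) ^+ s * b).
Proof.
case: (leP (normc b) (normc (a + b))) => H; first by exists false; rewrite expr0 mul1r.
exists true; rewrite expr1 mulN1r leNgt; apply/negP => H2.
have := ltrD H H2.
have := le_normcD (a + b) (- (a - b)); rewrite normcN.
rewrite (_ : a + b + - (a - b) = (2%:R : R)%:C * b); last first.
  by rewrite rmorph_nat; ring.
rewrite Normc.normcM normc_real ger0_norm// => H3 H4.
by move: H3 H4; lra.
Qed.

(* Gliding hump: were the norms unbounded, a suitable sum of the [+- 4^-j f_k / |f_k|], one index
   [k] for each [j], would have unbounded scalar products with the [f_k]. *)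
Lemma weak_bounded (f_ : nat -> Rn -> C) : (forall k, L2 (f_ k)) -> wnull f_ ->
  exists M, 0 <= M /\ forall k, nrm (f_ k) <= M.
Proof.
move=> Lf wf; apply: contrapT => unb.
have big (B : R) : exists k, B < nrm (f_ k).
  apply: contrapT => nB; apply: unb; exists `|B|; split => // k.
  rewrite leNgt; apply/negP => kB; apply: nB; exists k.
  by apply: le_lt_trans kB; exact: ler_norm.
have step (p : nat * (Rn -> C)) : exists g, L2 p.2 ->
    [/\ L2 g, nrm (fun x => g x - p.2 x) <= (4 ^+ p.1)^-1 &
    exists2 k, 2 * 4 ^+ p.1 * p.1%:R < nrm (f_ k) &
      nrm (f_ k) / 4 ^+ p.1 <= normc (ip (f_ k) g)].
  case: p => j g; rewrite [(j, g).1]/= [(j, g).2]/=.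
  have j4 : 0 < 4 ^+ j :> R by rewrite exprn_gt0.
  have [k Hk] := big (2 * 4 ^+ j * j%:R).
  have fk0 : 0 < nrm (f_ k) by apply: le_lt_trans Hk; rewrite !mulr_ge0// ltW.
  have [s Hs] := normc_hump (ip (f_ k) g) ((nrm (f_ k) / 4 ^+ j)%:C).
  (* Adding [c * f_ k] moves [g] by [4^-j] in norm and its product with [f_ k] by [nrm (f_ k) / 4^j]
     in modulus; the sign excludes cancellation with the humps already present. *)
  pose c : C := (-1) ^+ s * ((4 ^+ j * nrm (f_ k))^-1)%:C.
  have nc : normc c = (4 ^+ j * nrm (f_ k))^-1.
    rewrite Normc.normcM normc_real ger0_norm ?invr_ge0 ?mulr_ge0 ?ltW//.
    rewrite (_ : normc _ = 1) ?mul1r//.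
    by case: (s); rewrite ?expr0 ?Normc.normc1// expr1 normcN Normc.normc1.
  have cs : c^* = c.
    rewrite /c conjcM conjc_real; congr (_ * _).
    by case: (s); rewrite ?expr0 ?expr1; apply: complex_ext; rewrite /= ?oppr0.
  have Lc := L2Z c (Lf k).
  exists (fun x => g x + c * f_ k x) => Lg; split; first exact: L2D.
    rewrite (_ : (fun x => _) = fun x => c * f_ k x); last by apply/funext => x; ring.
    by rewrite nrmZ// nc invfM -mulrA mulVf ?gt_eqF// mulr1.
  exists k => //.
  rewrite ipDr// ipZr// ip_nrm2 cs.
  rewrite normc_real ger0_norm in Hs; last by rewrite divr_ge0 ?ltW.
  apply: le_trans Hs _; rewrite le_eqVlt; apply/orP; left; apply/eqP.
  congr (normc (_ + _)); rewrite /c -mulrA; congr (_ * _).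
  rewrite -rmorphM -sqr_nrm; congr _%:C.
  by field; rewrite !gt_eqF.
have [F HF] := choice step.
pose g := fix g j := if j is i.+1 then F (i, g i) else (fun=> 0) : Rn -> C.
have Lg j : L2 (g j).
  by elim: j => [|j IH]; [exact: L20|have [] := HF (j, g j) IH].
have [l Ll Hl] : exists2 l, L2 l & forall k, nrm (fun x => g k x - l x) <= 2 / 4 ^+ k.
  by apply: L2_complete => // j; have [] := HF (j, g j) (Lg j).
have [B HB] := cvg0_bounded (wf l Ll).
pose j := (Num.truncn B).+1.
have Bj : B < j%:R := Num.Theory.truncnS_gt B.
have [_ _ [k Hk1 Hk2]] := HF (j, g j) (Lg j).
rewrite [(j, g j).1]/= in Hk1 Hk2.
have j4 : 0 < 4 ^+ j :> R by rewrite exprn_gt0.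
have := HB k; apply/negP; rewrite -ltNge; apply: lt_le_trans Bj _.
(* The later humps amount to at most [2 / 4^(j+1)] in norm, which costs half of [nrm (f_ k) / 4^j];
   the other half exceeds [j], and so [B], by the threshold [2 * 4^j * j] imposed on
   [nrm (f_ k)]. *)
have Hd := Hl j.+1.
have CS := cauchy_schwarz_nrm (Lf k) (L2B (Lg j.+1) Ll).
rewrite ipBr// in CS.
have T := le_normcD (ip (f_ k) (g j.+1) - ip (f_ k) l) (ip (f_ k) l).
rewrite subrK in T.
have {}CS : normc (ip (f_ k) (g j.+1) - ip (f_ k) l) <= nrm (f_ k) * (2 / 4 ^+ j.+1).
  by apply: le_trans CS _; rewrite ler_wpM2l// nrm_ge0.
have E : nrm (f_ k) * (2 / 4 ^+ j.+1) = nrm (f_ k) / 4 ^+ j / 2.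
  by rewrite exprS; field; rewrite gt_eqF.
rewrite E in CS.
have J : j%:R < nrm (f_ k) / 4 ^+ j / 2.
  rewrite ltr_pdivlMr// ltr_pdivlMr//.
  by rewrite (_ : j%:R * 2 * 4 ^+ j = 2 * 4 ^+ j * j%:R)//; ring.
have {}Hk2 : nrm (f_ k) / 4 ^+ j <= normc (ip (f_ k) (g j.+1)) by exact: Hk2.
by move: Hk2 T CS J; move: (nrm _ / _) (normc _) (normc _) (normc _) => *; lra.
Qed.

(** Otherwise some subsequence keeps its norms above a positive [e]. A strongly convergent
    subsequence of it has a limit [v] that is also the weak limit, so [ip v v = 0], contradicting
    the convergence of the norms. *)
Lemma weak_precompact_cvg0 (f_ : nat -> Rn -> C) : (forall k, L2 (f_ k)) -> wnull f_ ->
  (forall s : nat -> nat, {homo s : i j / (i < j)%N} ->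
    exists2 t : nat -> nat, {homo t : i j / (i < j)%N} &
    exists2 v, L2 v & nrm (fun x => f_ (s (t k)) x - v x) @[k --> \oo] --> (0 : R)) ->
  nrm (f_ k) @[k --> \oo] --> (0 : R).
Proof.
move=> Lf wf H; apply: contrapT => ncvg.
have [e e0 He] : exists2 e, 0 < e & forall K, exists k, (K <= k)%N /\ e <= nrm (f_ k).
  apply: contrapT => nE; apply: ncvg; apply/cvg0P => e e0; apply: contrapT => nK.
  apply: nE; exists e => // K; apply: contrapT => nk; apply: nK; exists K => k Kk.
  rewrite ger0_norm ?nrm_ge0// ltNge; apply/negP => ek; apply: nk; by exists k.
have [a Ha] := choice He.
pose s := fix s j := if j is i.+1 then a (s i).+1 else a 0%N.
have ss j : (s j < s j.+1)%N by have [] := Ha (s j).+1.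
have Hs : {homo s : i j / (i < j)%N} by exact: homo_ltn (@ltn_trans) ss.
have se j : e <= nrm (f_ (s j)) by case: j => [|j]; [exact: (Ha 0%N).2|exact: (Ha _).2].
have [t Ht [v Lv cv]] := H s Hs.
have Hst : {homo (s \o t) : i j / (i < j)%N} by move=> i j ij; apply: Hs; exact: Ht.
have Lst k : L2 (f_ (s (t k))) by [].
have cv2 : L2_cvg setT (fun k => f_ (s (t k))) v by apply/L2_cvg_nrmP.
have c1 := ip_cvg Lst Lv (fun=> Lv) Lv cv2 (L2_cvg_cst Lv).
have c2 : normc (ip (f_ (s (t k))) v - 0) @[k --> \oo] --> (0 : R).
  under eq_fun do rewrite subr0; exact: (cvg_subseq Hst (wf v Lv)).
have : ip v v = 0 by apply: (cvg_normc_eq _ c1 c2).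
rewrite ip_nrm2 => -[v0].
have /cvgnP/(_ e e0)[K HK] := nrm_cvg Lst Lv cv2.
have := HK K (leqnn K); rewrite [nrm v]/nrm v0 sqrtr0 subr0 ger0_norm ?nrm_ge0//.
by rewrite ltNge se.
Qed.

Lemma wnullD (f_ g_ : nat -> Rn -> C) : (forall k, L2 (f_ k)) -> (forall k, L2 (g_ k)) ->
  wnull f_ -> wnull g_ -> wnull (fun k x => f_ k x + g_ k x).
Proof.
move=> Lf Lg wf wg h Lh.
apply: (@squeeze0 _ _ (fun k => normc (ip (f_ k) h) + normc (ip (g_ k) h))) => [k|].
  by rewrite normc_ge0 (ipDl (Lf k) (Lg k) Lh) andTb; exact: le_normcD.
by rewrite -(addr0 0); apply: cvgD; [exact: wf|exact: wg].
Qed.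

Lemma wnull_mul psi (f_ : nat -> Rn -> C) : Linfty psi -> (forall k, L2 (f_ k)) -> wnull f_ ->
  wnull (fun k x => psi x * f_ k x).
Proof.
move=> Lp Lf wf g Lg; have := wf _ (L2_Linfty (Linfty_conj Lp) Lg).
apply: squeeze0 => k; rewrite normc_ge0 andTb.
rewrite /ip [X in normc (cI mu X) <= _](_ : _ = fun x => f_ k x * ((psi x)^* * g x)^*)//.
by apply/funext => x; rewrite conjcM conjcK; ring.
Qed.

Lemma wnullZ (c : C) (f_ : nat -> Rn -> C) : (forall k, L2 (f_ k)) -> wnull f_ ->
  wnull (fun k x => c * f_ k x).
Proof. by move=> Lf wf; apply: wnull_mul => //; exact: Linfty_cst. Qed.

Lemma wnullB (f_ g_ : nat -> Rn -> C) : (forall k, L2 (f_ k)) -> (forall k, L2 (g_ k)) ->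
  wnull f_ -> wnull g_ -> wnull (fun k x => f_ k x - g_ k x).
Proof.
move=> Lf Lg wf wg; have := wnullD Lf (fun k => L2Z (-1) (Lg k)) wf (wnullZ (-1) Lg wg).
by congr wnull; apply/funext => k; apply/funext => x; ring.
Qed.

Lemma wnull_sum (I : Type) (r : seq I) (F : I -> nat -> Rn -> C) :
  (forall i k, L2 (F i k)) -> (forall i, wnull (F i)) ->
  wnull (fun k x => \sum_(i <- r) F i k x).
Proof.
move=> LF wF; elim: r => [|i r IH].
  move=> g Lg; rewrite [X in X @ _](_ : _ = fun=> 0); first exact: cvg_cst.
  apply/funext => k; rewrite /ip [X in cI mu X](_ : _ = fun=> 0) ?cI0 ?Normc.normc0//.
  by apply/funext => x; rewrite big_nil mul0r.
have := wnullD (LF i) (fun k => L2_sum r xpredT (fun i => LF i k)) (wF i) IH.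
by congr wnull; apply/funext => k; apply/funext => x; rewrite big_cons.
Qed.

Lemma wnull_psdoA psi (f_ : nat -> Rn -> C) : Linfty psi -> (forall k, L2 (f_ k)) -> wnull f_ ->
  wnull (fun k => psdoA psi (f_ k)).
Proof.
move=> Lp Lf wf g Lg; have := wf _ (L2_psdoA (Linfty_conj Lp) Lg).
by apply: squeeze0 => k; rewrite normc_ge0 (ip_psdoA Lp (Lf k) Lg) lexx.
Qed.

(** A compact operator improves weak convergence to convergence in norm. Compactness here concerns
    bounded sequences, whence the recourse to [weak_bounded]. *)
Lemma commutator_cvg0 psi Phi (f_ : nat -> Rn -> C) : algA psi -> C0 setT Phi ->
  (forall k, L2 (f_ k)) -> wnull f_ ->
  nrm (commutator (psdoA psi) (multB Phi) (f_ k)) @[k --> \oo] --> (0 : R).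
Proof.
move=> [Lp Hp] CP Lf wf; have LP := C0_Linfty CP.
have LC u : L2 u -> L2 (commutator (psdoA psi) (multB Phi) u) by exact: L2_commutator.
apply: weak_precompact_cvg0 => [k||s Hs]; first exact: LC.
  apply: wnullB => [k|k||].
  - by apply: L2_psdoA => //; exact: L2_Linfty.
  - by apply: L2_Linfty => //; exact: L2_psdoA.
  - by apply: wnull_psdoA => // [k|]; [exact: L2_Linfty|exact: wnull_mul].
  - by apply: wnull_mul => // [k|]; [exact: L2_psdoA|exact: wnull_psdoA].
have [M [_ HM]] := weak_bounded Lf wf.
exact: ((compact_opP LC).1 (Hp Phi CP) (f_ \o s) (fun k => Lf _) (ex_intro _ M (fun k => HM _))).
Qed.

End weak_convergence.

(** * The symbol inequality *)

Section filter_limits.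
Local Notation "x ^*" := (conjc x) : ring_scope.
Context {R : realType} {T : Type} (U : set_system T).
Context {UU : UltraFilter U}.
Local Notation C := R[i].
Implicit Types (f g : T -> C) (z w : C).

Definition clim f z :=
  ((Re (f t) @[t --> U] --> Re z) * (Im (f t) @[t --> U] --> Im z))%type.

Lemma climP f z : clim f z <-> forall e : R, 0 < e -> U [set t | normc (f t - z) < e].
Proof.
split=> [[cR cI] e e0|H].
  have e2 : 0 < e / 2 by rewrite divr_gt0.
  move: cR => /cvgrPdist_lt/(_ _ e2) cR; move: cI => /cvgrPdist_lt/(_ _ e2) cI.
  apply: filterS2 cR cI => t; rewrite distrC -cReB (distrC (Im z)) -cImB /= => a b.
  by apply: le_lt_trans (normc_le _) _; rewrite (splitr e) ltrD.
split; apply/cvgrPdist_lt => e /H; apply: filterS => t /=; apply: le_lt_trans.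
  by rewrite distrC -cReB normc_Re.
by rewrite distrC -cImB normc_Im.
Qed.

Lemma clim_unique f z w : clim f z -> clim f w -> z = w.
Proof.
move=> [a b] [c d]; apply: complex_ext.
  exact: cvg_unique a c.
exact: cvg_unique b d.
Qed.

Lemma climD f g z w : clim f z -> clim g w -> clim (fun t => f t + g t) (z + w).
Proof.
move=> [a b] [c d]; split.
  by under eq_fun do rewrite cReD; rewrite cReD; exact: cvgD.
by under eq_fun do rewrite cImD; rewrite cImD; exact: cvgD.
Qed.

Lemma climM f g z w : clim f z -> clim g w -> clim (fun t => f t * g t) (z * w).
Proof.
move=> [a b] [c d]; split.
  by under eq_fun do rewrite cReM; rewrite cReM; apply: cvgB; exact: cvgM.
by under eq_fun do rewrite cImM; rewrite cImM; apply: cvgD; exact: cvgM.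
Qed.

Lemma clim_conj f z : clim f z -> clim (fun t => (f t)^*) z^*.
Proof.
move=> [a b]; split.
  by under eq_fun do rewrite cReC; rewrite cReC.
by under eq_fun do rewrite cImC; rewrite cImC; exact: cvgN.
Qed.

Lemma clim_cst z : clim (fun=> z) z.
Proof. by split; exact: cvg_cst. Qed.

Lemma clim_sum (I : Type) (r : seq I) (F : I -> T -> C) (Z : I -> C) :
  (forall i, clim (F i) (Z i)) ->
  clim (fun t => \sum_(i <- r) F i t) (\sum_(i <- r) Z i).
Proof.
move=> H; elim: r => [|i r IH].
  rewrite big_nil; under eq_fun do rewrite big_nil; exact: clim_cst.
rewrite big_cons; under eq_fun do rewrite big_cons; exact: climD.
Qed.

(** The values eventually lie in a compact segment, hence have a cluster point; along an ultrafilter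
    a cluster point is a limit. *)
Lemma clim_exists f (M : R) : U [set t | normc (f t) <= M] -> exists z, clim f z.
Proof.
move=> UM.
have lim (h : T -> R) : U [set t | `|h t| <= M] -> exists l : R, h t @[t --> U] --> l.
  move=> Uh.
  have pF : ProperFilter (h t @[t --> U]) by exact: fmap_proper_filter.
  have := @segment_compact R (- M) M _ pF.
  case; first by change (U (h @^-1` `[- M, M])); apply: filterS Uh => t /=; rewrite in_itv/= -ler_norml.
  move=> l [_ cl]; exists l => B nB; rewrite /nbhs/=.
  have [//|Un] := in_ultra_setVsetC (h @^-1` B) UU.
  have [y [nBy By]] := cl (~` B) B Un nB; by [].
have [|a Ha] := lim (fun t => Re (f t)).
  by apply: filterS UM => t; apply: le_trans; exact: normc_Re.
have [|b Hb] := lim (fun t => Im (f t)).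
  by apply: filterS UM => t; apply: le_trans; exact: normc_Im.
by exists (a +i* b).
Qed.

End filter_limits.

Section hermitian_forms.
Local Notation "x ^*" := (conjc x) : ring_scope.
Context {R : realType} {N : nat}.
Local Notation C := R[i].
Implicit Types (q : 'I_N -> 'I_N -> C) (l : 'I_N -> C).

Definition qform q l : C := \sum_a \sum_b q a b * l a * (l b)^*.

Definition sqn l : R := \sum_a normc (l a) ^+ 2.

Definition qnorm q : R := \sum_a \sum_b normc (q a b).

Lemma sqn_ge0 l : 0 <= sqn l.
Proof. by apply: sumr_ge0 => i _; exact: sqr_ge0. Qed.

Lemma qnorm_ge0 q : 0 <= qnorm q.
Proof. by apply: sumr_ge0 => i _; apply: sumr_ge0 => j _; exact: normc_ge0. Qed.

Lemma normc_sum (I : Type) (r : seq I) (F : I -> C) :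
  normc (\sum_(i <- r) F i) <= \sum_(i <- r) normc (F i).
Proof.
elim: r => [|i r IH]; first by rewrite !big_nil Normc.normc0.
by rewrite !big_cons; apply: le_trans (le_normcD _ _) _; rewrite lerD2l.
Qed.

Lemma normc_sqr_le_sqn l a : normc (l a) ^+ 2 <= sqn l.
Proof. by rewrite /sqn (bigD1 a)//= lerDl sumr_ge0// => i _; exact: sqr_ge0. Qed.

Lemma qform_bound q l : normc (qform q l) <= qnorm q * sqn l.
Proof.
apply: le_trans (normc_sum _ _) _; rewrite mulr_suml; apply: ler_sum => a _.
apply: le_trans (normc_sum _ _) _; rewrite mulr_suml; apply: ler_sum => b _.
rewrite -mulrA Normc.normcM ler_wpM2l ?normc_ge0//.
apply: le_trans (normcM_le _ _) _; rewrite normc_conj ler_pdivrMr//.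
by have := normc_sqr_le_sqn l a; have := normc_sqr_le_sqn l b; lra.
Qed.

Lemma qformZ q (t : R) l : qform q (fun a => t%:C * l a) = (t ^+ 2)%:C * qform q l.
Proof.
rewrite /qform mulr_sumr; apply: eq_bigr => a _.
rewrite mulr_sumr; apply: eq_bigr => b _.
by rewrite conjcM conjc_real rmorphXn/=; ring.
Qed.

Lemma sqnZ (t : R) l : sqn (fun a => t%:C * l a) = t ^+ 2 * sqn l.
Proof.
rewrite /sqn mulr_sumr; apply: eq_bigr => a _.
by rewrite Normc.normcM normc_real exprMn real_normK// num_real.
Qed.

End hermitian_forms.

Section symbol_inequality.
Local Notation "x ^*" := (conjc x) : ring_scope.
Context {R : realType} {n N m M : nat}.
Local Notation Rn := 'rV[R]_n.
Local Notation C := R[i].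
Local Notation mu := (@leb R n).
Variables (p : 'I_m -> 'I_N -> 'I_M -> Rn -> C) (a : 'I_m -> 'I_N -> 'I_M -> C).
Variables (q : 'I_N -> 'I_N -> C) (delta : R).

Definition symb s (xi : Rn) (l : 'I_N -> C) : C :=
  \sum_al \sum_k a s al k * p s al k xi * l al.

Definition symb2 xi l : R := \sum_s normc (symb s xi l) ^+ 2.

Hypotheses (delta0 : 0 < delta) (pA : forall s al k, algA (p s al k)).
Hypothesis q_pos : forall (l : 'I_N -> C) eta, spectrum eta ->
  (forall s, \sum_al \sum_k a s al k * gelfand (p s al k) eta * l al = 0) ->
  0 <= Re (qform q l).

Lemma symb2_ge0 xi l : 0 <= symb2 xi l.
Proof. by apply: sumr_ge0 => s _; exact: sqr_ge0. Qed.

Lemma symb2Z (t : R) xi l : symb2 xi (fun al => t%:C * l al) = t ^+ 2 * symb2 xi l.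
Proof.
rewrite /symb2 mulr_sumr; apply: eq_bigr => s _.
rewrite (_ : symb s xi (fun al => t%:C * l al) = t%:C * symb s xi l).
  by rewrite Normc.normcM normc_real exprMn real_normK// num_real.
rewrite /symb mulr_sumr; apply: eq_bigr => al _.
by rewrite mulr_sumr; apply: eq_bigr => k _; ring.
Qed.

(** The pairs violating the inequality, normalized to the unit sphere. Since [k] is both the
    frequency threshold and the weight of the constraints, these sets decrease with [k]. *)
Let bad (k : nat) (t : Rn * ('I_N -> C)) := [/\ sqn t.2 = 1, k%:R < enorm t.1 &
  Re (qform q t.2) < - delta - k%:R * symb2 t.1 t.2].

Let bad_le k k' t : (k <= k')%N -> bad k' t -> bad k t.
Proof.
move=> kk [s1 e1 b1]; split => //; first by apply: le_lt_trans e1; rewrite ler_nat.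
apply: lt_le_trans b1 _; rewrite lerD2l lerN2 ler_wpM2r ?symb2_ge0//.
by rewrite ler_nat.
Qed.

(** The exceptional null set of frequencies must serve all vectors [l] at once; the quantifier over
    [l] therefore stands inside. *)
Let G : set_system (Rn * ('I_N -> C)) := fun A =>
  exists k : nat, {ae mu, forall xi, forall l, bad k (xi, l) -> A (xi, l)}.

Let G_filter : (forall k, ~ {ae mu, forall xi, forall l, ~ bad k (xi, l)}) -> ProperFilter G.
Proof.
move=> H; split; first by move=> [k Hk]; apply: (H k).
split; first by exists 0%N; exact: aeW.
- move=> A B [k Hk] [k' Hk']; exists (maxn k k').
  apply: filterS2 Hk Hk' => xi Ha Hb l bl; split.
    by apply: Ha; apply: bad_le bl; exact: leq_maxl.
  by apply: Hb; apply: bad_le bl; exact: leq_maxr.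
- by move=> A B AB [k Hk]; exists k; apply: filterS Hk => xi Ha l /Ha /AB.
Qed.

Section ultra.
Variable U : set_system (Rn * ('I_N -> C)).
Hypotheses (UU : UltraFilter U) (GU : G `<=` U).

Let L (f : Rn * ('I_N -> C) -> C) : C := xget 0 [set z | clim U f z].

Let LP f (B : R) : U [set t | normc (f t) <= B] -> clim U f (L f).
Proof.
by move=> /clim_exists[z Hz]; rewrite /L; case: xgetP => [w _ //|/(_ z)].
Qed.

Let U_ae (P : set Rn) : {ae mu, forall xi, P xi} -> U [set t | P t.1].
Proof. by move=> H; apply: GU; exists 0%N; apply: filterS H => xi Pxi l _. Qed.

Let U_bad k : U [set t | bad k t].
Proof. by apply: GU; exists k; exact: aeW. Qed.

Let U_enorm (r : R) : U [set t | r < enorm t.1].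
Proof.
apply: filterS (U_bad (Num.truncn r).+1) => t [_ + _]; apply: lt_trans.
exact: Num.Theory.truncnS_gt.
Qed.

(** A functional on A / A_0 takes classes as arguments, so a representative is picked; [etaP] shows
    that the limit does not depend on it. *)
Let eta (S : set (Rn -> C)) : C := L (fun t => xget (fun=> 0) S t.1).

(** Two representatives differ by an element of A_0, which off a null set is small for large
    frequencies. The ultrafilter contains the complements of null sets and all sets [r < enorm xi],
    so the difference tends to [0] along it. *)
Let etaP psi : algA psi -> clim U (fun t => psi t.1) (eta (classA psi)).
Proof.
move=> Ap; rewrite /eta; set g := xget _ _.
have [Ag [mz Ig]] : classA psi g.
  rewrite /g; case: xgetP => [w _ //|/(_ psi)[]]; split => //; split.
    by have [[mp _] _] := Ap; split; [exact: cmeasB|exists 0; apply: aeW => xi; rewrite /= subrr Normc.normc0].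
  by move=> e e0; exists 0; apply: aeW => xi _; rewrite /= subrr Normc.normc0.
have [B [_ HB]] := Linfty_bound Ag.1.
have cg := LP (U_ae HB).
have c0 : clim U (fun t => g t.1 - psi t.1) 0.
  apply/climP => e /Ig[r Hr]; apply: filterS2 (U_ae Hr) (U_enorm r) => t H /H /=.
  by rewrite subr0.
rewrite (_ : (fun t => psi t.1) = fun t => g t.1 + -1 * (g t.1 - psi t.1)); last first.
  by apply/funext => t; ring.
rewrite -[L _]addr0 -(mulr0 (-1)).
by apply: climD cg _; apply: climM c0; exact: clim_cst.
Qed.

Let eta_character : character eta.
Proof.
split.
- move=> phi psi Ap Aq; apply: clim_unique (etaP (algA_D Ap Aq)) _.
  exact: climD (etaP Ap) (etaP Aq).
- move=> c psi Ap; apply: clim_unique (etaP (algA_Z c Ap)) _.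
  exact: climM (clim_cst c) (etaP Ap).
- move=> phi psi Ap Aq; apply: clim_unique (etaP (algA_M Ap Aq)) _.
  exact: climM (etaP Ap) (etaP Aq).
- exists (fun=> 1); first exact: algA_1.
  have -> : eta (classA (fun=> 1)) = 1 by apply: clim_unique (etaP algA_1) (clim_cst 1).
  exact: oner_neq0.
Qed.

(** The unit vectors have a limit [l], and the symbols have limits given by [eta]. On the [k]-th
    exceptional set the form is at least [- qnorm q], so [k * symb2] stays below [qnorm q] and the
    constraints vanish in the limit: positivity applies to [l], although the form stays below
    [- delta]. *)
Lemma bad_ultrafilter_absurd : False.
Proof.
have Ul al : U [set t | normc (t.2 al) <= 1].
  apply: filterS (U_bad 0) => t [s1 _ _] /=.
  by rewrite -(@ler_sqr _ _ 1) ?nnegrE ?normc_ge0// expr1n -s1; exact: normc_sqr_le_sqn.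
pose l al := L (fun t => t.2 al).
have cl al : clim U (fun t => t.2 al) (l al) by exact: (LP (Ul al)).
have cs s : clim U (fun t => symb s t.1 t.2)
    (\sum_al \sum_k a s al k * gelfand (p s al k) eta * l al).
  apply: clim_sum => al; apply: clim_sum => k; apply: climM (cl al).
  exact: climM (clim_cst _) (etaP (pA s al k)).
have cs0 s : clim U (fun t => symb s t.1 t.2) 0.
  apply/climP => e e0.
  have e2 : 0 < e ^+ 2 by rewrite exprn_gt0.
  (* Chosen so that [qnorm q < k e^2]; together with [k * symb2 < qnorm q] this gives
     [symb2 < e^2]. *)
  pose k := (Num.truncn (qnorm q / e ^+ 2)).+1.
  have kB : qnorm q / e ^+ 2 < k%:R := Num.Theory.truncnS_gt _.
  apply: filterS (U_bad k) => t [s1 _ b1] /=; rewrite subr0.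
  rewrite -ltr_sqr ?nnegrE ?normc_ge0 ?(ltW e0)//.
  have : normc (symb s t.1 t.2) ^+ 2 <= symb2 t.1 t.2.
    by rewrite /symb2 (bigD1 s)//= lerDl sumr_ge0// => i _; exact: sqr_ge0.
  move=> /le_lt_trans; apply.
  have := qform_bound q t.2; rewrite s1 mulr1 => Q1.
  have Q2 := normc_Re (qform q t.2); rewrite ler_norml in Q2; case/andP: Q2 => Q2 _.
  move: kB; rewrite ltr_pdivrMr// => kB.
  have k0 : 0 < k%:R :> R by rewrite ltr0n.
  rewrite -(ltr_pM2l k0); move: delta0 b1 Q1 Q2 kB; move: (k%:R * _) (k%:R * _) => x y; lra.
have cq : clim U (fun t => qform q t.2) (qform q l).
  apply: clim_sum => al; apply: clim_sum => be.
  apply: climM (clim_conj (cl be)); exact: climM (clim_cst _) (cl al).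
have : 0 <= Re (qform q l).
  by apply: (q_pos eta_character) => s; exact: clim_unique (cs s) (cs0 s).
apply/negP; rewrite -ltNge.
have /climP/(_ _ delta0) H := cq.
have /filter_ex[t [/= H1 [s1 _ b1]]] : U ([set t | normc (qform q t.2 - qform q l) < delta] `&` [set t | bad 0 t]).
  by apply: filterI.
have := normc_Re (qform q t.2 - qform q l); rewrite cReB ler_norml mul0r subr0 in b1 *.
by case/andP => + _; move: H1 b1; lra.
Qed.

End ultra.

Lemma symbol_inequality : exists k : nat, {ae mu, forall xi, k%:R < enorm xi ->
  forall l : 'I_N -> C, - delta * sqn l - k%:R * symb2 xi l <= Re (qform q l)}.
Proof.
apply: contrapT => H.
have [k|U [UU GU]] := ultraFilterLemma (G_filter _); last exact: (bad_ultrafilter_absurd UU GU).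
move=> Hk; apply: H; exists k; apply: filterS Hk => xi Hxi kxi l.
rewrite leNgt; apply/negP => bl.
(* For [l = 0] the form vanishes and the inequality holds. Otherwise both sides are homogeneous of
   degree two, and [l] is scaled to the unit sphere, where [bad] lives. *)
have s0 : 0 < sqn l.
  rewrite lt_neqAle sqn_ge0 andbT eq_sym; apply/negP => /eqP s0.
  have := qform_bound q l; rewrite s0 mulr0 => Q1.
  have := normc_Re (qform q l); rewrite ler_norml => /andP[Q2 _].
  move: bl; rewrite s0 mulr0 sub0r; have := mulr_ge0 (ler0n R k) (symb2_ge0 xi l).
  by move: Q1 Q2; move: (_ * _) => x; lra.
pose t := (Num.sqrt (sqn l))^-1.
have t2 : t ^+ 2 = (sqn l)^-1 by rewrite /t exprVn sqr_sqrtr// ltW.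
apply: (Hxi (fun al => t%:C * l al)); split => //=.
  by rewrite sqnZ t2 mulVf// gt_eqF.
rewrite qformZ symb2Z cReM [Im _]/= mul0r subr0 [Re _%:C]/= t2.
rewrite -(@ltr_pM2l _ (sqn l)^-1) ?invr_gt0// in bl; apply: lt_le_trans bl _.
rewrite le_eqVlt; apply/orP; left; apply/eqP.
by field; rewrite gt_eqF.
Qed.

End symbol_inequality.

(** * Cutoff functions *)

Section bump.
Context {R : realType}.

(* The family [t^-m e^(-1/t)] (extended by [0]) is stable under derivation up to linear
   combinations. *)
Definition efl (m : nat) (t : R) : R :=
  if 0 < t then (t^-1) ^+ m * expR (- t^-1) else 0.

Lemma efl_ge0 m t : 0 <= efl m t.
Proof. by rewrite /efl; case: ifP => // t0; rewrite mulr_ge0 ?expR_ge0// exprn_ge0// invr_ge0 ltW. Qed.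

Lemma efl_gt0 t : 0 < efl 0 t <-> 0 < t.
Proof.
by rewrite /efl expr0 mul1r; case: ifP => [t0|_]; rewrite ?ltxx//; split => // _; exact: expR_gt0.
Qed.

(** From [exp s >= s^(m+1) / (m+1)!] at [s = 1/t]. A bound linear in [t] is enough for the limit [0]
    at the origin. *)
Lemma efl_bound m t : efl m t <= m.+1`!%:R * `|t|.
Proof.
rewrite /efl; case: ifP => [t0|_]; last by rewrite mulr_ge0.
rewrite (gtr0_norm t0).
have s0 : 0 < t^-1 by rewrite invr_gt0.
have H : t^-1 ^+ m.+1 / m.+1`!%:R <= expR t^-1.
  by apply: le_trans (expR_ge1Dxn m (ltW s0)); rewrite lerDr.
rewrite ler_pdivrMr ?ltr0n ?fact_gt0// in H.
rewrite expRN ler_pdivrMr ?expR_gt0// mulrAC mulrC -ler_pdivrMl//.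
by rewrite mulrC -exprSr mulrC.
Qed.

(** The difference quotient of [efl m] at the origin is thus [efl m.+1] itself, which tends to
    [0]. *)
Lemma efl_quot m (h : R) : h^-1 * efl m h = efl m.+1 h.
Proof. by rewrite /efl; case: ifP => _; rewrite ?mulr0// exprS mulrA. Qed.

Lemma is_derive_efl m t :
  is_derive t (1 : R) (efl m) (efl m.+2 t - m%:R * efl m.+1 t).
Proof.
have [t0|t0|<-] := ltgtP 0 t.
- have [tE tE1 tE2] : [/\ efl m t = (t^-1) ^+ m * expR (- t^-1),
      efl m.+1 t = (t^-1) ^+ m.+1 * expR (- t^-1) &
      efl m.+2 t = (t^-1) ^+ m.+2 * expR (- t^-1)] by rewrite /efl t0.
  apply: (@near_eq_is_derive _ _ _ (fun y : R => (y^-1) ^+ m * expR (- y^-1))).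
    near=> y; rewrite /efl; case: ifPn => // /negP; case.
    by near: y; exact: lt_nbhsr.
  have dV : is_derive t (1 : R) (fun y : R => y^-1) (- (t^-1) ^+ 2).
    have tn0 : t != 0 by rewrite gt_eqF.
    have := is_deriveV tn0 (is_derive_id t (1 : R)); rewrite /GRing.scale/= exprVn mulr1.
    exact.
  have dE : is_derive t (1 : R) (fun y : R => expR (- y^-1)) (expR (- t^-1) * (t^-1) ^+ 2).
    have := @is_derive1_comp _ expR (fun y => - y^-1) t _ _ (is_derive_expR _) (is_deriveN dV).
    by rewrite opprK mulrC.
  have dX : is_derive t (1 : R) (fun y : R => (y^-1) ^+ m) (m%:R * (t^-1) ^+ m.-1 * - (t^-1) ^+ 2).
    by have := is_deriveX m dV; rewrite exprfctE.
  apply: (@is_derive_eq _ _ _ _ _ _ _ _ (is_deriveM dX dE)).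
  rewrite tE1 tE2 /GRing.scale/=.
  case: m {tE tE1 tE2 dX} => [|m]; first by rewrite expr0 !mul0r !mulr0 !expr2; ring.
  by rewrite [m.+1.-1]/= !exprS; ring.
- have [tE tE1 tE2] : [/\ efl m t = 0, efl m.+1 t = 0 & efl m.+2 t = 0].
    by rewrite /efl ltNge (ltW t0).
  rewrite tE1 tE2 mulr0 subr0.
  have dc : is_derive t (1 : R) (cst (0 : R)) 0 by exact: is_derive_cst.
  apply: near_eq_is_derive dc.
  near=> y; rewrite /efl; case: ifPn => // y0; suff : y < 0 by rewrite ltNge ltW.
  by near: y; exact: lt_nbhsl.
- have z k : efl k 0 = 0 by rewrite /efl ltxx.
  rewrite !z mulr0 subr0.
  have c0 : (fun h : R => h^-1 *: (efl m (h *: 1 + 0) - efl m 0)) @ 0^' --> (0 : R).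
    rewrite (_ : (fun h => _) = efl m.+1); last first.
      by apply/funext => h; rewrite z subr0 addr0 /GRing.scale/= mulr1 efl_quot.
    apply/cvgrPdist_lt => e e0; near=> h.
    rewrite sub0r normrN ger0_norm ?efl_ge0//; apply: le_lt_trans (efl_bound _ _) _.
    rewrite mulrC -ltr_pdivlMr ?ltr0n ?fact_gt0//.
    near: h; apply: dnbhs0_lt; by rewrite divr_gt0// ltr0n fact_gt0.
  apply: DeriveDef; first by apply/cvg_ex; exists 0.
  by apply/cvg_lim.
Unshelve. all: by end_near. Qed.

Lemma continuous_efl m : continuous (efl m).
Proof. by apply: is_derive1_cts => x; exact: is_derive_efl. Qed.

Context {n : nat}.
Local Notation Rn := 'rV[R]_n.
Implicit Types (x v a b : Rn).

Lemma is_derive_line (f : Rn -> R) x v df :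
  is_derive (0 : R) (1 : R) (fun h : R => f (h *: v + x)) df -> is_derive x v f df.
Proof.
move=> [d1 d2]; apply: DeriveDef; first exact/derivable1P.
rewrite -d2 /derive; set g1 := fun h => h^-1 *: _; set g2 := fun h => h^-1 *: _.
suff -> : g1 = g2 by [].
rewrite /g1 /g2; apply/funext => h /=.
by rewrite addr0 scale0r add0r [_%:A]mulr1.
Qed.

Lemma is_derive_coord (g : R -> R) (i : 'I_n) (c d : R) x v dg :
  is_derive (c * x 0 i + d) (1 : R) g dg ->
  is_derive x v (fun y : Rn => g (c * y 0 i + d)) (c * v 0 i * dg).
Proof.
move=> Hg; apply: is_derive_line.
rewrite (_ : (fun h => _) = fun h => g (c * v 0 i * h + (c * x 0 i + d))); last first.
  by apply/funext => h; congr g; rewrite !mxE; ring.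
by apply: is_derive_affine; rewrite mulr0 add0r.
Qed.

(** A class of continuous functions closed under directional derivatives. Smoothness of its members
    follows by induction on the list of partial derivatives, none of which has to be computed. *)
Inductive sfam : (Rn -> R) -> Prop :=
| sfam_coord (m : nat) (i : 'I_n) (c d : R) : sfam (fun x => efl m (c * x 0 i + d))
| sfam_cst (c : R) : sfam (fun=> c)
| sfam_add f g : sfam f -> sfam g -> sfam (fun x => f x + g x)
| sfam_mul f g : sfam f -> sfam g -> sfam (fun x => f x * g x).

Lemma sfam_derive f : sfam f -> forall v, exists2 g, sfam g & forall x, is_derive x v f (g x).
Proof.
move=> Sf v; elim: Sf => {f} [m i c d|c|f g Sf [f' Sf' Hf] Sg [g' Sg' Hg]|f g Sf [f' Sf' Hf] Sg [g' Sg' Hg]].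
- exists (fun x => c * v 0 i * (efl m.+2 (c * x 0 i + d) + (- m%:R) * efl m.+1 (c * x 0 i + d))).
    do ?[exact: sfam_coord|exact: sfam_cst|apply: sfam_add|apply: sfam_mul].
  by move=> x; apply: is_derive_coord; rewrite mulNr; exact: is_derive_efl.
- by exists (fun=> 0); [exact: sfam_cst|move=> x; exact: is_derive_cst].
- by exists (fun x => f' x + g' x); [exact: sfam_add|move=> x; exact: is_deriveD].
- exists (fun x => f x * g' x + g x * f' x); first by apply: sfam_add; exact: sfam_mul.
  by move=> x; exact: is_deriveM.
Qed.

Lemma sfam_continuous f : sfam f -> continuous f.
Proof.
elim=> {f} [m i c d|c|f g _ cf _ cg|f g _ cf _ cg] x.
- have ca : continuous (fun y : Rn => c * y 0 i + d).
    move=> y; apply: (@continuousD _ _ _ (fun y : Rn => c * y 0 i) (fun=> d)); last exact: cst_continuous.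
    by apply: (@continuousM _ _ (fun=> c) (fun y : Rn => y 0 i)); [exact: cst_continuous|exact: coord_continuous].
  by apply: (@continuous_comp _ _ _ (fun y : Rn => c * y 0 i + d) (efl m)); [exact: ca|exact: continuous_efl].
- exact: cst_continuous.
- exact: continuousD (cf x) (cg x).
- exact: continuousM (cf x) (cg x).
Qed.

Lemma sfam_smooth f : sfam f -> smooth f.
Proof.
move=> Sf.
have Sp s : sfam (partial s f).
  elim: s => [//|i s IH] /=; have [g Sg Hg] := sfam_derive IH (delta_mx 0 i).
  rewrite (_ : 'D_(delta_mx 0 i) _ = g)//; apply/funext => x.
  by have [_ ->] := Hg x.
move=> s; split; first exact: sfam_continuous.
by move=> i x; have [g Sg Hg] := sfam_derive (Sp s) (delta_mx 0 i); have [] := Hg x.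
Qed.

(** No plateau is sought: what matters is that it is smooth and nonzero exactly on the open box, so
    that it can be divided out there. *)
Definition bump a b x : R := \prod_i (efl 0 (x 0 i - a 0 i) * efl 0 (b 0 i - x 0 i)).

Lemma sfam_bump a b : sfam (bump a b).
Proof.
rewrite /bump; elim: (index_enum _) => [|i r IH].
  rewrite (_ : (fun x => _) = fun=> 1); first exact: sfam_cst.
  by apply/funext => x; rewrite big_nil.
rewrite (_ : (fun x => _) = fun x =>
  (efl 0 (1 * x 0 i + (- a 0 i)) * efl 0 (-1 * x 0 i + b 0 i)) *
  \prod_(i <- r) (efl 0 (x 0 i - a 0 i) * efl 0 (b 0 i - x 0 i))); last first.
  by apply/funext => x; rewrite big_cons mul1r mulN1r (addrC (- _)).
by apply: sfam_mul IH; apply: sfam_mul; exact: sfam_coord.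
Qed.

Lemma bump_ge0 a b x : 0 <= bump a b x.
Proof. by apply: prodr_ge0 => i _; rewrite mulr_ge0 ?efl_ge0. Qed.

Lemma bump_neq0 a b x : bump a b x != 0 <-> forall i, a 0 i < x 0 i < b 0 i.
Proof.
have nz t : (efl 0 t != 0) = (0 < t).
  apply/idP/idP => [nz|/efl_gt0 t0]; last by rewrite gt_eqF.
  by apply/efl_gt0; rewrite lt_neqAle eq_sym nz efl_ge0.
rewrite prodf_seq_neq0; split=> [/allP H i|H].
  by have := H i (mem_index_enum i); rewrite /= mulf_eq0 negb_or !nz !subr_gt0.
by apply/allP => i _ /=; rewrite mulf_eq0 negb_or !nz !subr_gt0 H.
Qed.

End bump.

(** * Localization by functions with compact support in Omega *)

Section cutoffs.
Context {R : realType} {n : nat}.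
Local Notation "x ^*" := (conjc x) : ring_scope.
Local Notation Rn := 'rV[R]_n.
Local Notation C := R[i].
Local Notation mu := (@leb R n).
Variable Omega : set Rn.
Hypothesis oO : open Omega.
Implicit Types (f g h c Phi : Rn -> C).

Definition cutoff g := [/\ cmeas g, exists B : R, 0 <= B /\ forall x, normc (g x) <= B &
  exists K, [/\ compact K, K `<=` Omega & forall x, ~ K x -> g x = 0]].

Lemma cutoff_Linfty g : cutoff g -> Linfty g.
Proof. by move=> [mg [B [_ HB]] _]; split => //; exists B; exact: aeW. Qed.

Lemma C0_cutoff g : C0 Omega g -> cutoff g.
Proof.
move=> H; have [mg _] := C0_Linfty H; split; [exact: mg|exact: C0_bounded H|].
by case: H => _ cK KO; exists (csupport g); split => // x; exact: csupport0.
Qed.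

(** Coefficients and data are controlled on [Omega] only and arbitrary elsewhere; the extension by
    zero is measurable on the whole space and agrees with them under a cutoff. *)
Definition ext0 f x : C := if x \in Omega then f x else 0.

Lemma cmeas_ext0 f : cmeasurable Omega f -> cmeas (ext0 f).
Proof.
move=> [m1 m2]; have mO := open_rV_measurable oO.
split.
  rewrite (_ : (fun x => _) = (fun x => Re (f x)) \_ Omega); first exact/(measurable_restrictT _ mO).
  by apply/funext => x; rewrite patchE /ext0; case: ifP.
rewrite (_ : (fun x => _) = (fun x => Im (f x)) \_ Omega); first exact/(measurable_restrictT _ mO).
by apply/funext => x; rewrite patchE /ext0; case: ifP.
Qed.

Lemma cutoff_ext0 g f K x : K `<=` Omega -> (forall x, ~ K x -> g x = 0) ->
  g x * ext0 f x = g x * f x.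
Proof.
move=> KO g0; rewrite /ext0; case: ifPn => // /negP xO.
by rewrite g0 ?mul0r// => Kx; apply: xO; apply/mem_set; exact: KO.
Qed.

Lemma continuous_compact_bounded (f : Rn -> R) K : {within Omega, continuous f} ->
  compact K -> K `<=` Omega -> exists M, forall x, K x -> `|f x| <= M.
Proof.
move=> cf cK KO.
have : compact (f @` K) by apply: continuous_compact cK; exact: continuous_subspaceW cf.
move=> /compact_bounded[M [_ HM]]; exists (M + 1) => x Kx.
by apply: (HM (M + 1)); [rewrite ltrDl|exists x].
Qed.

Lemma cutoff_mul g c : cutoff g -> ccontinuous Omega c -> cutoff (fun x => g x * c x).
Proof.
move=> [mg [B [B0 HB]] [K [cK KO K0]]] cc.
have [M1 H1] := continuous_compact_bounded cc.1 cK KO.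
have [M2 H2] := continuous_compact_bounded cc.2 cK KO.
split; last by exists K; split => // x /K0 ->; rewrite mul0r.
  rewrite (_ : (fun x => _) = fun x => g x * ext0 c x); last first.
    by apply/funext => x; rewrite (cutoff_ext0 _ _ KO K0).
  by apply: cmeasM => //; apply: cmeas_ext0; exact: ccontinuous_cmeasurable.
exists (B * (`|M1| + `|M2|)); split => [|x]; first by rewrite mulr_ge0 ?addr_ge0.
have [Kx|/K0 ->] := pselect (K x); last by rewrite mul0r Normc.normc0 mulr_ge0 ?addr_ge0.
rewrite Normc.normcM ler_pM ?normc_ge0//; apply: le_trans (normc_le _) _.
by apply: lerD; [apply: le_trans (H1 x Kx) _|apply: le_trans (H2 x Kx) _]; exact: ler_norm.
Qed.

Lemma L2_ext0 f K : compact K -> K `<=` Omega -> L2loc Omega f ->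
  L2 (fun x => (\1_K x)%:C * ext0 f x) /\
  L2sq setT (fun x => (\1_K x)%:C * ext0 f x) = L2sq K f.
Proof.
move=> cK KO [mf Lf]; have mK := compact_rV_measurable cK.
have E : L2sq setT (fun x => (\1_K x)%:C * ext0 f x) = L2sq K f.
  rewrite /L2sq [RHS]integral_mkcond; apply: eq_integral => x _.
  rewrite patchE indicE; have [xK|_] := boolP (x \in K).
    rewrite mul1r /ext0 ifT//; apply/mem_set; apply: KO; exact/set_mem.
  by rewrite mul0r Normc.normc0 expr0n.
split=> //; split; last by rewrite E; exact: Lf.
apply: cmeasM; last exact: cmeas_ext0.
by apply: cmeas_real; exact: measurable_indic.
Qed.

Lemma L2_cutoff g f : cutoff g -> L2loc Omega f -> L2 (fun x => g x * f x).
Proof.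
move=> cg Lf; have Lg := cutoff_Linfty cg; have [_ _ [K [cK KO K0]]] := cg.
have [LK _] := L2_ext0 cK KO Lf; have := L2_Linfty Lg LK.
congr L2; apply/funext => x; rewrite /ext0 indicE.
have [xK|xK] := boolP (x \in K).
  by rewrite mul1r ifT//; apply/mem_set/KO/set_mem.
by rewrite K0 ?mul0r// => Kx; move/negP : xK; apply; exact/mem_set.
Qed.

Lemma cint_cI (nu : {measure set Rn -> \bar R}) f : (forall x, ~ Omega x -> f x = 0) ->
  cint nu Omega f = cI nu f.
Proof.
move=> f0; rewrite /cint /cI; congr (_ +i* _); rewrite Rintegral_mkcond; apply: eq_Rintegral => x _.
  by rewrite patchE; case: ifPn => // /negP xO; rewrite f0// => Ox; apply: xO; exact/mem_set.
by rewrite patchE; case: ifPn => // /negP xO; rewrite f0// => Ox; apply: xO; exact/mem_set.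
Qed.

Lemma ccvg_normc (z : nat -> C) l : ccvg z l <-> normc (z k - l) @[k --> \oo] --> (0 : R).
Proof.
split=> [[/cvgnP cR /cvgnP cI]|/cvg0P H].
  apply/cvg0P => e e0; have e2 : 0 < e / 2 by rewrite divr_gt0.
  have [K1 H1] := cR _ e2; have [K2 H2] := cI _ e2; exists (maxn K1 K2) => k.
  rewrite geq_max => /andP[k1 k2]; rewrite ger0_norm ?normc_ge0//.
  by apply: le_lt_trans (normc_le _) _; rewrite cReB cImB (splitr e) ltrD ?H1 ?H2.
split; apply/cvgnP => e /H[K HK]; exists K => k /HK; rewrite (ger0_norm (normc_ge0 _)); apply: le_lt_trans.
  by rewrite -cReB normc_Re.
by rewrite -cImB normc_Im.
Qed.

Variables (v_ : nat -> Rn -> C) (v : Rn -> C).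
Hypotheses (Lv_ : forall r, L2loc Omega (v_ r)) (Lv : L2loc Omega v).
Hypothesis v_weak : L2loc_weak_cvg Omega v_ v.

Lemma L2_cutoffB g r : cutoff g -> L2 (fun x => g x * (v_ r x - v x)).
Proof.
move=> cg; have := L2B (L2_cutoff cg (Lv_ r)) (L2_cutoff cg Lv).
by congr L2; apply/funext => x; rewrite mulrBr.
Qed.

(** The cutoff is moved onto the test function, which then has compact support in [Omega] as the
    weak convergence requires. *)
Lemma wnull_cutoff g : cutoff g -> wnull (fun r x => g x * (v_ r x - v x)).
Proof.
move=> cg h Lh; have Lg := cutoff_Linfty cg; have [mg _ [K [cK KO K0]]] := cg.
have Lgh := L2_Linfty (Linfty_conj Lg) Lh.
have gh0 x : ~ K x -> (g x)^* * h x = 0 by move=> /K0 ->; rewrite conjc0 mul0r.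
have := v_weak Lgh cK KO gh0; move/ccvg_normc; apply: squeeze0 => r.
rewrite normc_ge0 andTb le_eqVlt; apply/orP; left; apply/eqP; congr normc.
have E f : cint mu Omega (fun x => f x * ((g x)^* * h x)^*) = ip (fun x => g x * f x) h.
  rewrite cint_cI => [|x Ox]; last by rewrite gh0 ?conjc0 ?mulr0// => /KO.
  by congr cI; apply/funext => x; rewrite conjcM conjcK; ring.
rewrite (E (v_ r)) (E v) -ipBl//; [|exact: L2_cutoff|exact: L2_cutoff].
by rewrite /ip; congr cI; apply/funext => x; rewrite mulrBr.
Qed.

End cutoffs.

(** * From precompactness to convergence in norm *)

Section precompactness.
Context {R : realType} {n N M : nat}.
Local Notation "x ^*" := (conjc x) : ring_scope.
Local Notation Rn := 'rV[R]_n.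
Local Notation C := R[i].
Local Notation mu := (@leb R n).
Variables (Omega : set Rn) (u_ : nat -> 'I_N -> Rn -> C) (u : 'I_N -> Rn -> C).
Variables (p c : 'I_N -> 'I_M -> Rn -> C).
Hypotheses (oO : open Omega) (Lu_ : forall r al, L2loc Omega (u_ r al)).
Hypotheses (Lu : forall al, L2loc Omega (u al)).
Hypothesis u_weak : forall al, L2loc_weak_cvg Omega (u_ ^~ al) (u al).
Hypotheses (Lp : forall al k, Linfty (p al k)) (cc : forall al k, ccontinuous Omega (c al k)).

Lemma cutoff_indic (K : set Rn) : compact K -> K `<=` Omega ->
  cutoff Omega (fun x => (\1_K x)%:C : C).
Proof.
move=> cK KO; split.
- by apply: cmeas_real; apply: measurable_indic; exact: compact_rV_measurable.
- exists 1; split => // x; rewrite normc_real indicE.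
  by case: (_ \in _); rewrite ?normr1 ?normr0.
- exists K; split => // x Kx; rewrite indicE memNset//.
Qed.

(** The hypothesis bears on [u_], not on [u_ - u]; subtracting the fixed image of [u] preserves
    precompactness. The cutoff [g] turns L^2_loc convergence into L^2 convergence, and a weakly null
    precompact sequence tends to [0] in norm. *)
Lemma precompact_cvg0 (g Phi : Rn -> C) : cutoff Omega g -> C0 Omega Phi ->
  L2loc_precompact Omega (fun r x => \sum_al \sum_k c al k x *
    psdoA (p al k) (fun y => Phi y * u_ r al y) x) ->
  nrm (fun x => \sum_al \sum_k g x * c al k x *
    psdoA (p al k) (fun y => Phi y * (u_ r al y - u al y)) x) @[r --> \oo] --> (0 : R).
Proof.
move=> cg CP prec; have cP := C0_cutoff CP.
have [_ [B [B0 HB]] [K [cK KO K0]]] := cg.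
have LPu r al : L2 (fun y => Phi y * u_ r al y) by exact: (L2_cutoff oO cP).
have LP al : L2 (fun y => Phi y * u al y) by exact: (L2_cutoff oO cP).
have LPw r al : L2 (fun y => Phi y * (u_ r al y - u al y)).
  exact: (L2_cutoffB oO (fun r => Lu_ r al)).
pose S (g : Rn -> C) (f : 'I_N -> Rn -> C) x :=
  \sum_al \sum_k g x * c al k x * psdoA (p al k) (fun y => Phi y * f al y) x.
have L2S (h : Rn -> C) (f : 'I_N -> Rn -> C) : cutoff Omega h ->
    (forall al, L2 (fun y => Phi y * f al y)) -> L2 (S h f).
  move=> ch Lf; apply: L2_sum => al; apply: L2_sum => k.
  apply: L2_Linfty; first by apply: (@cutoff_Linfty _ _ Omega); exact: cutoff_mul.
  by apply: L2_psdoA.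
apply: (@weak_precompact_cvg0 _ _ (fun r => S g (fun al y => u_ r al y - u al y))) => [r||s Hs].
- exact: L2S.
- apply: wnull_sum => [al r|al].
    by apply: L2_sum => k; apply: L2_Linfty; [apply: (@cutoff_Linfty _ _ Omega); exact: cutoff_mul|exact: L2_psdoA].
  apply: wnull_sum => [k r|k].
    by apply: L2_Linfty; [apply: (@cutoff_Linfty _ _ Omega); exact: cutoff_mul|exact: L2_psdoA].
  apply: wnull_mul => [|r|].
  + by apply: (@cutoff_Linfty _ _ Omega); exact: cutoff_mul.
  + exact: L2_psdoA.
  + apply: wnull_psdoA => [|r|]; [exact: Lp|exact: LPw|].
    exact: (wnull_cutoff oO (fun r => Lu_ r al) (Lu al) (u_weak al)).
have [t Ht [f Lf cf]] := prec s Hs.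
have c1 := cutoff_indic cK KO.
(* The strong limit is [g] times the L^2_loc limit [f], minus the contribution of [u]. *)
exists t => //; exists (fun x => g x * f x - S g u x).
  by apply: L2B; [exact: (L2_cutoff oO cg)|exact: L2S].
pose h r x := S (fun x => (\1_K x)%:C) (u_ r) x - (\1_K x)%:C * f x.
have Lh r : L2 (h r) by apply: L2B; [exact: L2S|exact: (L2_cutoff oO c1)].
have h0 : nrm (h (s (t k))) @[k --> \oo] --> (0 : R).
  apply/(cvg_sqrt0 (fun k => nrm2_ge0 (h (s (t k))))).
  have /fine_cvg := cf K cK KO; rewrite (_ : fine \o _ = fun k => nrm2 (h (s (t k))))//.
  apply/funext => k; rewrite /= /nrm2; congr fine.
  rewrite /L2sq [LHS]integral_mkcond; apply: eq_integral => x _.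
  rewrite patchE /h /S indicE; have [xK|xK] := boolP (x \in K).
    by under [in RHS]eq_bigr do under eq_bigr do rewrite mul1r; rewrite mul1r.
  rewrite mul0r subr0 big1 ?Normc.normc0 ?expr0n// => al _.
  by rewrite big1// => k' _; rewrite !mul0r.
apply: (@squeeze0 _ _ (fun k => B * nrm (h (s (t k))))) => [k|]; last first.
  by rewrite -(mulr0 B); apply: cvgM => //; exact: cvg_cst.
rewrite nrm_ge0 andTb; set r := s (t k).
have [Lgh] := L2_mulr B0 (let: And3 a _ _ := cg in a) (aeW _ HB) (Lh r).
apply: le_trans; rewrite le_eqVlt; apply/orP; left; apply/eqP.
apply: ae_nrm; first exact: L2_meas.
  by apply: L2_meas; apply: L2B; [exact: L2S|apply: L2B; [exact: (L2_cutoff oO cg)|exact: L2S]].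
have ae1 : {ae mu, forall x, forall al k, psdoA (p al k) (fun y => Phi y * (u_ r al y - u al y)) x =
   psdoA (p al k) (fun y => Phi y * u_ r al y) x - psdoA (p al k) (fun y => Phi y * u al y) x}.
  apply: filter_forall => al; apply: filter_forall => k'.
  have -> : (fun y => Phi y * (u_ r al y - u al y)) = (fun y => Phi y * u_ r al y - Phi y * u al y).
    by apply/funext => y; rewrite mulrBr.
  exact: psdoAB.
apply: filterS ae1 => x Hx.
have gE : g x * (\1_K x)%:C = g x.
  rewrite indicE; have [xK|xK] := boolP (x \in K); first by rewrite mulr1.
  by rewrite mulr0 K0// => Kx; move/negP: xK; apply; exact/mem_set.
have E (X Y : 'I_N -> 'I_M -> C) (Z : 'I_N -> 'I_M -> C) (a e b : C) (cx : 'I_N -> 'I_M -> C) :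
    a * e = a -> (forall al k, X al k = Y al k - Z al k) ->
    a * (\sum_al \sum_k e * cx al k * Y al k - e * b) =
    \sum_al \sum_k a * cx al k * X al k - (a * b - \sum_al \sum_k a * cx al k * Z al k).
  move=> ae XYZ; rewrite mulrBr mulrA ae opprB addrA; congr (_ - _).
  rewrite mulr_sumr -big_split /=; apply: eq_bigr => al _.
  rewrite mulr_sumr -big_split /=; apply: eq_bigr => k' _.
  by rewrite XYZ !mulrA ae; ring.
exact: E.
Qed.

End precompactness.

(** * The localized quadratic form *)

Section form_estimates.
Context {R : realType} {n : nat}.
Local Notation "x ^*" := (conjc x) : ring_scope.
Local Notation Rn := 'rV[R]_n.
Local Notation C := R[i].
Local Notation mu := (@leb R n).
Implicit Types (f g h : Rn -> C) (x xi : Rn).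

Lemma Re_cI_le f g : cinteg mu f -> cinteg mu g ->
  {ae mu, forall x, Re (f x) <= Re (g x)} -> Re (cI mu f) <= Re (cI mu g).
Proof.
move=> If Ig fg; rewrite -subr_ge0 -cReB -cIB//.
have Id := cintegB Ig If.
have md := cinteg_meas Id.
have mn : measurable_fun setT (fun x => `|Re (g x - f x)|).
  by apply: measurableT_comp => //; exact: md.1.
have -> : Re (cI mu (fun x => g x - f x)) = Re (cI mu (fun x => `|Re (g x - f x)|%:C)).
  have -> : Re (cI mu (fun x => g x - f x)) = Re (cI mu (fun x => (Re (g x - f x))%:C)) by [].
  congr (Re _); apply: ae_eq_cI; [exact: cmeas_real md.1|exact: cmeas_real mn|].
  by apply: filterS fg => x H; rewrite ger0_norm// cReB subr_ge0.
rewrite cI_real /=; apply: Rintegral_ge0 => x _; exact: normr_ge0.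
Qed.

Lemma cI_sqn (I : nat) (V : 'I_I -> Rn -> C) : (forall a, L2 (V a)) ->
  cinteg mu (fun x => (sqn (fun a => V a x))%:C) /\
  cI mu (fun x => (sqn (fun a => V a x))%:C) = (\sum_a nrm2 (V a))%:C.
Proof.
move=> LV.
have E : (fun x => (sqn (fun a => V a x))%:C) = fun x => \sum_a V a x * (V a x)^*.
  by apply/funext => x; rewrite /sqn rmorph_sum; apply: eq_bigr => a _; rewrite /= mulcC_normc.
rewrite E; have [I1 ->] := cI_sum (index_enum 'I_I) xpredT (fun a => cinteg_ip (LV a) (LV a)).
split => //; rewrite rmorph_sum; apply: eq_bigr => a _; exact: ip_nrm2.
Qed.

Lemma cI_qform (I : nat) (q : 'I_I -> 'I_I -> C) (V : 'I_I -> Rn -> C) : (forall a, L2 (V a)) ->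
  cinteg mu (fun x => qform q (fun a => V a x)) /\
  cI mu (fun x => qform q (fun a => V a x)) = \sum_a \sum_b q a b * ip (V a) (V b).
Proof.
move=> LV.
have L2q a b := L2Z (q a b) (LV a).
have [I1 E1] : cinteg mu (fun x => qform q (fun a => V a x)) /\
    cI mu (fun x => qform q (fun a => V a x)) = \sum_a cI mu (fun x => \sum_b q a b * V a x * (V b x)^*).
  apply: cI_sum => a.
  by have [] := cI_sum (index_enum 'I_I) xpredT (fun b => cinteg_ip (L2q a b) (LV b)).
split=> //; rewrite E1; apply: eq_bigr => a _.
have [_ ->] := cI_sum (index_enum 'I_I) xpredT (fun b => cinteg_ip (L2q a b) (LV b)).
by apply: eq_bigr => b _; rewrite -(ipZl (q a b) (LV a) (LV b)).
Qed.

(** The index [k.+1] is due to the cubes being half-open: [cube k] misses the points with a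
    coordinate equal to [- k]. *)
Lemma enorm_cube (k : nat) x : enorm x <= k%:R -> cube k.+1 x.
Proof.
move=> xk; apply/cubeP => i.
have : `|x 0 i| <= k%:R.
  apply: le_trans xk; rewrite -sqrtr_sqr /enorm ler_wsqrtr//.
  rewrite /dotp (bigD1 i)//= expr2 lerDl; apply: sumr_ge0 => j _; exact: sqr_ge0.
by rewrite ler_norml => /andP[a b]; rewrite -natr1; apply/andP; split; lra.
Qed.

Lemma trunc_supp j f : (forall x, ~ cube j x -> f x = 0) -> trunc j f = f.
Proof.
move=> f0; apply/funext => x; rewrite /trunc /box1 indicE.
have [xj|xj] := boolP (x \in _); first by rewrite mul1r.
by rewrite mul0r f0// => xj'; move/negP: xj; apply; exact/mem_set.
Qed.

(** The common bounded support makes the transform a pairing of [V r] with an exponential cut to a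
    cube. These exponentials have norms independent of [xi], so the transforms tend to [0] pointwise
    and are uniformly bounded; dominated convergence applies on the bounded cube of frequencies. *)
Lemma low_frequency_cvg0 (V : nat -> Rn -> C) (j k : nat) : (forall r, L2 (V r)) -> wnull V ->
  (forall r x, ~ cube j x -> V r x = 0) ->
  nrm2 (trunc k (fourier (V r))) @[r --> \oo] --> (0 : R).
Proof.
move=> LV wV V0.
pose bj : Rn -> C := box1 (const_mx (- j%:R)) (const_mx j%:R).
pose ch xi x : C := ((cis (- 2 * pi * dotp xi x)) * bj x)^*.
have IV r : cinteg mu (V r) by rewrite -(trunc_supp (V0 r)); exact: cinteg_trunc.
have Lb : L2 bj := L2_box1 _ _.
have chle xi x : normc (ch xi x) = normc (bj x).
  by rewrite /ch normc_conj Normc.normcM normc_cis mul1r.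
have Lch xi : L2 (ch xi) /\ nrm (ch xi) <= nrm bj.
  have mch : cmeas (ch xi).
    apply: cmeas_conj; apply: cmeasM; last exact: L2_meas.
    apply: cmeas_cis; apply: measurable_funM; first exact: measurable_cst.
    apply: measurable_sum => i; apply: measurable_funM; first exact: measurable_cst.
    exact: measurable_rV_coord.
  have [|L N] := L2_le ler01 mch Lb; first by move=> x; rewrite chle mul1r.
  by split => //; rewrite -[nrm bj]mul1r; apply: nrm_leZ.
have FE r xi : fourier_int (V r) xi = ip (V r) (ch xi).
  rewrite fourier_intE /ip; congr cI; apply/funext => x.
  have Vb : V r x = bj x * V r x by rewrite -{1}(trunc_supp (V0 r)).
  transitivity (V r x * (cis (- 2 * pi * dotp xi x) * bj x)); first by rewrite {1}Vb; ring.
  by congr (_ * _); exact: esym (conjcK _).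
have [B [B0 HB]] := weak_bounded LV wV.
have Fb r xi : normc (fourier_int (V r) xi) <= B * nrm bj.
  rewrite FE; apply: le_trans (cauchy_schwarz_nrm (LV r) (Lch xi).1) _.
  by apply: ler_pM; rewrite ?nrm_ge0//; exact: (Lch xi).2.
have LF r : L2 (fourier_int (V r)) by have [] := fourier_int_L2 (IV r) (LV r).
pose D := B * nrm bj.
pose bk : Rn -> C := box1 (const_mx (- k%:R)) (const_mx k%:R).
have H : ccvg (fun r => cI mu (fun x => (normc (trunc k (fourier_int (V r)) x) ^+ 2)%:C)) (cI mu (fun=> 0)).
  apply: (@cI_dominated _ _ _ mu _ _ (fun x => D ^+ 2 * normc (bk x) ^+ 2)) => [r||||].
  - by apply: cmeas_real; apply: cmeas_sqr; apply: L2_meas; exact: L2_trunc.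
  - exact: cmeas_cst.
  - by apply: integrableZ_EFin; exact: ((L2P bk).1 (L2_box1 _ _)).2.
  - apply: aeW => xi; change (0 : C) with ((0 : R)%:C); apply: ccvg_real.
    have c0 := wV _ (Lch xi).1.
    apply: (@squeeze0 _ _ (fun r => normc (ip (V r) (ch xi)) * normc (ip (V r) (ch xi)))).
      move=> r; rewrite sqr_ge0 andTb -FE -expr2 ler_pXn2r ?nnegrE ?normc_ge0//.
      exact: normc_trunc.
    by rewrite -(mulr0 0); apply: cvgM.
  - move=> r; apply: aeW => xi; rewrite normc_real ger0_norm ?sqr_ge0//.
    rewrite -exprMn ler_pXn2r ?nnegrE ?normc_ge0// ?mulr_ge0 ?normc_ge0 ?nrm_ge0//.
    by rewrite /trunc Normc.normcM mulrC ler_wpM2r// normc_ge0.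
have H1 : nrm2 (trunc k (fourier_int (V r))) @[r --> \oo] --> (0 : R).
  move: H; rewrite cI0 (_ : (fun r => cI mu _) = fun r => (nrm2 (trunc k (fourier_int (V r))))%:C).
    by case.
  by apply/funext => r; rewrite cI_real -nrm2E.
apply: squeeze0 H1 => r; rewrite nrm2_ge0 andTb le_eqVlt; apply/orP; left; apply/eqP.
apply: ae_nrm2; [by apply: L2_meas; exact: L2_trunc|by apply: L2_meas; apply: L2_trunc; exact: L2_fourier|].
have := fourier_fourier_int (IV r) (LV r); apply: filterS => x e.
by congr (_ * _); exact: esym.
Qed.

Lemma is_fourier_sum (I : Type) (r : seq I) (F G : I -> Rn -> C) :
  (forall i, is_fourier (F i) (G i)) ->
  is_fourier (fun x => \sum_(i <- r) F i x) (fun x => \sum_(i <- r) G i x).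
Proof.
move=> H; elim: r => [|i r IH].
  have := is_fourierZ 0 (fourierP (L20 (R := R) (n := n))).
  congr is_fourier; apply/funext => x; by rewrite mul0r big_nil.
have := is_fourierD (H i) IH.
by congr is_fourier; apply/funext => x; rewrite big_cons.
Qed.

Section lower_bound.
Context {N m M : nat}.
Variables (p : 'I_m -> 'I_N -> 'I_M -> Rn -> C) (a : 'I_m -> 'I_N -> 'I_M -> C).
Variables (q : 'I_N -> 'I_N -> C) (delta : R) (k : nat).
Hypotheses (delta0 : 0 < delta) (Lp : forall s al j, Linfty (p s al j)).
Hypothesis symb_ineq : {ae mu, forall xi, k%:R < enorm xi ->
  forall l : 'I_N -> C, - delta * sqn l - k%:R * symb2 p a xi l <= Re (qform q l)}.

Definition psdo_sum (s : 'I_m) (V : 'I_N -> Rn -> C) x : C :=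
  \sum_al \sum_j a s al j * psdoA (p s al j) (V al) x.

(** Plancherel's theorem turns the penalty of the symbol inequality into the norm of the operator
    with frozen coefficients. *)
Lemma nrm2_psdo_sum s (V : 'I_N -> Rn -> C) : (forall al, L2 (V al)) ->
  L2 (fun xi => symb p a s xi (fun al => fourier (V al) xi)) /\
  nrm2 (fun xi => symb p a s xi (fun al => fourier (V al) xi)) = nrm2 (psdo_sum s V).
Proof.
move=> LV.
have LS : L2 (fun xi => symb p a s xi (fun al => fourier (V al) xi)).
  apply: L2_sum => al; apply: L2_sum => j.
  rewrite (_ : (fun xi => _) = fun xi => a s al j * (p s al j xi * fourier (V al) xi)); last first.
    by apply/funext => xi; rewrite mulrA.
  by apply: L2Z; apply: L2_Linfty => //; exact: L2_fourier.
have LA al j : L2 (psdoA (p s al j) (V al)) by exact: L2_psdoA.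
have HF : is_fourier (psdo_sum s V)
    (fun xi => \sum_al \sum_j a s al j * fourier (psdoA (p s al j) (V al)) xi).
  apply: is_fourier_sum => al; apply: is_fourier_sum => j.
  by apply: is_fourierZ; exact: fourierP.
have [LP _ _] := HF.
split=> //; rewrite -(nrm2_fourier LP).
apply: ae_nrm2; [by apply: L2_meas; exact: L2_fourier|exact: L2_meas|].
have ae1 : {ae mu, forall xi, forall al j,
    fourier (psdoA (p s al j) (V al)) xi = p s al j xi * fourier (V al) xi}.
  by apply: filter_forall => al; apply: filter_forall => j; exact: fourier_psdoA.
apply: filterS2 ae1 (fourier_uniq HF) => xi H1 H2; apply: (etrans H2).
apply: eq_bigr => al _; apply: eq_bigr => j _.
by rewrite -mulrA; exact: (congr1 _ (H1 al j)).
Qed.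

Lemma form_lower_bound (V : 'I_N -> Rn -> C) : (forall al, L2 (V al)) ->
  - delta * (\sum_al nrm2 (V al)) - k%:R * (\sum_s nrm2 (psdo_sum s V))
  - qnorm q * (\sum_al nrm2 (trunc k.+1 (fourier (V al))))
  <= Re (\sum_al \sum_be q al be * ip (V al) (V be)).
Proof.
move=> LV.
have LF al : L2 (fourier (V al)) by exact: L2_fourier.
have LT al : L2 (trunc k.+1 (fourier (V al))) by exact: L2_trunc.
have LS s := (nrm2_psdo_sum s LV).1.
have [IA EA] := cI_sqn LF.
have [IB EB] := cI_sqn LS.
have [IT ET] := cI_sqn LT.
have [IQ EQ] := cI_qform q LF.
have -> : \sum_al \sum_be q al be * ip (V al) (V be) =
    cI mu (fun x => qform q (fun al => fourier (V al) x)).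
  rewrite EQ; apply: eq_bigr => al _; apply: eq_bigr => be _.
  by rewrite (ip_fourier (LV al) (LV be)).
have IAB := cintegD (cintegZ (- delta)%:C IA) (cintegZ (- k%:R)%:C IB).
have I3 := cintegD IAB (cintegZ (- qnorm q)%:C IT).
have := Re_cI_le I3 IQ; rewrite (cID IAB (cintegZ _ IT)) (cID (cintegZ _ IA) (cintegZ _ IB)) !cIZ//.
rewrite EA EB ET -!rmorphM -!rmorphD /= !mulNr.
have -> : \sum_s nrm2 (fun xi => symb p a s xi (fun al => fourier (V al) xi)) =
    \sum_s nrm2 (psdo_sum s V).
  by apply: eq_bigr => s _; exact: (nrm2_psdo_sum s LV).2.
have E1 : (\sum_al nrm2 (fourier (V al))) = \sum_al nrm2 (V al).
  by apply: eq_bigr => al _; exact: nrm2_fourier.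
rewrite E1; apply; apply: filterS symb_ineq => xi H.
set l := fun al => fourier (V al) xi.
have Q0 := qnorm_ge0 q; have S0 := symb2_ge0 p a xi l; have D0 := sqn_ge0 l.
have T0 := sqn_ge0 (fun al => trunc k.+1 (fourier (V al)) xi).
rewrite !mul0r !subr0; change (sqn (fun s => symb p a s xi l)) with (symb2 p a xi l).
have [kx|kx] := ltP k%:R (enorm xi).
  apply: le_trans (H kx l); rewrite !mulNr gerDl oppr_le0; exact: mulr_ge0.
have E : sqn (fun al => trunc k.+1 (fourier (V al)) xi) = sqn l.
  apply: eq_bigr => al _; rewrite /trunc /box1 indicE mem_set ?mul1r//.
  exact: enorm_cube.
rewrite E !mulNr; have := qform_bound q l; have := normc_Re (qform q l).
rewrite ler_norml => /andP[+ _].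
have := mulr_ge0 (ltW delta0) D0; have := mulr_ge0 (ler0n R k) S0.
move: (normc _) (Re _) (delta * _) (k%:R * _) (qnorm q * _) => *; lra.
Qed.

End lower_bound.

End form_estimates.

(** * Test functions and boxes *)

Section test_functions.
Context {R : realType} {n : nat}.
Local Notation Rn := 'rV[R]_n.
Local Notation C := R[i].
Implicit Types (phi : Rn -> R) (x a b : Rn) (V : set Rn).

Definition test V phi := [/\ continuous phi, forall x, 0 <= phi x &
  exists K, [/\ compact K, K `<=` V & forall x, ~ K x -> phi x = 0]].

Lemma rV_hausdorff : hausdorff_space Rn.
Proof. exact: norm_hausdorff. Qed.

Lemma compact_rV_closed (K : set Rn) : compact K -> closed K.
Proof. exact: compact_closed rV_hausdorff. Qed.

Lemma ccontinuous_real phi D : continuous phi -> ccontinuous D (fun x => (phi x)%:C : C).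
Proof.
move=> cp; split; first by apply: continuous_subspaceT => x; exact: cp.
by apply: continuous_subspaceT => x; exact: cst_continuous.
Qed.

Lemma real_C0 V phi K : continuous phi -> compact K -> K `<=` V ->
  (forall x, ~ K x -> phi x = 0) -> C0 V (fun x => (phi x)%:C : C).
Proof.
move=> cp cK KV K0.
have sK : csupport (fun x => (phi x)%:C : C) `<=` K.
  rewrite [X in _ `<=` X](closure_id K).1; last exact: compact_rV_closed.
  apply: closure_subset => x /= px; apply: contrapT => /K0 p0.
  by move: px; rewrite p0 eqxx.
split; first exact: ccontinuous_real.
  by apply: (subclosed_compact _ cK sK); exact: closed_closure.
exact: subset_trans sK KV.
Qed.

Lemma test_C0 V phi : test V phi -> C0 V (fun x => (phi x)%:C : C).
Proof. by move=> [cp _ [K [cK KV K0]]]; exact: real_C0 cK KV K0. Qed.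

Definition openbox a b : set Rn := [set x | forall i, a 0 i < x 0 i < b 0 i].

Definition closedbox a b : set Rn := [set x | forall i, x 0 i \in `[a 0 i, b 0 i]].

Lemma compact_closedbox a b : compact (closedbox a b).
Proof.
apply: (rV_compact (A := fun i => [set` `[a 0 i, b 0 i]])) => i.
exact: segment_compact.
Qed.

Lemma open_openbox a b : open (openbox a b).
Proof.
have -> : openbox a b = bump a b @^-1` [set t | t != 0].
  by apply/seteqP; split => x /= /bump_neq0.
apply: open_comp => [x _|]; first exact: sfam_continuous (sfam_bump a b) x.
exact: open_neq.
Qed.

Lemma openbox_closedbox a b : openbox a b `<=` closedbox a b.
Proof. by move=> x Hx i; have /andP[c d] := Hx i; rewrite in_itv/= !ltW. Qed.

Lemma C0infty_bump a b V : closedbox a b `<=` V -> C0infty V (fun x => (bump a b x)%:C : C).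
Proof.
move=> ab; split.
- apply: (real_C0 _ (compact_closedbox (a := a) (b := b)) ab); first exact: sfam_continuous (sfam_bump a b).
  move=> x nx; apply/eqP/negPn/negP => /bump_neq0 Hx; apply: nx; exact: openbox_closedbox.
- exact: sfam_smooth (sfam_bump a b).
- by apply: sfam_smooth; exact: sfam_cst.
Qed.

Lemma continuous_sqrt_test V phi : test V phi -> continuous (fun x => Num.sqrt (phi x)).
Proof.
move=> [cp _ _] x; apply: (@continuous_comp _ _ _ phi Num.sqrt); first exact: cp.
exact: sqrt_continuous.
Qed.

Lemma test_sqrt V phi : test V phi -> test V (fun x => Num.sqrt (phi x)).
Proof.
move=> H; have [_ _ [K [cK KV K0]]] := H; split; first exact: continuous_sqrt_test H.
  by move=> x; exact: sqrtr_ge0.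
by exists K; split => // x /K0 ->; rewrite sqrtr0.
Qed.

(** The denominator is nonzero on the compact set [K] carrying [phi]. Off [K] the quotient vanishes
    on a neighbourhood, including points where the denominator is [0], since [phi] does. *)
Lemma continuous_div_bump a b phi : test (openbox a b) phi ->
  continuous (fun x => Num.sqrt (phi x) / bump a b x).
Proof.
move=> H x; have cs := continuous_sqrt_test H; have [_ _ [K [cK KV K0]]] := H.
have [Kx|nKx] := pselect (K x).
  apply: (@continuousM _ _ (fun y : Rn => Num.sqrt (phi y)) (fun y => (bump a b y)^-1)).
    exact: cs.
  apply: (@continuousV _ _ (bump a b)); last exact: sfam_continuous (sfam_bump a b) x.
  by apply/bump_neq0; exact: KV.
have : \forall y \near x, 0 = Num.sqrt (phi y) / bump a b y.
  have oK : open (~` K) by apply: closed_openC; exact: compact_rV_closed.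
  have := open_nbhs_nbhs (conj oK nKx); apply: filterS => y /K0 ->.
  by rewrite sqrtr0 mul0r.
move=> nE; rewrite /continuous_at -(nbhs_singleton nE).
by apply: cvg_trans (near_eq_cvg nE) _; exact: cvg_cst.
Qed.

Lemma nbhs_box x (P : set Rn) : (\forall y \near x, P y) ->
  exists a b, openbox a b x /\ closedbox a b `<=` P.
Proof.
move=> /nbhs_ballP[e /= e0 xe].
have e2 : 0 < e / 2 by rewrite divr_gt0.
exists (\row_i (x 0 i - e / 2)), (\row_i (x 0 i + e / 2)); split.
  by move=> i; rewrite !mxE ltrDl gtrDl oppr_lt0 e2.
move=> y Hy; apply: xe; split => // i j; rewrite ord1 /ball/=.
have := Hy j; rewrite in_itv/= !mxE => /andP[c d].
by rewrite ltr_distlC; apply/andP; split; lra.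
Qed.

Lemma ccontinuous_near V (f : Rn -> C) x e : open V -> ccontinuous V f -> V x -> 0 < e ->
  \forall y \near x, normc (f y - f x) < e.
Proof.
move=> oV [cR cI] Vx e0; have e2 : 0 < e / 2 by rewrite divr_gt0.
have xV : x \in V by exact/mem_set.
move: cR cI; rewrite !continuous_open_subspace// => /(_ x xV) cR /(_ x xV) cI.
move: cR cI => /cvgrPdist_lt/(_ _ e2) + /cvgrPdist_lt/(_ _ e2).
apply: filterS2 => y; rewrite distrC -cReB (distrC (Im _)) -cImB => c d.
by apply: le_lt_trans (normc_le _) _; rewrite (splitr e) ltrD.
Qed.

End test_functions.

Section finite_sums.
Context {R : realType} {n : nat}.
Local Notation Rn := 'rV[R]_n.
Local Notation C := R[i].

Lemma nrm_sum (I : Type) (r : seq I) (F : I -> Rn -> C) : (forall i, L2 (F i)) ->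
  nrm (fun x => \sum_(i <- r) F i x) <= \sum_(i <- r) nrm (F i).
Proof.
move=> LF; elim: r => [|i r IH].
  rewrite big_nil (_ : (fun x => _) = fun=> 0) ?/nrm ?nrm20 ?sqrtr0//.
  by apply/funext => x; rewrite big_nil.
rewrite big_cons (_ : (fun x => _) = fun x => F i x + \sum_(i <- r) F i x); last first.
  by apply/funext => x; rewrite big_cons.
apply: le_trans (nrmD (LF i) (L2_sum r xpredT LF)) _.
by rewrite lerD2l.
Qed.

Lemma cvg_sum0 (I : Type) (r : seq I) (F : I -> nat -> R) :
  (forall i, F i k @[k --> \oo] --> (0 : R)) ->
  \sum_(i <- r) F i k @[k --> \oo] --> (0 : R).
Proof.
move=> H; elim: r => [|i r IH].
  by under eq_fun do rewrite big_nil; exact: cvg_cst.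
by have := cvgD (H i) IH; rewrite addr0 => h; under eq_fun do rewrite big_cons; exact: h.
Qed.

End finite_sums.

(** * The estimate near a point *)

Section local_estimate.
Context {R : realType} {n N m M : nat}.
Local Notation "x ^*" := (conjc x) : ring_scope.
Local Notation Rn := 'rV[R]_n.
Local Notation C := R[i].
Local Notation mu := (@leb R n).
Variables (Omega : set Rn) (w : nat -> 'I_N -> Rn -> C).
Variables (p c : 'I_m -> 'I_N -> 'I_M -> Rn -> C) (q : 'I_N -> 'I_N -> Rn -> C).
Hypotheses (oO : open Omega).
Hypothesis w_L2 : forall g, cutoff Omega g -> forall r al, L2 (fun x => g x * w r al x).
Hypothesis w_null : forall g, cutoff Omega g -> forall al, wnull (fun r x => g x * w r al x).
Hypotheses (pA : forall s al k, algA (p s al k)) (cc : forall s al k, ccontinuous Omega (c s al k)).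
Hypothesis qc : forall al be, ccontinuous Omega (q al be).
Hypothesis w_prec : forall g Phi s, cutoff Omega g -> C0infty Omega Phi ->
  nrm (fun x => \sum_al \sum_k g x * c s al k x *
    psdoA (p s al k) (fun y => Phi y * w r al y) x) @[r --> \oo] --> (0 : R).

Section psdo_sum_localization.
Variables (a : 'I_m -> 'I_N -> 'I_M -> C) (Phi b th : Rn -> C) (rho : R).
Variables (B : 'I_m -> 'I_N -> 'I_M -> R).
Hypotheses (CPhi : C0infty Omega Phi) (Cb : C0 Omega b).
Hypothesis thE : forall x, th x = b x * Phi x.
Hypotheses (B0 : forall s al k, 0 <= B s al k).
Hypothesis pB : forall s al k, {ae mu, forall x, normc (p s al k x) <= B s al k}.
Hypothesis rho0 : 0 <= rho.
Hypothesis arho : forall s al k x, b x != 0 -> normc (a s al k - c s al k x) <= rho.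

(* Commuting the multiplication by [b] past the operators, the frozen coefficients may be
   replaced by the variable ones up to [rho] times the norm of [th w]. *)
Lemma psdo_sum_localized s : exists2 e : nat -> R, e r @[r --> \oo] --> (0 : R) &
  forall r, nrm (psdo_sum p a s (fun al x => th x * w r al x)) <=
    rho * (\sum_al \sum_k B s al k * nrm (fun x => th x * w r al x)) + e r.
Proof.
have [CP _ _] := CPhi; have cP := C0_cutoff CP; have cb := C0_cutoff Cb.
have Cb' : C0 setT b by case: Cb => ? ? _; split => //; exact: subsetT.
have Lb := cutoff_Linfty cb.
have Lp al k : Linfty (p s al k) by case: (pA s al k).
pose V r al x := Phi x * w r al x.
have LV r al : L2 (V r al) := w_L2 cP r al.
have WE r al : (fun x => th x * w r al x) = multB b (V r al).
  by apply/funext => x; rewrite /multB /V /= mulrA thE.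
have LW r al : L2 (multB b (V r al)) by exact: L2_Linfty.
pose A r al k := psdoA (p s al k) (V r al).
have LA r al k : L2 (A r al k) by exact: L2_psdoA.
pose K r al k := commutator (psdoA (p s al k)) (multB b) (V r al).
have LK r al k : L2 (K r al k) by exact: L2_commutator.
pose D r al k x := (a s al k - c s al k x) * (b x * A r al k x).
have mD al k : cmeas (fun x => b x * (a s al k - c s al k x)).
  have [m1 _ _] := cutoff_mul oO cb (cc s al k).
  rewrite (_ : (fun x => _) = fun x => b x * a s al k - b x * c s al k x); last first.
    by apply/funext => x; rewrite mulrBr.
  by apply: cmeasB => //; apply: cmeasM; [exact: Lb.1|exact: cmeas_cst].
have LD r al k : L2 (D r al k) /\ nrm (D r al k) <= rho * nrm (fun x => b x * A r al k x).
  have LbA : L2 (fun x => b x * A r al k x) by exact: L2_Linfty.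
  apply: L2_le_ae => //.
    rewrite (_ : D r al k = fun x => b x * (a s al k - c s al k x) * A r al k x).
      by apply: cmeasM => //; exact: L2_meas.
    by apply/funext => x; rewrite /D mulrCA mulrA.
  apply: aeW => x; rewrite /D Normc.normcM.
  have [b0|bn0] := eqVneq (b x) 0; first by rewrite b0 mul0r Normc.normc0 !mulr0.
  by rewrite ler_wpM2r ?normc_ge0//; exact: arho.
pose G r x := \sum_al \sum_k b x * c s al k x * A r al k x.
have LG r : L2 (G r).
  apply: L2_sum => al; apply: L2_sum => k; apply: L2_Linfty => //.
  by apply: (@cutoff_Linfty _ _ Omega); exact: cutoff_mul.
have psE r : psdo_sum p a s (fun al x => th x * w r al x) = fun x =>
    (\sum_al \sum_k a s al k * K r al k x) + ((\sum_al \sum_k D r al k x) + G r x).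
  apply/funext => x; rewrite /psdo_sum /G -!big_split /=; apply: eq_bigr => al _.
  rewrite -!big_split /=; apply: eq_bigr => k _; rewrite WE.
  have E (t f kk d g aa : C) : kk = t - f -> aa * t = aa * kk + aa * f by move=> ->; ring.
  rewrite (E _ (b x * A r al k x) (K r al k x) 0 0)//; congr (_ + _).
  by rewrite /D; move: (A r al k x) => y; ring.
have LKs r : L2 (fun x => \sum_al \sum_k a s al k * K r al k x).
  by apply: L2_sum => al; apply: L2_sum => k; exact: L2Z.
have LDs r : L2 (fun x => \sum_al \sum_k D r al k x).
  by apply: L2_sum => al; apply: L2_sum => k; exact: (LD r al k).1.
(* The term [rho] beside [normc (a s al k)] appears when [b A_p V] is bounded through
   [A_p (b V) - K], so that only the norm of [th w] remains. *)
exists (fun r => (\sum_al \sum_k (normc (a s al k) + rho) * nrm (K r al k)) + nrm (G r)).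
  rewrite -[X in _ --> X](addr0 0); apply: cvgD; last exact: w_prec.
  apply: (@cvg_sum0 _ _ _ (fun al r => \sum_k (normc (a s al k) + rho) * nrm (K r al k))) => al.
  apply: (@cvg_sum0 _ _ _ (fun k r => (normc (a s al k) + rho) * nrm (K r al k))) => k.
  rewrite -[X in _ --> X](mulr0 (normc (a s al k) + rho)); apply: cvgM; first exact: cvg_cst.
  by apply: commutator_cvg0 => //; exact: w_null.
move=> r; rewrite psE.
apply: le_trans (nrmD (LKs r) (L2D (LDs r) (LG r))) _.
have h1 : nrm (fun x => \sum_al \sum_k a s al k * K r al k x) <=
    \sum_al \sum_k normc (a s al k) * nrm (K r al k).
  apply: le_trans (nrm_sum _ (fun al => L2_sum _ xpredT (fun k => L2Z (a s al k) (LK r al k)))) _.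
  apply: ler_sum => al _; apply: le_trans (nrm_sum _ (fun k => L2Z (a s al k) (LK r al k))) _.
  by apply: ler_sum => k _; rewrite nrmZ.
have h2 : nrm (fun x => \sum_al \sum_k D r al k x) <=
    \sum_al \sum_k (rho * (B s al k * nrm (fun x => th x * w r al x)) + rho * nrm (K r al k)).
  apply: le_trans (nrm_sum _ (fun al => L2_sum _ xpredT (fun k => (LD r al k).1))) _.
  apply: ler_sum => al _; apply: le_trans (nrm_sum _ (fun k => (LD r al k).1)) _.
  apply: ler_sum => k _; apply: le_trans (LD r al k).2 _.
  rewrite -mulrDr ler_wpM2l//.
  have -> : (fun x => b x * A r al k x) = fun x => psdoA (p s al k) (multB b (V r al)) x - K r al k x.
    have E (t f kk : C) : kk = t - f -> f = t - kk by move=> ->; ring.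
    by apply/funext => x; exact: E.
  have LP := L2_psdoA (Lp al k) (LW r al).
  apply: le_trans (nrmB LP (LK r al k)) _; rewrite lerD2r WE.
  exact: (psdoA_le (B0 s al k) (Lp al k) (@pB s al k) (LW r al)).
have h3 := nrmD (LDs r) (LG r).
have h4 : \sum_al \sum_k (rho * (B s al k * nrm (fun x => th x * w r al x)) + rho * nrm (K r al k)) =
    rho * (\sum_al \sum_k B s al k * nrm (fun x => th x * w r al x)) +
    \sum_al \sum_k rho * nrm (K r al k).
  rewrite mulr_sumr -big_split /=; apply: eq_bigr => al _.
  by rewrite mulr_sumr -big_split.
have h5 : \sum_al \sum_k (normc (a s al k) + rho) * nrm (K r al k) =
    \sum_al \sum_k normc (a s al k) * nrm (K r al k) + \sum_al \sum_k rho * nrm (K r al k).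
  rewrite -big_split /=; apply: eq_bigr => al _; rewrite -big_split /=; apply: eq_bigr => k _.
  by rewrite mulrDl.
rewrite h5; move: h1 h2 h3; rewrite h4.
have L (x y z t u v g : R) : x <= y -> z <= u + v -> t <= z + g -> x + t <= u + (y + v + g).
  by lra.
exact: L.
Qed.

End psdo_sum_localization.

Definition weighted (phi : Rn -> R) r al x : C := (Num.sqrt (phi x))%:C * w r al x.

Definition energy phi r : R := \sum_al nrm2 (weighted phi r al).

Definition qint phi r : C :=
  cI mu (fun x => (phi x)%:C * qform (fun al be => q al be x) (fun al => w r al x)).

Lemma weighted_L2 phi r al : test Omega phi -> L2 (weighted phi r al).
Proof. by move=> /test_sqrt /test_C0 /C0_cutoff tp; exact: w_L2. Qed.

Lemma qint_weighted phi r : test Omega phi ->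
  cinteg mu (fun x => qform (fun al be => q al be x) (fun al => weighted phi r al x)) /\
  qint phi r = cI mu (fun x => qform (fun al be => q al be x) (fun al => weighted phi r al x)).
Proof.
move=> tp; have cp := C0_cutoff (test_C0 (test_sqrt tp)).
have Lq al be : L2 (fun x => (Num.sqrt (phi x))%:C * q al be x * w r al x).
  by apply: w_L2; exact: cutoff_mul.
split.
  have [] := cI_sum (index_enum 'I_N) xpredT (fun al =>
    (cI_sum (index_enum 'I_N) xpredT (fun be => cinteg_ip (Lq al be) (weighted_L2 r be tp))).1).
  move=> I1 _; move: I1; congr cinteg; apply/funext => x.
  apply: eq_bigr => al _; apply: eq_bigr => be _.
  by congr (_ * _); rewrite /weighted; ring.
congr cI; apply/funext => x; rewrite /weighted qformZ sqr_sqrtr//.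
by case: tp.
Qed.

Lemma rho_exists (A e : R) : 0 <= A -> 0 < e -> exists2 rho, 0 < rho & A * rho ^+ 2 <= e.
Proof.
move=> A0 e0; have d0 : 0 < A + 1 by rewrite ltr_wpDl.
exists (Num.min 1 (e / (A + 1))); first by rewrite lt_min ltr01 divr_gt0.
set rho := Num.min _ _.
have r0 : 0 <= rho by rewrite le_min ler01 divr_ge0// ltW.
have r1 : rho <= 1 by rewrite ge_min lexx.
have r2 : rho <= e / (A + 1) by rewrite ge_min lexx orbT.
rewrite ler_pdivlMr// in r2.
by nra.
Qed.

Hypothesis q_pos : forall x, Omega x -> forall (l : 'I_N -> C) eta, spectrum eta ->
  (forall s, \sum_al \sum_k c s al k x * gelfand (p s al k) eta * l al = 0) ->
  0 <= Re (qform (fun al be => q al be x) l).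

(** An asymptotic lower bound written without lower limits. For fixed [delta] it is additive in
    [phi], since [energy] and [qint] are; this is what allows gluing. *)
Definition almost_pos delta phi := forall e, 0 < e -> exists r0 : nat, forall r, (r0 <= r)%N ->
  - delta * energy phi r - e <= Re (qint phi r).

(** [delta] is spent in quarters: on the symbol inequality, on the oscillation of [q], and on that
    of the coefficients [c] amplified by [k]. The box depends on [x0] and [delta] but not on [phi],
    as a covering argument demands. *)
Lemma local_estimate x0 delta : Omega x0 -> 0 < delta ->
  exists a b, [/\ openbox a b x0, closedbox a b `<=` Omega &
    forall phi, test (openbox a b) phi -> almost_pos delta phi].
Proof.
move=> Ox0 delta0.
pose q0 := fun al be => q al be x0; pose a0 := fun s al k => c s al k x0.
have d4 : 0 < delta / 4 by rewrite divr_gt0.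
have [k Hk] := symbol_inequality d4 pA (q_pos Ox0).
have Lp s al j : Linfty (p s al j) by case: (pA s al j).
have [B HB] := choice (fun t : 'I_m * 'I_N * 'I_M => Linfty_bound (Lp t.1.1 t.1.2 t.2)).
pose S := \sum_s (\sum_al \sum_j B (s, al, j)) ^+ 2.
have S0 : 0 <= S by apply: sumr_ge0 => s _; exact: sqr_ge0.
have kS0 : 0 <= 2 * k%:R * S by rewrite mulr_ge0// mulr_ge0.
(* The admissible oscillation [rho] of the coefficients is fixed after [k]: the squared norms of the
   operators carry the weight [k], and [2 k S rho^2] must not exceed [delta / 4]. *)
have [rho rho0 Hrho] := rho_exists kS0 d4.
(* The oscillation of [q] is summed over [N * N] entries; the added [1] keeps the divisor positive
   when [N = 0]. *)
have N0 : 0 < (N * N)%:R + 1 :> R by rewrite ltr_wpDl.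
have q4 : 0 < delta / 4 / ((N * N)%:R + 1) by rewrite divr_gt0.
have near1 : \forall y \near x0, Omega y /\ ((forall s al j, normc (c s al j y - c s al j x0) < rho) /\
    (forall al be, normc (q al be y - q al be x0) < delta / 4 / ((N * N)%:R + 1))).
  have ff (I : finType) (P : I -> set Rn) : (forall i, nbhs x0 (P i)) ->
      nbhs x0 (fun y => forall i, P i y).
    by move=> H; exact: (@filter_forall _ _ _ (nbhs x0) _ H).
  apply: filterI; first exact: open_nbhs_nbhs.
  apply: filterI.
    by apply: (ff) => s; apply: (ff) => al; apply: (ff) => j; exact: ccontinuous_near oO (cc s al j) Ox0 rho0.
  by apply: (ff) => al; apply: (ff) => be; exact: ccontinuous_near oO (qc al be) Ox0 q4.
have [a [b [abx0 ab]]] := nbhs_box near1.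
have abO : closedbox a b `<=` Omega by move=> x /ab[].
exists a, b; split => // phi tphi e e0.
have tO : test Omega phi.
  have [cp p0 [K [cK KV K0]]] := tphi; split => //; exists K; split => //.
  by apply: subset_trans KV _; apply: subset_trans abO; exact: openbox_closedbox.
have [_ phi0 [K [cK KV K0]]] := tphi.
have KO : K `<=` Omega by apply: subset_trans KV _; apply: subset_trans abO; exact: openbox_closedbox.
have cth := C0_cutoff (test_C0 (test_sqrt tO)).
have LW r al := weighted_L2 r al tO.
have nW al : wnull (fun r => weighted phi r al) := w_null cth al.
pose bb x : C := (Num.sqrt (phi x) / bump a b x)%:C.
have Cbb : C0 Omega bb.
  apply: (real_C0 (continuous_div_bump tphi) cK KO) => x /K0 ->.
  by rewrite sqrtr0 mul0r.
have thE x : (Num.sqrt (phi x))%:C = bb x * (bump a b x)%:C :> C.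
  rewrite /bb -rmorphM; congr _%:C.
  have [bx|bx] := eqVneq (bump a b x) 0; last by rewrite divfK.
  rewrite bx mulr0 K0 ?sqrtr0// => Kx.
  by have /bump_neq0 := KV x Kx; rewrite bx eqxx.
have arho s al j x : bb x != 0 -> normc (a0 s al j - c s al j x) <= rho.
  move=> bx; have Kx : K x.
    by apply: contrapT => /K0 p0; move: bx; rewrite /bb p0 sqrtr0 mul0r eqxx.
  have [_ [Hc _]] := ab x (openbox_closedbox (KV x Kx)).
  by rewrite -normcN opprB ltW.
have E1 s := psdo_sum_localized (C0infty_bump abO) Cbb thE
  (fun s al j => (HB (s, al, j)).1) (fun s al j => (HB (s, al, j)).2) (ltW rho0) arho s.
have E2 s : exists e : nat -> R, e r @[r --> \oo] --> (0 : R) /\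
    forall r, nrm (psdo_sum p a0 s (weighted phi r)) <=
      rho * (\sum_al \sum_j B (s, al, j) * nrm (weighted phi r al)) + e r.
  by have [e1 c1 b1] := E1 s; exists e1.
have [ee Hee] := choice E2.
have [j Kj] := bounded_cube (compact_bounded cK).
have W0 r al x : ~ cube j x -> weighted phi r al x = 0.
  by move=> nx; rewrite /weighted K0 ?sqrtr0 ?mul0r// => /Kj.
have low al := low_frequency_cvg0 k.+1 (fun r => LW r al) (nW al) (fun r => W0 r al).
pose err r := 2 * k%:R * (\sum_s ee s r ^+ 2) +
  qnorm q0 * \sum_al nrm2 (trunc k.+1 (fourier (weighted phi r al))).
have err0 : err r @[r --> \oo] --> (0 : R).
  have c1 : \sum_s ee s r ^+ 2 @[r --> \oo] --> (0 : R).
    apply: (@cvg_sum0 _ _ _ (fun s r => ee s r ^+ 2)) => s.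
    by have := cvgM (Hee s).1 (Hee s).1; rewrite mulr0 => c1; under eq_fun do rewrite expr2; exact: c1.
  have c2 : \sum_al nrm2 (trunc k.+1 (fourier (weighted phi r al))) @[r --> \oo] --> (0 : R).
    exact: (@cvg_sum0 _ _ _ (fun al r => nrm2 (trunc k.+1 (fourier (weighted phi r al))))).
  suff : err r @[r --> \oo] --> (2 * k%:R * 0 + qnorm q0 * 0 : R) by rewrite !mulr0 addr0.
  by apply: cvgD; apply: cvgM => //; exact: cvg_cst.
have /cvg0P/(_ e e0)[r0 Hr0] := err0.
exists r0 => r /Hr0 er; have {}er := le_lt_trans (ler_norm _) er.
set T := energy phi r.
have T0 : 0 <= T by apply: sumr_ge0 => al _; exact: nrm2_ge0.
have Wr al : L2 (weighted phi r al) := LW r al.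
have h2 := form_lower_bound d4 Lp Hk Wr.
(* Unfreezing the form: on the box the coefficients [q] and [q0] differ by at most [delta / 4] in
   [qnorm], and off [K] both integrands vanish. *)
have h1 : Re (\sum_al \sum_be q0 al be * ip (weighted phi r al) (weighted phi r be)) - delta / 4 * T
    <= Re (qint phi r).
  have [Iq ->] := qint_weighted r tO.
  have [I0 E0] := cI_qform q0 Wr; have [IT ET] := cI_sqn Wr.
  have I2 := cintegB I0 (cintegZ (delta / 4)%:C IT).
  have := Re_cI_le I2 Iq.
  rewrite (cIB I0 (cintegZ _ IT)) (cIZ _ IT) E0 ET cReB -rmorphM /=; apply; apply: aeW => x.
  rewrite cReB cReM /= mul0r subr0.
  have [Kx|nKx] := pselect (K x); last first.
    have W0' al : weighted phi r al x = 0 by rewrite /weighted K0// sqrtr0 mul0r.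
    have q00 (qq : 'I_N -> 'I_N -> C) : qform qq (fun al => weighted phi r al x) = 0.
      by rewrite /qform big1// => al _; rewrite big1// => be _; rewrite !W0' mulr0 mul0r.
    rewrite !q00 /= sub0r oppr_le0 mulr_ge0 ?sqn_ge0// ltW//.
  have [_ [_ Hq]] := ab x (openbox_closedbox (KV x Kx)).
  set l := fun al => weighted phi r al x.
  have Eq : qform (fun al be => q al be x) l = qform q0 l + qform (fun al be => q al be x - q0 al be) l.
    rewrite /qform -big_split; apply: eq_bigr => al _; rewrite -big_split; apply: eq_bigr => be _ /=.
    by ring.
  have qn : qnorm (fun al be => q al be x - q0 al be) <= delta / 4.
    rewrite /qnorm; apply: (@le_trans _ _ (\sum_(al < N) \sum_(be < N) (delta / 4 / ((N * N)%:R + 1)))).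
      by apply: ler_sum => al _; apply: ler_sum => be _; exact/ltW/Hq.
    rewrite !sumr_const !card_ord; have t0 := ltW d4; move: (delta / 4) t0 => t t0.
    by rewrite -[X in X <= _]mulrnA -[X in X <= _]mulr_natr mulrAC ler_pdivrMr// ler_wpM2l// lerDl.
  rewrite Eq cReD lerD2l.
  have := qform_bound (fun al be => q al be x - q0 al be) l.
  have := normc_Re (qform (fun al be => q al be x - q0 al be) l); rewrite ler_norml => /andP[H1 _] H2.
  apply: le_trans H1; rewrite lerN2; apply: le_trans H2 _.
  by rewrite ler_wpM2r ?sqn_ge0.
(* The factors [2] come from [(x + y)^2 <= 2 x^2 + 2 y^2], which separates the oscillation term from
   the error [ee]. *)
have h3 : k%:R * (\sum_s nrm2 (psdo_sum p a0 s (weighted phi r))) <=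
    delta / 4 * T + 2 * k%:R * (\sum_s ee s r ^+ 2).
  have hs s : nrm2 (psdo_sum p a0 s (weighted phi r)) <=
      2 * rho ^+ 2 * T * (\sum_al \sum_j0 B (s, al, j0)) ^+ 2 + 2 * ee s r ^+ 2.
    have Bs0 : 0 <= \sum_al \sum_j0 B (s, al, j0).
      by apply: sumr_ge0 => al _; apply: sumr_ge0 => j0 _; exact: (HB (s, al, j0)).1.
    have Ps : \sum_al \sum_j0 B (s, al, j0) * nrm (weighted phi r al) <=
        (\sum_al \sum_j0 B (s, al, j0)) * Num.sqrt T.
      rewrite mulr_suml; apply: ler_sum => al _; rewrite mulr_suml; apply: ler_sum => j0 _.
      apply: ler_wpM2l; first exact: (HB (s, al, j0)).1.
      rewrite /nrm ler_wsqrtr// /T /energy (bigD1 al)//= lerDl sumr_ge0// => be _.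
      exact: nrm2_ge0.
    have Hs := le_trans ((Hee s).2 r) (lerD (ler_wpM2l (ltW rho0) Ps) (lexx _)).
    have n0 := nrm_ge0 (psdo_sum p a0 s (weighted phi r)).
    have sT : Num.sqrt T ^+ 2 = T by rewrite sqr_sqrtr.
    rewrite -sqr_nrm -{}sT.
    move: n0 Hs; move: (nrm _) (\sum_al _) (Num.sqrt T) (ee s r) => X P t ev X0 Xle.
    have : X ^+ 2 <= (rho * (P * t) + ev) ^+ 2 by rewrite ler_pXn2r ?nnegrE//; exact: le_trans X0 Xle.
    move=> /le_trans; apply; rewrite -subr_ge0.
    rewrite (_ : _ - _ = (rho * (P * t) - ev) ^+ 2); first exact: sqr_ge0.
    by ring.
  have : \sum_s nrm2 (psdo_sum p a0 s (weighted phi r)) <= 2 * rho ^+ 2 * T * S + 2 * (\sum_s ee s r ^+ 2).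
    apply: le_trans (ler_sum _ (fun s _ => hs s)) _.
    by rewrite big_split /= -mulr_sumr -mulr_sumr.
  move=> /(ler_wpM2l (ler0n R k)) /le_trans; apply.
  have := ler_wpM2r T0 Hrho; move: (\sum_s _) => X H.
  rewrite (_ : k%:R * (2 * rho ^+ 2 * T * S + 2 * X) = 2 * k%:R * S * rho ^+ 2 * T + 2 * k%:R * X).
    by rewrite lerD2r.
  by ring.
have L (x1 x2 x3 x4 t d f g : R) : x1 - d / 4 * t <= x2 -> - (d / 4) * t - x3 - g <= x1 ->
    x3 <= d / 4 * t + x4 -> x4 + g < f -> 0 <= t -> 0 < d -> - d * t - f <= x2.
  by move=> *; nra.
exact: (L _ _ _ _ _ _ _ _ h1 h2 h3 er T0 delta0).
Qed.

End local_estimate.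

Lemma compact_seq_cover (T : ptopologicalType) (I : choiceType) (D : set I) (f : I -> set T)
  (K : set T) : compact K -> (forall i, D i -> open (f i)) -> K `<=` cover D f ->
  exists s : seq I, (forall i, i \in s -> D i) /\ forall x, K x -> exists2 i, i \in s & f i x.
Proof.
rewrite compact_cover => cK oD cov; have [D' D'D KD'] := cK _ _ _ oD cov.
exists (finmap.enum_fset D'); split => [i /D'D /set_mem//|x Kx].
by have [i iD' fx] := KD' x Kx; exists i.
Qed.

(** * From local to global *)

Section covering.
Context {R : realType} {n N : nat}.
Local Notation "x ^*" := (conjc x) : ring_scope.
Local Notation Rn := 'rV[R]_n.
Local Notation C := R[i].
Local Notation mu := (@leb R n).
Variables (Omega : set Rn) (w : nat -> 'I_N -> Rn -> C) (q : 'I_N -> 'I_N -> Rn -> C).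
Hypotheses (oO : open Omega).
Hypothesis w_L2 : forall g, cutoff Omega g -> forall r al, L2 (fun x => g x * w r al x).
Hypothesis qc : forall al be, ccontinuous Omega (q al be).

(** Rewrites the energy linearly in [phi]; its definition through square roots hides the additivity
    used in the gluing. *)
Lemma energy_int phi r : test Omega phi ->
  mu.-integrable setT (EFin \o (fun x => phi x * sqn (fun al => w r al x))) /\
  energy w phi r = \int[mu]_x (phi x * sqn (fun al => w r al x)).
Proof.
move=> tp; have [_ p0 _] := tp.
have [I1 E1] := cI_sqn (fun al => weighted_L2 w_L2 r al tp).
have E : (fun x => (sqn (fun al => weighted w phi r al x))%:C : C) =
    fun x => (phi x * sqn (fun al => w r al x))%:C.
  by apply/funext => x; rewrite /weighted sqnZ sqr_sqrtr.
rewrite E in I1 E1; split; first exact: I1.1.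
by move: E1; rewrite cI_real => -[].
Qed.

Lemma energyD phi psi r : test Omega phi -> test Omega psi -> test Omega (fun x => phi x + psi x) ->
  energy w (fun x => phi x + psi x) r = energy w phi r + energy w psi r.
Proof.
move=> t1 t2 t3; have [I1 E1] := energy_int r t1; have [I2 E2] := energy_int r t2.
have [_ ->] := energy_int r t3; rewrite E1 E2 -RintegralD//.
by apply: eq_Rintegral => x _; rewrite mulrDl.
Qed.

Lemma qint_cinteg phi r : test Omega phi ->
  cinteg mu (fun x => (phi x)%:C * qform (fun al be => q al be x) (fun al => w r al x)).
Proof.
move=> tp; have [+ _] := qint_weighted oO w_L2 qc r tp; congr cinteg; apply/funext => x.
by rewrite /weighted qformZ sqr_sqrtr//; case: tp.
Qed.

Lemma qintD phi psi r : test Omega phi -> test Omega psi ->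
  qint w q (fun x => phi x + psi x) r = qint w q phi r + qint w q psi r.
Proof.
move=> t1 t2; rewrite /qint -cID; [|exact: qint_cinteg|exact: qint_cinteg].
by congr cI; apply/funext => x; rewrite rmorphD mulrDl.
Qed.

Lemma testD V phi psi : test V phi -> test V psi -> test V (fun x : Rn => phi x + psi x).
Proof.
move=> [c1 p1 [K1 [k1 K1V z1]]] [c2 p2 [K2 [k2 K2V z2]]]; split.
- by move=> x; exact: continuousD (c1 x) (c2 x).
- by move=> x; exact: addr_ge0.
- exists (K1 `|` K2); split; first exact: compactU.
    by move=> x []; [exact: K1V|exact: K2V].
  by move=> x nx; rewrite z1 ?z2 ?addr0// => Kx; apply: nx; [right|left].
Qed.

Lemma test0 V : test V (fun _ : Rn => 0 : R).
Proof.
split=> //; first by move=> x; exact: cst_continuous.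
by exists set0; split => //; exact: compact0.
Qed.

Lemma almost_posD delta phi psi : test Omega phi -> test Omega psi ->
  almost_pos w q delta phi -> almost_pos w q delta psi -> almost_pos w q delta (fun x => phi x + psi x).
Proof.
move=> t1 t2 H1 H2 e e0; have e2 : 0 < e / 2 by rewrite divr_gt0.
have [r1 h1] := H1 _ e2; have [r2 h2] := H2 _ e2.
exists (maxn r1 r2) => r; rewrite geq_max => /andP[l1 l2].
rewrite (energyD r t1 t2 (testD t1 t2)) (qintD r t1 t2) cReD.
have := h1 r l1; have := h2 r l2; move: (energy _ _ _) (energy _ _ _) (Re _) (Re _) => *; lra.
Qed.

Lemma almost_pos_sum delta (I : eqType) (s : seq I) (phi : I -> Rn -> R) :
  (forall i, i \in s -> test Omega (phi i)) -> (forall i, i \in s -> almost_pos w q delta (phi i)) ->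
  test Omega (fun x => \sum_(i <- s) phi i x) /\
  almost_pos w q delta (fun x => \sum_(i <- s) phi i x).
Proof.
elim: s => [|i s IH] Ht Hp.
  under eq_fun do rewrite big_nil; split; first exact: test0.
  move=> e e0; exists 0%N => r _.
  have [_ ->] := energy_int r (test0 Omega).
  rewrite [X in _ * X](_ : _ = 0); last first.
    by rewrite /Rintegral integral0_eq// => x _; rewrite mul0r.
  rewrite mulr0 sub0r (_ : qint _ _ _ _ = 0) ?oppr_le0 ?ltW//.
  by rewrite /qint -[RHS](cI0 mu); congr cI; apply/funext => x; rewrite mul0r.
have [t1 p1] : test Omega (phi i) /\ almost_pos w q delta (phi i).
  by split; [apply: Ht|apply: Hp]; rewrite mem_head.
have [t2 p2] : test Omega (fun x => \sum_(i <- s) phi i x) /\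
    almost_pos w q delta (fun x => \sum_(i <- s) phi i x).
  by apply: IH => j js; [apply: Ht|apply: Hp]; rewrite inE js orbT.
under eq_fun do rewrite big_cons; split; [exact: testD|exact: almost_posD].
Qed.

(** [phi] is split into the pieces [phi * bump_i / sigma], where [sigma] is the sum of finitely many
    bumps and is positive on the support of [phi]. Finitely many thresholds in [r] have a
    maximum. *)
Lemma global_estimate delta phi : 
  (forall x0, Omega x0 -> exists a b, [/\ openbox a b x0, closedbox a b `<=` Omega &
    forall phi, test (openbox a b) phi -> almost_pos w q delta phi]) ->
  test Omega phi -> almost_pos w q delta phi.
Proof.
move=> loc tphi; have [cphi phi0 [K [cK KO K0]]] := tphi.
(* A bump is nonzero on its whole open box, so its support is the closed box. The boxes of [loc] are
   shrunk, and the estimate is recorded for functions vanishing off the smaller closed box. *)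
pose D : set (Rn * Rn) := [set ab | closedbox ab.1 ab.2 `<=` Omega /\
  forall psi : Rn -> R, continuous psi -> (forall x, 0 <= psi x) ->
  (forall x, ~ closedbox ab.1 ab.2 x -> psi x = 0) -> almost_pos w q delta psi].
have cov : K `<=` cover D (fun ab => openbox ab.1 ab.2).
  move=> x /KO Ox; have [a [b [xab abO Hab]]] := loc x Ox.
  have [a' [b' [x' ab']]] := nbhs_box (open_nbhs_nbhs (conj (@open_openbox _ _ a b) xab)).
  exists (a', b') => //; split => /= [|psi cpsi psi0 z].
    by apply: subset_trans ab' _; apply: subset_trans abO; exact: openbox_closedbox.
  apply: Hab; split => //; exists (closedbox a' b'); split => //.
  exact: compact_closedbox.
have [|s [sD Ks]] := compact_seq_cover cK _ cov; first by move=> i _; exact: open_openbox.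
pose sigma x := \sum_(ab <- s) bump ab.1 ab.2 x.
have csigma : continuous sigma.
  apply: sfam_continuous; rewrite /sigma; elim: (s) => [|i t IH].
    by under eq_fun do rewrite big_nil; exact: sfam_cst.
  by under eq_fun do rewrite big_cons; apply: sfam_add => //; exact: sfam_bump.
have sig0 x : K x -> sigma x != 0.
  move=> /Ks[ab abs xab]; rewrite gt_eqF// /sigma (big_rem ab)//=.
  rewrite ltr_pwDl ?sumr_ge0//; last by move=> i _; exact: bump_ge0.
  by rewrite lt_neqAle bump_ge0 andbT eq_sym; apply/bump_neq0.
pose phi_ (ab : Rn * Rn) x := phi x / sigma x * bump ab.1 ab.2 x.
have cq : continuous (fun x => phi x / sigma x).
  move=> x; have [Kx|nKx] := pselect (K x).
    apply: (@continuousM _ _ phi (fun y => (sigma y)^-1)); first exact: cphi.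
    by apply: (@continuousV _ _ sigma); [exact: sig0|exact: csigma].
  have : \forall y \near x, 0 = phi y / sigma y.
    have oK : open (~` K).
      by apply: closed_openC; exact: compact_rV_closed.
    by have := open_nbhs_nbhs (conj oK nKx); apply: filterS => y /K0 ->; rewrite mul0r.
  move=> nE; rewrite /continuous_at -(nbhs_singleton nE).
  by apply: cvg_trans (near_eq_cvg nE) _; exact: cvg_cst.
have phiE : phi = fun x => \sum_(ab <- s) phi_ ab x.
  apply/funext => x; rewrite /phi_ -mulr_sumr -/(sigma x).
  have [Kx|/K0 ->] := pselect (K x); last by rewrite !mul0r.
  by rewrite divfK// sig0.
have cphi_ ab : continuous (phi_ ab).
  by move=> x; exact: continuousM (cq x) (sfam_continuous (sfam_bump ab.1 ab.2) (x := x)).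
have phi_0 ab x : 0 <= phi_ ab x.
  rewrite mulr_ge0 ?bump_ge0// divr_ge0// sumr_ge0// => i _; exact: bump_ge0.
have z ab x : ~ closedbox ab.1 ab.2 x -> phi_ ab x = 0.
  move=> nx; rewrite /phi_; suff -> : bump ab.1 ab.2 x = 0 by rewrite mulr0.
  apply/eqP/negPn/negP => /bump_neq0 Hx; apply: nx; exact: openbox_closedbox.
rewrite phiE; apply: (almost_pos_sum _ _).2 => ab abs.
  have [abO _] := sD ab abs; split => //.
  by exists (closedbox ab.1 ab.2); split; [exact: compact_closedbox|exact: abO|exact: z].
by have [_ H] := sD ab abs; apply: H => //; exact: z.
Qed.

End covering.

(** * From test functions to Borel sets *)

Section regularity.
Context {R : realType} {n : nat}.
Local Notation Rn := 'rV[R]_n.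
Implicit Types (phi : Rn -> R) (x a b : Rn) (A B F G K V : set Rn).

(** Each bump is divided by half its value at a chosen centre, so it exceeds [1] near that centre.
    Finitely many of these neighbourhoods cover [F]; the sum of the rescaled bumps is then capped at
    [1]. *)
Lemma urysohn_bump F V : compact F -> open V -> F `<=` V ->
  exists phi, [/\ test V phi, forall x, phi x <= 1 & forall x, F x -> phi x = 1].
Proof.
move=> cF oV FV.
pose D : set (Rn * (Rn * Rn)) := [set i | bump i.2.1 i.2.2 i.1 != 0 /\ closedbox i.2.1 i.2.2 `<=` V].
pose f (i : Rn * (Rn * Rn)) := [set y : Rn | bump i.2.1 i.2.2 i.1 < 2 * bump i.2.1 i.2.2 y].
have cb a b : continuous (@bump R n a b) by exact: sfam_continuous (sfam_bump a b).
have of_ i : D i -> open (f i).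
  move=> _; rewrite (_ : f i = bump i.2.1 i.2.2 @^-1` [set t | bump i.2.1 i.2.2 i.1 / 2 < t]).
    by apply: open_comp => [y _|]; [exact: cb|exact: open_gt].
  by apply/seteqP; split => y /=; rewrite /f/= ltr_pdivrMr// mulrC.
have pos (i : Rn * (Rn * Rn)) : D i -> 0 < bump i.2.1 i.2.2 i.1.
  by move=> [b0 _]; rewrite lt_neqAle bump_ge0 andbT eq_sym.
have cov : F `<=` cover D f.
  move=> x /FV Vx; have [a [b [xab abV]]] := nbhs_box (open_nbhs_nbhs (conj oV Vx)).
  have bx : bump a b x != 0 by apply/bump_neq0.
  exists (x, (a, b)) => //; rewrite /f/= mulrC ltr_pMr ?ltr1n//.
  by rewrite lt_neqAle bump_ge0 andbT eq_sym.
have [s [sD Fs]] := compact_seq_cover cF of_ cov.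
pose g (i : Rn * (Rn * Rn)) y := 2 / bump i.2.1 i.2.2 i.1 * bump i.2.1 i.2.2 y.
have g0 i y : 0 <= g i y by rewrite mulr_ge0 ?bump_ge0// divr_ge0// bump_ge0.
pose phi0 y := \sum_(i <- s) g i y.
have ts : test V phi0.
  rewrite /phi0; have : forall i, i \in s -> D i by [].
  elim: (s) => [|i t IH] Ht; first by under eq_fun do rewrite big_nil; exact: test0.
  under eq_fun do rewrite big_cons; apply: testD; last first.
    by apply: IH => j jt; apply: Ht; rewrite inE jt orbT.
  split; [|exact: g0|].
    move=> y; apply: (@continuousM _ _ (fun=> 2 / bump i.2.1 i.2.2 i.1) (bump i.2.1 i.2.2)).
      exact: cst_continuous.
    exact: cb.
  have [_ abV] := Ht i (mem_head _ _).
  exists (closedbox i.2.1 i.2.2); split => //; first exact: compact_closedbox.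
  move=> y ny; rewrite /g; suff -> : bump i.2.1 i.2.2 y = 0 by rewrite mulr0.
  by apply/eqP/negPn/negP => /bump_neq0 Hy; apply: ny; exact: openbox_closedbox.
have [cp p0 [K [cK KV K0]]] := ts.
exists (fun y => Num.min (phi0 y) 1); split => [|x|x /Fs[i si fx]].
- split.
  + by move=> y; apply: (@continuous_min _ _ phi0 (fun=> 1)); [exact: cp|exact: cst_continuous].
  + by move=> y; rewrite le_min p0 ler01.
  + by exists K; split => // y /K0 ->; rewrite min_l.
- by rewrite ge_min lexx orbT.
- apply: min_r; apply: (@le_trans _ _ (g i x)).
    rewrite /g mulrAC ler_pdivlMr ?pos ?mul1r ?ltW//; exact: sD.
  by rewrite /phi0 (big_rem i)//= lerDl sumr_ge0.
Qed.

Section regular_measure.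
Variables (m : {measure set Rn -> \bar R}) (K : set Rn).
Hypotheses (mK : measurable K) (mKfin : (m K < +oo)%E).

Lemma measure_vanish (H : nat -> set Rn) (e : R) : 0 < e -> (forall k, measurable (H k)) ->
  (forall k, H k `<=` K) -> nonincreasing_seq H -> \bigcap_k H k = set0 ->
  exists k, (m (H k) <= e%:E)%E.
Proof.
move=> e0 mH HK nH H0.
have fin k : m (H k) \is a fin_num.
  rewrite ge0_fin_numE//; apply: le_lt_trans mKfin.
  by apply: le_measure => //; rewrite inE.
have := @nonincreasing_cvg_mu _ _ _ m H _ mH _ nH.
rewrite H0 measure0 -ge0_fin_numE// => /(_ (fin 0%N) measurable0).
move=> /fine_cvg /cvg0P/(_ e e0)[k /(_ k (leqnn k))] /= Hk.
exists k; rewrite -(fineK (fin k)) lee_fin; apply: le_trans (ltW Hk); exact: ler_norm.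
Qed.

(** Regularity relative to [K]: the measures in question are known to be finite on compact subsets
    of [Omega] only. *)
Definition regular A := forall e : R, 0 < e -> exists F G,
  [/\ closed F, open G, F `<=` A, A `<=` G & (m ((G `\` F) `&` K) <= e%:E)%E].

Lemma regularC A : regular A -> regular (~` A).
Proof.
move=> rA e /rA[F [G [cF oG FA AG mGF]]].
exists (~` G), (~` F); split; [exact: open_closedC|exact: closed_openC|exact: subsetC|exact: subsetC|].
by rewrite [_ `\` _](_ : _ = G `\` F)// setDE setCK setIC.
Qed.

(** The open sets are united with errors [e / 2^(k+2)]. A countable union of closed sets need not be
    closed, so finitely many are kept; what is lost inside [K] has small measure by continuity from
    above. *)
Lemma regular_bigcup (A : nat -> set Rn) : (forall k, regular (A k)) -> regular (\bigcup_k A k).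
Proof.
move=> rA e e0; have e2 : 0 < e / 2 by rewrite divr_gt0.
have ek k : 0 < e / 2 / (2 ^ k.+1)%:R by rewrite divr_gt0// ltr0n expn_gt0.
have [F HF] := choice (fun k => rA k _ (ek k)).
have [G HG] := choice HF.
pose Fn k := \big[setU/set0]_(i < k) F i.
have cFn k : closed (Fn k).
  rewrite /Fn; elim: k => [|k IH]; first by rewrite big_ord0; exact: closed0.
  by rewrite big_ord_recr; apply: closedU => //; have [] := HG k.
have mF k : measurable (F k) by apply: closed_rV_measurable; have [] := HG k.
have mG k : measurable (G k) by apply: open_rV_measurable; have [] := HG k.
pose H k := ((\bigcup_i F i) `\` Fn k) `&` K.
have mH k : measurable (H k).
  apply: measurableI => //; apply: measurableD; first exact: bigcup_measurable.
  exact: closed_rV_measurable.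
have [k Hk] : exists k, (m (H k) <= (e / 2)%:E)%E.
  apply: measure_vanish => // [k x []//|i j ij|].
    apply/subsetPset => x [[xF nxF] Kx]; split => //; split => // xF'; apply: nxF.
    move: xF'; rewrite /Fn -!bigcup_mkord => -[l /= li Fl]; exists l => //=.
    exact: leq_trans li ij.
  rewrite -subset0 => x Hx; have [[[i _ Fi] _] _] := Hx 0%N Logic.I.
  have [[_ +] _] := Hx i.+1 Logic.I; apply.
  by rewrite /Fn -bigcup_mkord; exists i => //=.
exists (Fn k), (\bigcup_i G i); split => //.
- by apply: bigcup_open => i _; have [] := HG i.
- by rewrite /Fn -bigcup_mkord => x [i _ Fi]; exists i => //; have [_ _ + _ _] := HG i; exact.
- by move=> x [i _ Ai]; exists i => //; have [_ _ _ + _] := HG i; exact.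
pose D i := (G i `\` F i) `&` K.
have mD i : measurable (D i) by apply: measurableI => //; exact: measurableD.
have mUD : measurable (\bigcup_i D i) by exact: bigcup_measurable.
apply: (@le_trans _ _ (m ((\bigcup_i D i) `|` H k))).
  apply: le_measure; rewrite ?inE.
  - apply: measurableI => //; apply: measurableD; first exact: bigcup_measurable.
    exact: closed_rV_measurable.
  - exact: measurableU.
  - move=> x [[[i _ Gi] nF] Kx].
    have [Fx|nFx] := pselect ((\bigcup_i F i) x); [right|left]; first by split.
    by exists i => //; split => //; split => // Fi; apply: nFx; exists i.
apply: le_trans (measureU2 _ mUD (mH k)) _.
rewrite [e in (_ <= e%:E)%E]splitr EFinD; apply: leeD Hk.
apply: le_trans (measure_sigma_subadditive m mD mUD (@subset_refl _ _)) _.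
apply: le_trans (epsilon_trick0 xpredT (ltW e2)).
by apply: lee_nneseries => // i _; have [_ _ _ _] := HG i.
Qed.

(** Boxes being open on the left and closed on the right, the inner set moves the left faces inwards
    and the outer set the right faces outwards, by [1/(k+1)]; the sets between them decrease to the
    empty set. *)
Lemma regular_box a b : regular (rV_box a b).
Proof.
move=> e e0.
pose F k : set Rn := [set x | forall i, a 0 i + k.+1%:R^-1 <= x 0 i <= b 0 i].
pose G k : set Rn := [set x | forall i, a 0 i < x 0 i < b 0 i + k.+1%:R^-1].
have k0 k : 0 < k.+1%:R^-1 :> R by rewrite invr_gt0.
have cF k : closed (F k).
  rewrite (_ : F k = closedbox (\row_i (a 0 i + k.+1%:R^-1)) b).
    by apply: compact_rV_closed; exact: compact_closedbox.
  by apply/seteqP; split => x Hx i; have := Hx i; rewrite in_itv/= mxE.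
have oG k : open (G k).
  rewrite (_ : G k = openbox a (\row_i (b 0 i + k.+1%:R^-1))); first exact: open_openbox.
  by apply/seteqP; split => x Hx i; have := Hx i; rewrite mxE.
pose H k := (G k `\` F k) `&` K.
have mH k : measurable (H k).
  apply: measurableI => //; apply: measurableD; first exact: open_rV_measurable.
  exact: closed_rV_measurable.
have [k Hk] : exists k, (m (H k) <= e%:E)%E.
  have inv_le i j : (i <= j)%N -> j.+1%:R^-1 <= i.+1%:R^-1 :> R.
    by move=> ij; rewrite lef_pV2 ?posrE// ler_nat.
  apply: measure_vanish => // [k x []//|i j ij|].
    apply/subsetPset => x [[Gx nFx] Kx]; split => //; split.
      by move=> l; have /andP[-> /=] := Gx l; move/lt_le_trans; apply; rewrite lerD2l inv_le.
    move=> Fx; apply: nFx => l; have /andP[+ ->] := Fx l; rewrite andbT; apply: le_trans.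
    by rewrite lerD2l inv_le.
  rewrite -subset0 => x Hx.
  have big (t : R) : 0 < t -> exists k : nat, k.+1%:R^-1 <= t.
    move=> t0; exists (Num.truncn t^-1); rewrite invf_ple ?posrE//.
    by apply/ltW; exact: Num.Theory.truncnS_gt.
  have xa i : a 0 i < x 0 i by have [[/(_ i)/andP[]]] := Hx 0%N Logic.I.
  have xb i : x 0 i <= b 0 i.
    rewrite leNgt; apply/negP; rewrite -subr_gt0 => /big[k Hk].
    have [[/(_ i)/andP[_]]] := Hx k Logic.I; rewrite -ltrBlDl => /lt_le_trans/(_ Hk).
    by rewrite ltxx.
  have [k Hk] : exists k : nat, forall i, k.+1%:R^-1 <= x 0 i - a 0 i.
    have xa' i : 0 < x 0 i - a 0 i by rewrite subr_gt0.
    have [kk Hkk] := choice (fun i => big _ (xa' i)).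
    exists (\max_i kk i) => i; apply: le_trans (Hkk i); apply: inv_le.
    exact: (@leq_bigmax _ kk i).
  have [[_ +] _] := Hx k Logic.I; apply => i; rewrite xb andbT -lerBrDl; exact: Hk.
exists (F k), (G k); split => // x Hx i.
  by have /andP[h1 ->] := Hx i; rewrite andbT; apply: lt_le_trans h1; rewrite ltrDl.
by have /andP[-> h2] := Hx i; apply: le_lt_trans h2 _; rewrite ltrDl.
Qed.

(** The regular sets form a sigma-algebra containing the boxes. *)
Lemma measurable_regular A : measurable A -> regular A.
Proof.
move=> /measurable_rV_boxesE; apply: smallest_sub => //; last first.
  by move=> _ [a [b ->]]; exact: regular_box.
have r0 : regular set0.
  move=> e e0; exists set0, set0; split; [exact: closed0|exact: open0|by []|by []|].
  by rewrite set0D set0I measure0 lee_fin ltW.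
split=> //; first by move=> B rB; rewrite setTD; exact: regularC.
exact: regular_bigcup.
Qed.

End regular_measure.

End regularity.

Section sandwich.
Context d (T : measurableType d) {R : realType}.
Variable nu : {measure set T -> \bar R}.

Lemma integrable_bounded_mul (M : R) (phi h : T -> R) : measurable_fun setT phi ->
  (forall x, `|phi x| <= M) -> nu.-integrable setT (EFin \o h) ->
  nu.-integrable setT (EFin \o (fun x => phi x * h x)).
Proof.
move=> mp pM ih.
have mh : measurable_fun setT h by have /integrableP[/measurable_EFinP] := ih.
apply: (le_integrable measurableT _ _ (integrableZ_EFin M ih)).
  by apply/measurable_EFinP; exact: measurable_funM.
move=> x _ /=; rewrite lee_fin !normrM ler_wpM2r//; apply: le_trans (pM x) _; exact: ler_norm.
Qed.

(** Serves for three measures: Lebesgue measure with a density [h], and each of the two parts of [v]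
    with [h] the indicator of a compact set. *)
Lemma Rintegral_sandwich (phi h : T -> R) (B D : set T) : measurable B -> measurable D ->
  measurable_fun setT phi -> nu.-integrable setT (EFin \o h) ->
  (forall x, `|phi x - \1_B x| <= \1_D x) ->
  `|\int[nu]_x (phi x * h x) - \int[nu]_(x in B) h x| <= \int[nu]_(x in D) `|h x|.
Proof.
move=> mB mD mp ih H.
have ind1 (A : set T) x : `|\1_A x : R| <= 1.
  by rewrite indicE; case: (_ \in _); rewrite ?normr1 ?normr0.
have p2 x : `|phi x| <= 2.
  have := H x; have := ind1 B x; have := ind1 D x.
  have : `|phi x| <= `|phi x - \1_B x| + `|\1_B x| by rewrite -{1}(subrK (\1_B x) (phi x)) ler_normD.
  have := ler_norm (\1_D x : R); lra.
have i1 := integrable_bounded_mul mp p2 ih.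
have i2 := integrable_bounded_mul (measurable_indic mB) (ind1 B) ih.
have ia : nu.-integrable setT (EFin \o (fun x => `|h x|)) by have := integrable_norm ih.
have i3 := integrable_bounded_mul (measurable_indic mD) (ind1 D) ia.
have mk (A : set T) (g : T -> R) : \int[nu]_(x in A) g x = \int[nu]_x (\1_A x * g x).
  rewrite Rintegral_mkcond; apply: eq_Rintegral => x _; rewrite patchE indicE.
  by case: (x \in A); rewrite ?mul1r ?mul0r.
rewrite (mk B) (mk D) -RintegralB//.
have i4 : nu.-integrable setT (EFin \o (fun x => phi x * h x - \1_B x * h x)).
  by have := integrableB measurableT i1 i2.
apply: le_trans (le_normr_Rintegral measurableT i4) _.
apply: le_Rintegral => //; first by have := integrable_norm i4.
by move=> x _; rewrite -mulrBl normrM ler_wpM2r.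
Qed.

End sandwich.

(** * Passage to the limit in the quadratic form *)

Section weak_limit.
Context {R : realType} {n N : nat}.
Local Notation "x ^*" := (conjc x) : ring_scope.
Local Notation Rn := 'rV[R]_n.
Local Notation C := R[i].
Local Notation mu := (@leb R n).
Variables (Omega : set Rn) (u_ : nat -> 'I_N -> Rn -> C) (u : 'I_N -> Rn -> C).
Variable q : 'I_N -> 'I_N -> Rn -> C.
Hypotheses (oO : open Omega) (Lu_ : forall r al, L2loc Omega (u_ r al)).
Hypotheses (Lu : forall al, L2loc Omega (u al)).
Hypothesis u_weak : forall al, L2loc_weak_cvg Omega (u_ ^~ al) (u al).
Hypothesis qc : forall al be, ccontinuous Omega (q al be).
Local Notation w := (fun r al x => u_ r al x - u al x).

Definition bform (l l' : 'I_N -> C) x : C := \sum_a \sum_b q a b x * l a * (l' b)^*.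

(** The weight is a square, so that each argument of the form receives one factor [t] and becomes
    square integrable; the coefficient [q] joins the first. *)
Lemma cI_bform (t : Rn -> R) (f g : 'I_N -> Rn -> C) : cutoff Omega (fun x => (t x)%:C) ->
  (forall h, cutoff Omega h -> forall al, L2 (fun x => h x * f al x)) ->
  (forall h, cutoff Omega h -> forall al, L2 (fun x => h x * g al x)) ->
  cinteg mu (fun x => (t x ^+ 2)%:C * bform (fun al => f al x) (fun al => g al x) x) /\
  cI mu (fun x => (t x ^+ 2)%:C * bform (fun al => f al x) (fun al => g al x) x) =
  \sum_a \sum_b ip (fun x => (t x)%:C * q a b x * f a x) (fun x => (t x)%:C * g b x).
Proof.
move=> ct Lf Lg.
have L1 a b : L2 (fun x => (t x)%:C * q a b x * f a x) by apply: Lf; exact: cutoff_mul.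
have L2' b : L2 (fun x => (t x)%:C * g b x) by exact: Lg.
have E : (fun x => (t x ^+ 2)%:C * bform (fun al => f al x) (fun al => g al x) x) =
    fun x => \sum_a \sum_b ((t x)%:C * q a b x * f a x) * ((t x)%:C * g b x)^*.
  apply/funext => x; rewrite /bform mulr_sumr; apply: eq_bigr => a _.
  rewrite mulr_sumr; apply: eq_bigr => b _; rewrite conjcM conjc_real rmorphXn /=; ring.
rewrite E; have H a := cI_sum (index_enum 'I_N) xpredT (fun b => cinteg_ip (L1 a b) (L2' b)).
have [I1 E1] := cI_sum (index_enum 'I_N) xpredT (fun a => (H a).1).
split=> //; rewrite E1; apply: eq_bigr => a _; exact: (H a).2.
Qed.

Let Lw h : cutoff Omega h -> forall r al, L2 (fun x => h x * w r al x).
Proof. by move=> ch r al; exact: (L2_cutoffB oO (fun r => Lu_ r al)). Qed.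

Let wn h : cutoff Omega h -> forall al, wnull (fun r x => h x * w r al x).
Proof. by move=> ch al; exact: (wnull_cutoff oO (fun r => Lu_ r al) (Lu al) (u_weak al)). Qed.

(** Expanding the form at [u_r = u + w_r] leaves two mixed terms, each a finite sum of products of a
    fixed L^2 function with a weakly null sequence. *)
Lemma qint_cvg phi : test Omega phi ->
  normc (cI mu (fun x => (phi x)%:C * qform (fun al be => q al be x) (fun al => u_ r al x)) -
    cI mu (fun x => (phi x)%:C * qform (fun al be => q al be x) (fun al => u al x)) -
    qint w q phi r) @[r --> \oo] --> (0 : R).
Proof.
move=> tp; have ct := C0_cutoff (test_C0 (test_sqrt tp)); have [_ p0 _] := tp.
pose t x := Num.sqrt (phi x).
have t2 x : t x ^+ 2 = phi x by rewrite sqr_sqrtr.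
have Lur r h : cutoff Omega h -> forall al, L2 (fun x => h x * u_ r al x).
  by move=> ch al; exact: (L2_cutoff oO ch).
have Luu h : cutoff Omega h -> forall al, L2 (fun x => h x * u al x).
  by move=> ch al; exact: (L2_cutoff oO ch).
have Lww r h : cutoff Omega h -> forall al, L2 (fun x => h x * w r al x).
  by move=> ch al; exact: Lw.
have [Iuu _] := cI_bform ct Luu Luu.
have Iww r := (cI_bform ct (Lww r) (Lww r)).1.
have [Iuw Euw] := (fun r => (cI_bform ct Luu (Lww r)).1, fun r => (cI_bform ct Luu (Lww r)).2).
have [Iwu Ewu] := (fun r => (cI_bform ct (Lww r) Luu).1, fun r => (cI_bform ct (Lww r) Luu).2).
apply: (@squeeze0 _ _ (fun r =>
  \sum_a \sum_b normc (ip (fun x => (t x)%:C * q a b x * u a x) (fun x => (t x)%:C * w r b x)) +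
  \sum_a \sum_b normc (ip (fun x => (t x)%:C * q a b x * w r a x) (fun x => (t x)%:C * u b x)))).
  move=> r; rewrite normc_ge0 andTb.
  have E : cI mu (fun x => (phi x)%:C * qform (fun al be => q al be x) (fun al => u_ r al x)) =
      cI mu (fun x => (phi x)%:C * qform (fun al be => q al be x) (fun al => u al x)) + qint w q phi r +
      (\sum_a \sum_b ip (fun x => (t x)%:C * q a b x * u a x) (fun x => (t x)%:C * w r b x) +
       \sum_a \sum_b ip (fun x => (t x)%:C * q a b x * w r a x) (fun x => (t x)%:C * u b x)).
    have I1 : cinteg mu (fun x => (phi x)%:C * qform (fun al be => q al be x) (fun al => u al x)).
      by move: Iuu; under eq_fun do rewrite t2.
    have I2 : cinteg mu (fun x => (phi x)%:C * qform (fun al be => q al be x) (fun al => w r al x)).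
      by move: (Iww r); under eq_fun do rewrite t2.
    rewrite -(Euw r) -(Ewu r) -(cID (Iuw r) (Iwu r)) /qint -(cID I1 I2).
    rewrite -(cID (cintegD I1 I2) (cintegD (Iuw r) (Iwu r))).
    congr cI; apply/funext => x; rewrite t2 -!mulrDr; congr (_ * _).
    rewrite /qform /bform -!big_split; apply: eq_bigr => a _.
    rewrite -!big_split; apply: eq_bigr => b _ /=.
    have -> : (u_ r b x)^* = (u b x)^* + (u_ r b x - u b x)^* by rewrite conjcB; ring.
    by ring.
  rewrite E; set s1 := \sum_a _; set s2 := \sum_a _.
  have -> (z1 z2 : C) : z1 + z2 + (s1 + s2) - z1 - z2 = s1 + s2 by ring.
  apply: le_trans (le_normcD _ _) _; apply: lerD.
    by apply: le_trans (normc_sum _ _) _; apply: ler_sum => a _; exact: normc_sum.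
  by apply: le_trans (normc_sum _ _) _; apply: ler_sum => a _; exact: normc_sum.
suff : (\sum_a \sum_b normc (ip (fun x => (t x)%:C * q a b x * u a x) (fun x => (t x)%:C * w r b x)) +
  \sum_a \sum_b normc (ip (fun x => (t x)%:C * q a b x * w r a x) (fun x => (t x)%:C * u b x)))
  @[r --> \oo] --> (0 + 0 : R) by rewrite addr0.
have cq a b : cutoff Omega (fun x => (t x)%:C * q a b x) by exact: cutoff_mul.
apply: cvgD.
  apply: (@cvg_sum0 _ _ _ (fun a r => \sum_b normc (ip (fun x => (t x)%:C * q a b x * u a x) (fun x => (t x)%:C * w r b x)))) => a.
  apply: (@cvg_sum0 _ _ _ (fun b r => normc (ip (fun x => (t x)%:C * q a b x * u a x) (fun x => (t x)%:C * w r b x)))) => b.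
  have := wn ct b (Luu _ (cq a b) a); apply: squeeze0 => r.
  rewrite normc_ge0 andTb.
  have -> := ip_conj (Lww r _ ct b) (Luu _ (cq a b) a).
  by rewrite normc_conj.
apply: (@cvg_sum0 _ _ _ (fun a r => \sum_b normc (ip (fun x => (t x)%:C * q a b x * w r a x) (fun x => (t x)%:C * u b x)))) => a.
apply: (@cvg_sum0 _ _ _ (fun b r => normc (ip (fun x => (t x)%:C * q a b x * w r a x) (fun x => (t x)%:C * u b x)))) => b.
exact: (wn (cq a b) a (Luu _ ct b)).
Qed.

Hypothesis pos : forall delta phi, 0 < delta -> test Omega phi -> almost_pos w q delta phi.

(** The energies are bounded because weakly null sequences are, and [pos] holds for every [delta];
    taking [delta] small relative to this bound makes the energy term negligible. *)
Lemma limit_ge phi (P : C) : test Omega phi ->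
  ccvg (fun r => cI mu (fun x => (phi x)%:C * qform (fun al be => q al be x) (fun al => u_ r al x))) P ->
  Re (cI mu (fun x => (phi x)%:C * qform (fun al be => q al be x) (fun al => u al x))) <= Re P.
Proof.
move=> tp cP; rewrite leNgt; apply/negP => PQ.
set Q := cI _ _ in PQ.
have [E [E0 HE]] : exists E, 0 <= E /\ forall r, energy w phi r <= E.
  have ct := C0_cutoff (test_C0 (test_sqrt tp)).
  have [B HB] := choice (fun al => weak_bounded (fun r => Lw ct r al) (wn ct al)).
  exists (\sum_al B al ^+ 2); split; first by apply: sumr_ge0 => al _; exact: sqr_ge0.
  move=> r; apply: ler_sum => al _; have [B0 Br] := HB al.
  by rewrite -sqr_nrm ler_pXn2r ?nnegrE ?nrm_ge0//; exact: Br.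
(* A quarter of the supposed gap, for four errors: the energy term, the slack of [almost_pos], the
   mixed terms, and the distance to the limit [P]. *)
pose e := (Re Q - Re P) / 4.
have e0 : 0 < e by rewrite divr_gt0// subr_gt0.
have d0 : 0 < e / (E + 1) by rewrite divr_gt0// ltr_wpDl.
have [r1 H1] := pos d0 tp e0.
have [r2 H2] := (cvg0P _).1 (qint_cvg tp) e e0.
have [r3 H3] := (cvg0P _).1 ((ccvg_normc _ _).1 cP) e e0.
pose r := maxn r1 (maxn r2 r3).
have l1 : (r1 <= r)%N by rewrite leq_maxl.
have l2 : (r2 <= r)%N by rewrite /r maxnCA leq_maxl.
have l3 : (r3 <= r)%N by rewrite /r maxnA leq_maxr.
have {}H1 := H1 r l1; have {}H2 := H2 r l2; have {}H3 := H3 r l3.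
rewrite ger0_norm ?normc_ge0// in H2; rewrite ger0_norm ?normc_ge0// in H3.
move: H2 H3; rewrite -/Q; set z := cI _ _ => H2 H3.
have := le_lt_trans (normc_Re _) H2; rewrite !cReB ltr_norml => /andP[a1 a2].
have := le_lt_trans (normc_Re _) H3; rewrite !cReB ltr_norml => /andP[b1 b2].
have dE : e / (E + 1) * energy w phi r <= e.
  apply: (@le_trans _ _ (e / (E + 1) * E)); first by rewrite ler_wpM2l// ltW.
  by rewrite mulrAC ler_pdivrMr ?ltr_wpDl// ler_wpM2l ?(ltW e0)// lerDl.
have e4 : Re Q - Re P = e * 4 by rewrite /e divfK.
move: H1 a1 a2 b1 b2 dE e4 e0; rewrite mulNr; move: (_ * energy _ _ _) (Re (qint _ _ _ _)) (Re Q) (Re P) (Re z) => *; lra.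
Qed.

End weak_limit.

(** * The inequality between measures *)

Section measure_inequality.
Context {R : realType} {n : nat}.
Local Notation "x ^*" := (conjc x) : ring_scope.
Local Notation Rn := 'rV[R]_n.
Local Notation C := R[i].
Local Notation mu := (@leb R n).

Lemma integrable_indic (nu : {measure set Rn -> \bar R}) (K : set Rn) : measurable K ->
  (nu K < +oo)%E -> nu.-integrable setT (EFin \o (\1_K : Rn -> R)).
Proof.
move=> mK fK; apply/integrableP; split; first by apply/measurable_EFinP; exact: measurable_indic.
rewrite (eq_integral (fun x => (\1_K x)%:E)); last first.
  by move=> x _ /=; rewrite ger0_norm// indicE.
by rewrite integral_indic// setIT.
Qed.

Lemma test_sandwich (F B G : set Rn) (phi : Rn -> R) : F `<=` B -> B `<=` G ->
  (forall x, 0 <= phi x) -> (forall x, phi x <= 1) -> (forall x, F x -> phi x = 1) ->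
  (forall x, ~ G x -> phi x = 0) -> forall x, `|phi x - \1_B x| <= \1_(G `\` F) x.
Proof.
move=> FB BG p0 p1 pF pG x; rewrite !indicE.
have [Fx|nFx] := pselect (F x).
  by rewrite pF// mem_set ?subrr ?normr0//; exact: FB.
have [Gx|nGx] := pselect (G x); last first.
  by rewrite pG// memNset ?subrr ?normr0// => /BG.
rewrite [x \in _ `\` _]mem_set//.
by have := p0 x; have := p1 x; case: (x \in B); rewrite /= ler_norml => *; apply/andP; split; lra.
Qed.

(** One test function must approximate the indicator of [B] for three measures at once: [|f| dx] and
    both parts of [v]. Uniting the inner sets and intersecting the outer ones given by regularity
    achieves this, with an error [e / 3] for each. *)
Lemma test_Mloc_ge_density (Omega : set Rn) (v : Mloc Omega) (f : Rn -> C) : open Omega ->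
  (forall K, compact K -> K `<=` Omega -> cinteg mu (fun x => (\1_K x)%:C * f x)) ->
  (forall x, Omega x -> Im (f x) = 0) ->
  (forall phi, test Omega phi ->
    Re (cI mu (fun x => (phi x)%:C * f x)) <= Re (Mloc_pairing v (fun x => (phi x)%:C))) ->
  Mloc_ge_density f v.
Proof.
move=> oO If f_real Hf B K mB cK KO BK.
have [psi [tpsi psi1 psiK]] := urysohn_bump cK oO KO.
have [cpsi psi0 [K' [cK' KO' K0']]] := tpsi.
(* An open neighbourhood of [K] inside a compact subset [K'] of [Omega]. Outer approximations of [B]
   may leave [K], so regularity is taken relative to [K']. *)
pose V := psi @^-1` [set t | 0 < t].
have oV : open V by apply: open_comp => [x _|]; [exact: cpsi|exact: open_gt].
have VK' : V `<=` K'.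
  by move=> x Vx; apply: contrapT => /K0' p0; move: Vx; rewrite /V/= p0 ltxx.
have KV : K `<=` V by move=> x /psiK; rewrite /V/= => ->.
have BK' : B `<=` K' by apply: subset_trans BK _; exact: subset_trans KV VK'.
have mK' := compact_rV_measurable cK'.
have If' := If K' cK' KO'.
pose h x := Re ((\1_K' x)%:C * f x).
have ih : mu.-integrable setT (EFin \o h) := If'.1.
have hE x : K' x -> h x = Re (f x).
  by move=> Kx; rewrite /h indicE mem_set// mul1r.
have mh : measurable_fun setT (fun x => (`|h x|)%:E).
  by apply/measurable_EFinP; apply: measurableT_comp => //; exact: (cinteg_meas If').1.
have h0 x : (0 <= (`|h x|)%:E)%E by rewrite lee_fin.
pose m1 := density_of mu mh h0.
have fin1 : (m1 K' < +oo)%E.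
  have /integrableP[_] := integrableS measurableT mK' (@subsetT _ K') ih.
  by [].
(* The order on complex numbers compares real parts and asks for equal imaginary parts; the latter
   is [f_real]. *)
rewrite /cint lecE /=; apply/andP; split.
  rewrite eq_sym /= (eq_Rintegral mu (g := fun=> 0)) ?Rintegral_cst ?mul0r//.
  by move=> x /set_mem /BK /KO; exact: f_real.
rewrite (eq_Rintegral mu (g := h)); last by move=> x /set_mem /BK' /hE.
apply/ler_addgt0Pr => e e0; have e3 : 0 < e / 3 by rewrite divr_gt0.
have [F1 [G1 [cF1 oG1 FB1 BG1 D1]]] := measurable_regular mK' fin1 mB e3.
have [F2 [G2 [cF2 oG2 FB2 BG2 D2]]] := measurable_regular mK' (Mpos_fin v cK' KO') mB e3.
have [F3 [G3 [cF3 oG3 FB3 BG3 D3]]] := measurable_regular mK' (Mneg_fin v cK' KO') mB e3.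
pose F := F1 `|` F2 `|` F3; pose G := G1 `&` G2 `&` G3 `&` V.
have FB : F `<=` B by move=> x [[]|]; [exact: FB1|exact: FB2|exact: FB3].
have BG : B `<=` G.
  by move=> x Bx; split; [split; [split|]|]; [exact: BG1|exact: BG2|exact: BG3|exact/KV/BK].
have cF : closed F by apply: closedU => //; exact: closedU.
have oG : open G by do 3?[apply: openI => //].
have cptF : compact F by apply: (subclosed_compact cF cK); exact: subset_trans FB BK.
have [phi [tphi phi1 phiF]] := urysohn_bump cptF oG (subset_trans FB BG).
have [cphi phi0 [L [cL LG L0]]] := tphi.
have GK' : G `<=` K' by move=> x [_ /VK'].
have tO : test Omega phi.
  split => //; exists L; split => //; apply: subset_trans LG _; exact: subset_trans GK' KO'.
have phiG x : ~ G x -> phi x = 0 by move=> nG; apply: L0 => /LG.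
have mphi : measurable_fun setT phi.
  apply: (continuous_rV_measurable openT); exact: continuous_subspaceT.
pose D := G `\` F.
have mD : measurable D by apply: measurableD; [exact: open_rV_measurable|exact: closed_rV_measurable].
have DK' : D `<=` K' by move=> x [/GK'].
have sw := test_sandwich FB BG phi0 phi1 phiF phiG.
have Dle (nu : {measure set Rn -> \bar R}) F' G' : closed F' -> open G' -> D `<=` G' `\` F' ->
    (nu ((G' `\` F') `&` K') <= (e / 3)%:E)%E -> fine (nu D) <= e / 3.
  move=> cF' oG' DFG H.
  have le : (nu D <= (e / 3)%:E)%E.
    apply: le_trans H; apply: le_measure; rewrite ?inE//.
      apply: measurableI => //; apply: measurableD; first exact: open_rV_measurable.
      exact: closed_rV_measurable.
    by move=> x Dx; split; [exact: DFG|exact: DK'].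
  rewrite -lee_fin fineK// ge0_fin_numE//; apply: le_lt_trans le _; exact: ltry.
have d1 : \int[mu]_(x in D) `|h x| <= e / 3.
  apply: (Dle m1 F1 G1) => // x [[[[g1 _] _] _] nF]; split => // F1x; apply: nF; left; left.
  exact: F1x.
have d2 : fine (Mpos v D) <= e / 3.
  by apply: (Dle _ F2 G2) => // x [[[[_ g2] _] _] nF]; split => // F2x; apply: nF; left; right.
have d3 : fine (Mneg v D) <= e / 3.
  by apply: (Dle _ F3 G3) => // x [[[_ g3] _] nF]; split => // F3x; apply: nF; right.
have s1 := Rintegral_sandwich mB mD mphi ih sw.
have val (nu : {measure set Rn -> \bar R}) : (nu K' < +oo)%E ->
    `|Re (cint nu Omega (fun x => (phi x)%:C)) - fine (nu B)| <= fine (nu D).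
  move=> fK'; have := Rintegral_sandwich mB mD mphi (integrable_indic mK' fK') sw.
  have E1 (A : set Rn) : measurable A -> A `<=` K' -> \int[nu]_(x in A) (\1_K' x : R) = fine (nu A).
    move=> mA AK; rewrite (eq_Rintegral nu (g := fun=> 1)) ?Rintegral_cst ?mul1r//.
    by move=> x /set_mem /AK Kx; rewrite indicE mem_set.
  have E2 : \int[nu]_(x in D) `|\1_K' x : R| = fine (nu D).
    rewrite -(E1 D mD DK'); apply: eq_Rintegral => x _.
    by rewrite ger0_norm// indicE.
  rewrite (E1 B mB BK') E2 cint_cI; last first.
    move=> x nO; rewrite phiG// => /GK' /KO'; exact: nO.
  rewrite cI_real /=; congr (`|_ - _| <= _).
  apply: eq_Rintegral => x _; rewrite indicE.
  have [Kx|nKx] := pselect (K' x); first by rewrite mem_set// mulr1.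
  by rewrite phiG ?mul0r// => /GK'.
have v2 := val _ (Mpos_fin v cK' KO'); have v3 := val _ (Mneg_fin v cK' KO').
have := Hf phi tO; rewrite /Mloc_pairing cReB.
have -> : Re (cI mu (fun x => (phi x)%:C * f x)) = \int[mu]_x (phi x * h x).
  rewrite /cI /=; apply: eq_Rintegral => x _; rewrite cReM /= mul0r subr0.
  have [Kx|nKx] := pselect (K' x); first by rewrite hE.
  by rewrite phiG ?mul0r// => /GK'.
move: s1 v2 v3 d1 d2 d3; rewrite /Mloc_val !ler_norml.
move: (\int[mu]_x _) (\int[mu]_(x in B) _) (\int[mu]_(x in D) _) (Re _) (Re _).
move: (fine (Mpos v D)) (fine (Mneg v D)) (fine (Mpos v B)) (fine (Mneg v B)).
move=> x1 x2 x3 x4 x5 x6 x7 x8 x9 /andP[a1 a2] /andP[b1 b2] /andP[c1 c2]; lra.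
Qed.

End measure_inequality.

Section hermitian.
Context {R : realType} {N : nat}.
Local Notation "x ^*" := (conjc x) : ring_scope.
Local Notation C := R[i].

(** Conjugating and exchanging the two summation indices reproduces the form, which therefore equals
    its conjugate. *)
Lemma qform_herm (q : 'I_N -> 'I_N -> C) (l : 'I_N -> C) :
  (forall a b, q b a = (q a b)^*) -> Im (qform q l) = 0.
Proof.
move=> hq.
have conj_sum (I : Type) (r : seq I) (F : I -> C) :
  (\sum_(i <- r) F i)^* = \sum_(i <- r) (F i)^* by exact: rmorph_sum.
have : (qform q l)^* = qform q l.
  rewrite /qform [RHS]exchange_big conj_sum; apply: eq_bigr => a _.
  rewrite conj_sum; apply: eq_bigr => b _.
  by rewrite !conjcM conjcK -hq; ring.
move=> /(congr1 Im); rewrite cImC => /eqP; rewrite eq_sym -addr_eq0 -mulr2n mulrn_eq0 /=.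
by move/eqP.
Qed.

End hermitian.

Theorem theorem4p1 (R : realType) (n N m M : nat) (Omega : set 'rV[R]_n)
  (u_ : nat -> 'rV[R]_n -> 'rV[R[i]]_N) (u : 'rV[R]_n -> 'rV[R[i]]_N)
  (p c : 'I_m -> 'I_N -> 'I_M -> 'rV[R]_n -> R[i])
  (q : 'I_N -> 'I_N -> 'rV[R]_n -> R[i]) (v : Mloc Omega)
  (Omega_open : open Omega)
  (u_L2loc : forall (r : nat) (alpha : 'I_N),
    L2loc Omega (fun x => u_ r x 0 alpha))
  (u_lim_L2loc : forall alpha : 'I_N, L2loc Omega (fun x => u x 0 alpha))
  (u_weak : forall alpha : 'I_N,
    L2loc_weak_cvg Omega (fun r x => u_ r x 0 alpha) (fun x => u x 0 alpha))
  (p_A : forall (s : 'I_m) (alpha : 'I_N) (k : 'I_M), algA (p s alpha k))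
  (c_cont : forall (s : 'I_m) (alpha : 'I_N) (k : 'I_M),
    ccontinuous Omega (c s alpha k))
  (precompact : forall (Phi : 'rV[R]_n -> R[i]) (s : 'I_m),
    C0infty Omega Phi ->
    L2loc_precompact Omega (fun r x =>
      \sum_(alpha < N) \sum_(k < M)
        c s alpha k x *
        psdoA (p s alpha k) (fun y => Phi y * u_ r y 0 alpha) x))
  (q_cont : forall alpha beta : 'I_N, ccontinuous Omega (q alpha beta))
  (q_herm : forall (alpha beta : 'I_N) (x : 'rV[R]_n), Omega x ->
    q beta alpha x = (q alpha beta x)^*)
  (q_weak : Mloc_weak_cvg (fun r x => hform q x (u_ r x)) v)
  (q_ge0 : forall (x : 'rV[R]_n) (lambda : 'rV[R[i]]_N), Omega x ->
    LambdaSet p c x lambda -> 0 <= hform q x lambda) :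
  Mloc_ge_density (fun x => hform q x (u x)) v.
Proof.
pose ur r (al : 'I_N) (x : 'rV[R]_n) : R[i] := u_ r x 0 al.
pose uu (al : 'I_N) (x : 'rV[R]_n) : R[i] := u x 0 al.
pose w r al x := ur r al x - uu al x.
have Lur h : cutoff Omega h -> forall al, L2 (fun x => h x * uu al x).
  by move=> ch al; exact: (L2_cutoff Omega_open ch (u_lim_L2loc al)).
have w_L2 h : cutoff Omega h -> forall r al, L2 (fun x => h x * w r al x).
  by move=> ch r al; exact: (L2_cutoffB Omega_open (fun r => u_L2loc r al) (u_lim_L2loc al) r ch).
have w_null h : cutoff Omega h -> forall al, wnull (fun r x => h x * w r al x).
  move=> ch al.
  exact: (wnull_cutoff Omega_open (fun r => u_L2loc r al) (u_lim_L2loc al) (u_weak al)).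
have pL s al k : Linfty (p s al k) by case: (p_A s al k).
have w_prec g Phi s : cutoff Omega g -> C0infty Omega Phi ->
    nrm (fun x => \sum_al \sum_k g x * c s al k x *
      psdoA (p s al k) (fun y => Phi y * w r al y) x) @[r --> \oo] --> (0 : R).
  move=> cg CPhi; have [CP _ _] := CPhi.
  exact: (precompact_cvg0 Omega_open (u_ := ur) (u := uu) u_L2loc u_lim_L2loc u_weak
    (pL s) (c_cont s) cg CP (precompact Phi s CPhi)).
have q_pos x : Omega x -> forall (l : 'I_N -> R[i]) eta, spectrum eta ->
    (forall s, \sum_al \sum_k c s al k x * gelfand (p s al k) eta * l al = 0) ->
    0 <= Re (qform (fun al be => q al be x) l).
  move=> Ox l eta Seta H.
  have /(q_ge0 _ _ Ox) : LambdaSet p c x (\row_al l al).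
    exists eta => // s; rewrite -[RHS](H s); apply: eq_bigr => al _; apply: eq_bigr => k _.
    by rewrite mxE.
  have -> : hform q x (\row_al l al) = qform (fun al be => q al be x) l.
    by apply: eq_bigr => al _; apply: eq_bigr => be _; rewrite !mxE.
  by rewrite lecE /= => /andP[].
have pos delta phi : 0 < delta -> test Omega phi -> almost_pos w q delta phi.
  move=> d0; apply: (global_estimate Omega_open w_L2 q_cont) => x0 Ox0.
  exact: (local_estimate Omega_open w_L2 w_null p_A c_cont q_cont w_prec q_pos Ox0 d0).
apply: test_Mloc_ge_density => // [K cK KO|x Ox|phi tphi].
(* The indicator of [K] equals its own square, so it can play the part of the squared weight. *)
- have := (cI_bform Omega_open q_cont (cutoff_indic cK KO) Lur Lur).1.
  congr cinteg; apply/funext => x; congr (_%:C * _).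
  by rewrite indicE; case: (x \in K); rewrite ?expr1n ?expr0n.
- by apply: qform_herm => a b; exact: q_herm.
- apply: (limit_ge Omega_open u_L2loc u_lim_L2loc u_weak q_cont pos tphi).
  have := q_weak _ (test_C0 tphi); congr ccvg; apply/funext => r.
  rewrite cint_cI => [|x nO]; first by congr cI; apply/funext => x /=; rewrite mulrC.
  rewrite /=; have [_ _ [L [_ LO L0]]] := tphi.
  by rewrite L0 ?mulr0// => /LO.
Qed.
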